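(* Terao's conjecture holds for line arrangements in $\mathbb{CP}^2$ of cardinality less than $11$: if $\mathcal B$ and $\mathcal B'$ are line arrangements in $\mathbb{CP}^2$ with isomorphic intersection lattices, each consisting of fewer than $11$ lines, and $\mathcal B$ is free, then $\mathcal B'$ is free.
   Context: A line arrangement $\mathcal A$ in $\mathbb{CP}^2$ is a finite set of distinct projective lines, equivalently a finite set of 2-dimensional linear subspaces $\ker\alpha_H$ ($H\in\mathcal A$) of $\mathbb C^3$. With $S=\mathbb C[x,y,z]$, $\mathcal A$ is called free if the $S$-module $D(\mathcal A)=\{\theta\in\mathrm{Der}_{\mathbb C}(S)\mid\theta(\alpha_H)\in\alpha_HS\ \text{for all }H\in\mathcal A\}$ is free. The intersection lattice of $\mathcal A$ is the set of all intersections of subfamilies of these subspaces of $\mathbb C^3$, ordered by reverse inclusion. *)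

(* Defs.v *)
From HB Require Import structures.
From mathcomp Require Import all_boot all_order all_algebra finmap.
From mathcomp Require Import boolp classical_sets functions reals.
From mathcomp Require Import complex mpoly.

Set Implicit Arguments.
Unset Strict Implicit.
Unset Printing Implicit Defensive.

Import GRing.Theory Num.Theory.

Local Open Scope ring_scope.

Section FreeModule.
Variables (S : nzRingType) (V : lmodType S).

(* [B] may be infinite, as in the definition of a free module; sums are taken
   over finite sequences of elements of [B]. *)
Definition is_basis_of (D B : set V) : Prop :=
  [/\ (B `<=` D)%classic,
      forall v, D v -> exists (s : seq V) (c : V -> S),
        (forall b, b \in s -> B b) /\ v = \sum_(b <- s) c b *: b
    & forall (s : seq V) (c : V -> S),
        uniq s -> (forall b, b \in s -> B b) ->
        \sum_(b <- s) c b *: b = 0 -> forall b, b \in s -> c b = 0].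

(* For [D] a submodule of [V]. *)
Definition free_module (D : set V) : Prop := exists B : set V, is_basis_of D B.

End FreeModule.

Section Arrangements.
Variable R : realType.

Local Notation C := R[i].
Local Notation S := {mpoly C[3]}.
Local Notation subspace := {vspace 'rV[C]_3}.

(* A projective line is a 2-dimensional linear subspace of C^3. *)
Definition line_arrangement (A : {fset subspace}) : Prop :=
  forall H, H \in A -> \dim H = 2%N.

Definition linear_form_of (H : subspace) (alpha : S) : Prop :=
  alpha \is 1.-homog /\ forall v, (v \in H) = (alpha.@[v ord0] == 0).

(* The regular module [S^o] in the codomain makes the pointwise scaling of
   functions by elements of [S] available. *)
Definition is_derivation (theta : S -> S^o) : Prop :=
  (forall (a : C) (p q : S),
      theta (a *: p + q) = a *: (theta p : S) + theta q) /\
  (forall p q : S, theta (p * q) = theta p * q + p * theta q).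

(* The linear form of a plane is determined up to a nonzero scalar, on which
   the condition does not depend. *)
Definition log_derivations (A : {fset subspace}) : set (S -> S^o) :=
  [set theta | is_derivation theta /\
     forall H, H \in A -> forall alpha : S, linear_form_of H alpha ->
       exists q : S, theta alpha = alpha * q]%classic.

Definition free_arrangement (A : {fset subspace}) : Prop :=
  free_module (log_derivations A).

(* The empty subfamily is included, with intersection the whole of C^3. *)
Definition intersection_lattice (A : {fset subspace}) : {fset subspace} :=
  [fset (\bigcap_(H <- enum_fset B) H)%VS | B : {fset subspace} in fpowerset A]%fset.

Definition lattice_le (X Y : subspace) : bool := (Y <= X)%VS.

Definition lattice_isomorphic (A A' : {fset subspace}) : Prop :=
  exists2 f : intersection_lattice A -> intersection_lattice A',
    bijective f &
    forall X Y, lattice_le (val (f X)) (val (f Y)) =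
                lattice_le (val X) (val Y).

End Arrangements.

(* Main.v *)
Require Import Defs.
From HB Require Import structures.
From mathcomp Require Import all_boot all_order all_algebra finmap.
From mathcomp Require Import reals complex.
From mathcomp Require Import mpoly ring zify.
From mathcomp Require boolp classical_sets functions.

Set Implicit Arguments.
Unset Strict Implicit.
Unset Printing Implicit Defensive.

Import GRing.Theory Num.Theory.

Local Open Scope ring_scope.

(** Write Q for the product of the linear forms of an arrangement of n lines and x for the
    Euler field. By Saito's criterion the arrangement (n > 0) is free exactly when there are
    homogeneous logarithmic fields th1, th2 of some degrees a, b (the exponents) whose
    determinant with x is a nonzero constant times Q; then a + b + 1 = n. The plan is to show
    by induction on n that, for n < 11, such a pair exists for one arrangement if and only if
    it exists, with the same degrees, for every arrangement with the same concurrent triples.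

    The induction removes a line H carrying h intersection points. Restrict a logarithmic
    field that kills the form of H to H, and take its determinant with the Euler field of H:
    this is a binary form of degree one more than the field, divisible by the product of the
    h points. If h > a, comparing degrees produces a field divisible by the form of H, so that
    the arrangement without H is free, with exponents (a, b - 1) and h = a + 1, or (a - 1, b)
    and h = b + 1 (lemma [deletion]). Conversely, if n lines different from H meet it
    in h points, the value of a logarithmic field on the form of H restricts to a multiple of
    a fixed product of n - h linear forms on H. If moreover h - 1 is one of the exponents, the
    other one is n - h, and the field of degree h - 1 can be corrected by a multiple of the
    other one to become tangent to H, up to an exchange of the two fields when a = b (lemma
    [addition]). As h depends only on which lines
    are concurrent, [deletion] for the first arrangement, the induction hypothesis and
    [addition] for the second one settle every arrangement with a line carrying more than
    min(a, b) points.

    It remains to see what happens when every line carries at most a <= b points. Adding the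
    lines one at a time bounds the dimension of the space of logarithmic fields of a given large
    degree from below; a free basis bounds it from above, and the comparison yields
    ab + a + b <= s, where s is the sum of m - 1 over the intersection points of multiplicity m
    ([free_exps_npoints_sum]). On the other hand the sum of (m - 3)^2 is nonnegative, that is,
    9 s <= n (n - 1) + 4 (sum of the m), and the sum of the m is at most n a. For 1 < n < 11
    the two inequalities are compatible only if n = 9, a = b = 4 and all points are triple
    ([few_points_count]). Nine lines meeting only in triple points form the affine plane of
    order 3 ([steiner9]); over a field this configuration is unique up to coordinates and the
    choice of a primitive cube root of unity ([hesse_coordinates]): it is the dual Hesse
    arrangement (x^3 - y^3)(y^3 - z^3)(z^3 - x^3) = 0, which has an explicit basis
    ([ceva_free_exps]).

    Two translations complete the proof. A basis of the module of logarithmic derivations, in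
    whatever form it is given, has three elements, its determinant is a constant times Q,
    one of its members can be traded for x, and the others for homogeneous components
    ([exps_of_free_arrangement]). An isomorphism of intersection lattices maps lines to lines
    and preserves concurrency, because a line contains the intersection of two others exactly
    when it contains every element of the lattice that both of them contain
    ([lattice_iso_lines]). *)

(** * Divisibility and primes among polynomials in three variables *)

Definition o0 : 'I_3 := @Ordinal 3 0 isT.
Definition o1 : 'I_3 := @Ordinal 3 1 isT.
Definition o2 : 'I_3 := @Ordinal 3 2 isT.

Lemma ord3P (P : 'I_3 -> Prop) : P o0 -> P o1 -> P o2 -> forall i, P i.
Proof.
move=> P0 P1 P2 [[|[|[|i]]] //= lti];
  [move: P0|move: P1|move: P2]; congr (P _); exact: val_inj.
Qed.

Lemma sum3 (V : nmodType) (F : 'I_3 -> V) :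
  \sum_k F k = F o0 + F o1 + F o2.
Proof.
rewrite !big_ord_recr big_ord0 /= add0r.
by congr (F _ + F _ + F _); apply: val_inj.
Qed.

Section Divisibility.
Variable K : fieldType.
Local Notation S := {mpoly K[3]}.
Implicit Types (p q r F G : S) (u v w : 'rV[K]_3) (th : 'rV[S]_3).

Definition dvdm p q := exists r, q = r * p.

Lemma dvdmm p : dvdm p p. Proof. by exists 1; rewrite mul1r. Qed.
Lemma dvdm0 p : dvdm p 0. Proof. by exists 0; rewrite mul0r. Qed.
Lemma dvdm_trans p q r : dvdm p q -> dvdm q r -> dvdm p r.
Proof. by move=> [x ->] [y ->]; exists (y * x); rewrite mulrA. Qed.
Lemma dvdm_mull p q r : dvdm p q -> dvdm p (r * q).
Proof. by move=> [x ->]; exists (r * x); rewrite mulrA. Qed.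
Lemma dvdm_mulr p q r : dvdm p q -> dvdm p (q * r).
Proof. by rewrite mulrC; apply: dvdm_mull. Qed.
Lemma dvdm_add p q r : dvdm p q -> dvdm p r -> dvdm p (q + r).
Proof. by move=> [x ->] [y ->]; exists (x + y); rewrite mulrDl. Qed.
Lemma dvdm_opp p q : dvdm p q -> dvdm p (- q).
Proof. by move=> [x ->]; exists (- x); rewrite mulNr. Qed.
Lemma dvdm_sub p q r : dvdm p q -> dvdm p r -> dvdm p (q - r).
Proof. by move=> pq pr; apply/dvdm_add/dvdm_opp. Qed.
Lemma dvdm_mul p q r s : dvdm p q -> dvdm r s -> dvdm (p * r) (q * s).
Proof. by move=> [x ->] [y ->]; exists (x * y); rewrite mulrACA. Qed.
Lemma dvdm_mul2l p q r : p != 0 -> dvdm (p * q) (p * r) -> dvdm q r.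
Proof.
by move=> p0 [x]; rewrite mulrCA => /(mulfI p0) ->; exists x.
Qed.
Lemma dvdm_rmorph (f : {rmorphism S -> S}) p q : dvdm p q -> dvdm (f p) (f q).
Proof. by move=> [x ->]; exists (f x); rewrite rmorphM. Qed.

Definition primem p :=
  p != 0 /\ forall a b, dvdm p (a * b) -> dvdm p a \/ dvdm p b.

Lemma primem_prod p (I : eqType) (s : seq I) (f : I -> S) : primem p ->
  ~ dvdm p 1 -> dvdm p (\prod_(i <- s) f i) ->
  exists2 i, i \in s & dvdm p (f i).
Proof.
move=> [_ pP] p1; elim: s => [|i s IH]; first by rewrite big_nil.
rewrite big_cons => /pP [pi|/IH [j js pj]]; first by exists i; rewrite ?mem_head.
by exists j; rewrite // in_cons js orbT.
Qed.

(** The only consequence of unique factorization that is needed: a product of primes, none of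
    which divides G, can be cancelled against G one factor at a time. *)
Lemma prod_primem_cancel (I : eqType) (s : seq I) (f : I -> S) G q :
  {in s, forall i, primem (f i)} -> {in s, forall i, ~ dvdm (f i) G} ->
  dvdm (\prod_(i <- s) f i) (G * q) -> dvdm (\prod_(i <- s) f i) q.
Proof.
elim: s q => [|i s IH] q fP fG; first by exists q; rewrite big_nil mulr1.
rewrite big_cons => fsGq.
have [fi0 fiP] : primem (f i) by apply: fP; rewrite mem_head.
have fiGq : dvdm (f i) (G * q).
  by apply: dvdm_trans fsGq; apply/dvdm_mulr/dvdmm.
have [/fG|[q' eq_q]] := fiP _ _ fiGq; first by rewrite mem_head; case.
move: fsGq; rewrite {fiGq}eq_q => fsGq; rewrite [q' * _]mulrC; apply: dvdm_mul; first exact: dvdmm.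
apply: IH.
- by move=> j js; apply: fP; rewrite in_cons js orbT.
- by move=> j js; apply: fG; rewrite in_cons js orbT.
by apply: (dvdm_mul2l fi0); rewrite mulrCA [f i * q']mulrC.
Qed.

(** Linear forms restricted to a line become proportional when they pass through the same point.
    The classes of proportional factors are coprime to each other, so divisibility by the whole
    product may be tested class by class; [cl] names the classes. *)
Lemma prod_class_dvdm (I P : finType) (J : {set I}) (cl : I -> P) (f : I -> S) F :
  {in J, forall i, primem (f i) /\ ~ dvdm (f i) 1} ->
  {in J &, forall i j, dvdm (f i) (f j) -> cl i = cl j} ->
  (forall x : P, dvdm (\prod_(j in J | cl j == x) f j) F) ->
  dvdm (\prod_(j in J) f j) F.
Proof.
move=> fP fcl fF.
rewrite (partition_big cl predT) //=.
have := enum_uniq P; rewrite /index_enum -enumT.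
elim: (enum P) => [|x xs IH]; first by rewrite big_nil; exists F; rewrite mulr1.
rewrite big_cons cons_uniq => /andP[xxs /IH{IH} [q Fq]].
have [q' Fq'] : dvdm (\prod_(j in J | cl j == x) f j) q.
  rewrite -big_enum_cond /= -big_filter.
  apply: (prod_primem_cancel
    (G := \prod_(y <- xs) \prod_(i0 in J | cl i0 == y) f i0)).
  - move=> j; rewrite mem_filter mem_enum => /andP[_ jJ].
    by case: (fP _ jJ).
  - move=> j; rewrite mem_filter mem_enum => /andP[/eqP jx jJ].
    have [fj fj1] := fP _ jJ.
    move=> /(primem_prod fj fj1) [y yxs].
    rewrite -big_enum_cond /= -big_filter => /(primem_prod fj fj1) [k].
    rewrite mem_filter mem_enum => /andP[/eqP ky kJ] /(fcl _ _ jJ kJ).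
    by rewrite jx ky => xy; rewrite xy yxs in xxs.
  rewrite mulrC -Fq big_filter.
  by rewrite big_enum_cond /=; apply: fF.
by exists q'; rewrite Fq Fq' mulrA.
Qed.

End Divisibility.

(** * Linear forms and restriction to a plane *)

Section LinearForms.
Variable K : fieldType.
Local Notation S := {mpoly K[3]}.
Implicit Types (p q r F G : S) (u v w : 'rV[K]_3) (th : 'rV[S]_3).

Definition kdot u v : K := \sum_k u 0 k * v 0 k.
Definition dot u th : S := \sum_k (u 0 k)%:MP * th 0 k.
Definition euler : 'rV[S]_3 := \row_k 'X_k.
Definition lin u : S := dot u euler.

Lemma dotZD u c th1 th2 : dot u (c *: th1 + th2) = c * dot u th1 + dot u th2.
Proof. by rewrite /dot mulr_sumr -big_split; apply: eq_bigr => k _ /=; rewrite !mxE; ring. Qed.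
Lemma dotD u th1 th2 : dot u (th1 + th2) = dot u th1 + dot u th2.
Proof. by rewrite -[th1]scale1r dotZD mul1r scale1r. Qed.
Lemma dot0 u : dot u 0 = 0.
Proof. by rewrite /dot big1 // => k _; rewrite mxE mulr0. Qed.
Lemma dotZ u c th : dot u (c *: th) = c * dot u th.
Proof. by rewrite -[_ *: _]addr0 dotZD dot0 addr0. Qed.
Lemma dotB u th1 th2 : dot u (th1 - th2) = dot u th1 - dot u th2.
Proof. by rewrite -scaleN1r addrC dotZD mulN1r addrC. Qed.
Lemma dotDl u w th : dot (u + w) th = dot u th + dot w th.
Proof. by rewrite /dot -big_split; apply: eq_bigr => k _; rewrite !mxE mpolyCD mulrDl. Qed.
Lemma dotZl c u th : dot (c *: u) th = c%:MP * dot u th.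
Proof. by rewrite /dot mulr_sumr; apply: eq_bigr => k _; rewrite !mxE mpolyCM mulrA. Qed.
Lemma dotNl u th : dot (- u) th = - dot u th.
Proof. by rewrite -scaleN1r dotZl mpolyCN mulN1r. Qed.
Lemma dotBl u w th : dot (u - w) th = dot u th - dot w th.
Proof. by rewrite dotDl dotNl. Qed.

Lemma linD u w : lin (u + w) = lin u + lin w. Proof. exact: dotDl. Qed.
Lemma linB u w : lin (u - w) = lin u - lin w. Proof. exact: dotBl. Qed.
Lemma linZ c u : lin (c *: u) = c%:MP * lin u. Proof. exact: dotZl. Qed.
Lemma lin0 : lin 0 = 0. Proof. by rewrite -[0](scale0r 0) linZ mul0r. Qed.

Lemma linE u : lin u = \sum_k (u 0 k)%:MP * 'X_k.
Proof. by apply: eq_bigr => k _; rewrite mxE. Qed.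

(** Covectors and vectors are both rows; [kdot] pairs them, and [lin u] is the function that
    pairs with u. *)
Lemma meval_lin u v : (lin u).@[v 0] = kdot u v.
Proof.
rewrite linE rmorph_sum; apply: eq_bigr => k _.
by rewrite rmorphM /= mevalC mevalXU.
Qed.

Lemma kdot_delta u k : kdot u (delta_mx 0 k) = u 0 k.
Proof.
rewrite /kdot (bigD1 k) //= mxE !eqxx mulr1 big1 ?addr0 // => l lk.
by rewrite mxE (negPf lk) andbF mulr0.
Qed.

Lemma lin_inj : injective lin.
Proof.
by move=> u w uw; apply/rowP => k; rewrite -!kdot_delta -!meval_lin uw.
Qed.

Lemma lin_eq0 u : (lin u == 0) = (u == 0).
Proof. by rewrite -lin0 (inj_eq lin_inj). Qed.

Lemma lin_homog u : lin u \is 1.-homog.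
Proof.
rewrite linE; apply: rpred_sum => k _.
by rewrite mul_mpolyC rpredZ // dhomogX /= mdeg1.
Qed.

Lemma lin_delta k : lin (delta_mx 0 k) = 'X_k.
Proof.
rewrite linE (bigD1 k) //= mxE !eqxx mpolyC1 mul1r big1 ?addr0 // => l lk.
by rewrite mxE (negPf lk) andbF mpolyC0 mul0r.
Qed.

Lemma kdotC u v : kdot u v = kdot v u.
Proof. by apply: eq_bigr => k _; rewrite mulrC. Qed.
Lemma kdotDl u w v : kdot (u + w) v = kdot u v + kdot w v.
Proof. by rewrite /kdot -big_split; apply: eq_bigr => k _; rewrite mxE mulrDl. Qed.
Lemma kdotZl c u v : kdot (c *: u) v = c * kdot u v.
Proof. by rewrite /kdot mulr_sumr; apply: eq_bigr => k _; rewrite mxE mulrA. Qed.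
Lemma kdotNl u v : kdot (- u) v = - kdot u v.
Proof. by rewrite -scaleN1r kdotZl mulN1r. Qed.
Lemma kdotBl u w v : kdot (u - w) v = kdot u v - kdot w v.
Proof. by rewrite kdotDl kdotNl. Qed.

Lemma exists_kdot1 u : u != 0 -> exists v, kdot u v = 1.
Proof.
move=> /rV0Pn [k uk]; exists ((u 0 k)^-1 *: delta_mx 0 k).
by rewrite kdotC kdotZl kdotC kdot_delta mulVf.
Qed.

End LinearForms.

(** The projection of space along v onto the plane [lin u = 0] (when u pairs to 1 with v), acting
    on polynomials. It realizes the coordinate ring of the plane inside the polynomial ring, so
    that restricted polynomials can still be multiplied and compared with the others. Locked,
    because unfolding the substitution makes conversion tests explode. *)
HB.lock Definition restr (K : fieldType) (u v : 'rV[K]_3) (p : {mpoly K[3]}) :=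
  p \mPo [tuple 'X_i - (v 0 i)%:MP * lin u | i < 3].

Section RestrictionTheory.
Variable K : fieldType.
Local Notation S := {mpoly K[3]}.
Implicit Types (p q r F G : S) (u v w : 'rV[K]_3) (th : 'rV[S]_3).

Section Restriction.
Variables u v : 'rV[K]_3.
Local Notation rho := (restr u v).

Fact restr_is_zmod_morphism : zmod_morphism rho.
Proof. by move=> p q; rewrite restr.unlock rmorphB. Qed.
Fact restr_is_monoid_morphism : monoid_morphism rho.
Proof. by split=> [|p q]; rewrite restr.unlock ?rmorph1 ?rmorphM. Qed.
HB.instance Definition _ :=
  GRing.isZmodMorphism.Build S S rho restr_is_zmod_morphism.
HB.instance Definition _ :=
  GRing.isMonoidMorphism.Build S S rho restr_is_monoid_morphism.

Lemma restrC c : rho c%:MP = c%:MP. Proof. by rewrite restr.unlock comp_mpolyC. Qed.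

Lemma restrX k : rho 'X_k = 'X_k - (v 0 k)%:MP * lin u.
Proof. by rewrite restr.unlock comp_mpolyXU -tnth_nth tnth_mktuple. Qed.

Lemma restr_lin w : rho (lin w) = lin w - (kdot w v)%:MP * lin u.
Proof.
rewrite {1}linE rmorph_sum /= /kdot rmorph_sum /= mulr_suml linE -sumrB.
apply: eq_bigr => k _.
by rewrite rmorphM /= restrC restrX mpolyCM; ring.
Qed.

Lemma restr_linE w : rho (lin w) = lin (w - kdot w v *: u).
Proof. by rewrite restr_lin linB linZ. Qed.

Lemma restr_dot w th : rho (dot w th) = dot w (map_mx rho th).
Proof.
rewrite rmorph_sum; apply: eq_bigr => k _.
by rewrite rmorphM /= restrC mxE.
Qed.

Lemma dvdm_sub_restr p : dvdm (lin u) (p - rho p).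
Proof.
have subM q r : dvdm (lin u) (q - rho q) -> dvdm (lin u) (r - rho r) ->
    dvdm (lin u) (q * r - rho (q * r)).
  move=> Hq Hr; have -> : q * r - rho (q * r) = q * (r - rho r) + (q - rho q) * rho r.
    by rewrite rmorphM; ring.
  by apply: dvdm_add; [apply: dvdm_mull|apply: dvdm_mulr].
have sub1 : dvdm (lin u) (1 - rho 1) by rewrite rmorph1 subrr; apply: dvdm0.
elim/mpolyind: p => [|c m p _ _ IH]; first by rewrite rmorph0 subr0; apply: dvdm0.
rewrite rmorphD /= opprD addrACA; apply: dvdm_add => //.
rewrite -mul_mpolyC rmorphM /= restrC -mulrBr; apply: dvdm_mull => {c p IH}.
rewrite mpolyXE_id; elim/big_ind: _ => // i _.
elim: (m i) => // k IH; rewrite exprS; apply: subM => //.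
rewrite restrX subKr; exact/dvdm_mull/dvdmm.
Qed.

Lemma restr_homog d p : p \is d.-homog -> rho p \is d.-homog.
Proof.
move=> /dhomogP hp; rewrite restr.unlock comp_mpolyEX big_seq rpred_sum // => m mp.
apply: rpredZ; rewrite -(hp _ mp) comp_mpolyX /= mdegE.
elim/big_rec2: _ => [|i d' q _ IH]; first exact: dhomog1.
rewrite addnC mulrC; apply: dhomogM => //; rewrite tnth_mktuple.
suff: 'X_i - (v 0 i)%:MP * lin u \is 1.-homog by move/(dhomogMn (m i)); rewrite mul1n.
apply: rpredB; first by rewrite dhomogX /= mdeg1.
by rewrite mul_mpolyC rpredZ ?lin_homog.
Qed.

Hypothesis uv1 : kdot u v = 1.

Lemma restr_lin0 : rho (lin u) = 0.
Proof. by rewrite restr_lin uv1 mul1r subrr. Qed.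

(** Restriction is a ring morphism with values in a domain and the multiples of [lin u] as its
    kernel; this is why [lin u] is prime. *)
Lemma restr_eq0 p : dvdm (lin u) p <-> rho p = 0.
Proof.
split=> [[q ->]|rp0]; first by rewrite rmorphM /= restr_lin0 mulr0.
by have := dvdm_sub_restr p; rewrite rp0 subr0.
Qed.

Lemma restrK p : rho (rho p) = rho p.
Proof.
have /restr_eq0 := dvdm_sub_restr p.
by rewrite rmorphB => /subr0_eq/esym.
Qed.

End Restriction.

Lemma primem_lin u : u != 0 -> primem (lin u).
Proof.
move=> u0; split; first by rewrite lin_eq0.
have [v uv] := exists_kdot1 u0; move=> p q /(restr_eq0 uv).
rewrite rmorphM => /eqP; rewrite mulf_eq0.
by case/orP => /eqP/(restr_eq0 uv); [left|right].
Qed.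

Lemma dvdm_lin u w : u != 0 -> dvdm (lin u) (lin w) -> exists c, w = c *: u.
Proof.
move=> u0; have [v uv] := exists_kdot1 u0; move=> /(restr_eq0 uv).
rewrite restr_linE => /eqP; rewrite lin_eq0 subr_eq0 => /eqP ->.
by eexists.
Qed.

Lemma lin_ndvdm1 u : ~ dvdm (lin u) 1.
Proof.
move=> [q /(congr1 (meval ((0 : 'rV[K]_3) 0)))]; rewrite meval1 mevalM meval_lin.
rewrite /kdot big1 => [|k _]; last by rewrite mxE mulr0.
by rewrite mulr0 => /eqP; rewrite oner_eq0.
Qed.

End RestrictionTheory.

(** * Three by three determinants and homogeneous vector fields *)

Definition det3 (R : comNzRingType) (a b c : 'rV[R]_3) : R :=
  a 0 o0 * (b 0 o1 * c 0 o2 - b 0 o2 * c 0 o1)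
  - a 0 o1 * (b 0 o0 * c 0 o2 - b 0 o2 * c 0 o0)
  + a 0 o2 * (b 0 o0 * c 0 o1 - b 0 o1 * c 0 o0).

Section Det3.
Variable R : comNzRingType.
Implicit Types a b c w : 'rV[R]_3.

Lemma det3C a b c : det3 a c b = - det3 a b c.
Proof. by rewrite /det3; ring. Qed.

Lemma det3_rot a b c : det3 b c a = det3 a b c.
Proof. by rewrite /det3; ring. Qed.

Lemma det3ZDm s a b b' c : det3 a (s *: b + b') c = s * det3 a b c + det3 a b' c.
Proof. by rewrite /det3 !mxE; ring. Qed.

Lemma det3ZDr s a b c c' : det3 a b (s *: c + c') = s * det3 a b c + det3 a b c'.
Proof. by rewrite /det3 !mxE; ring. Qed.

Lemma det3Zl s a b c : det3 (s *: a) b c = s * det3 a b c.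
Proof. by rewrite /det3 !mxE; ring. Qed.
Lemma det3Zm s a b c : det3 a (s *: b) c = s * det3 a b c.
Proof. by rewrite /det3 !mxE; ring. Qed.
Lemma det3Zr s a b c : det3 a b (s *: c) = s * det3 a b c.
Proof. by rewrite /det3 !mxE; ring. Qed.

Lemma det3_aab a b : det3 a a b = 0. Proof. by rewrite /det3; ring. Qed.
Lemma det3_aba a b : det3 a b a = 0. Proof. by rewrite /det3; ring. Qed.
Lemma det3_abb a b : det3 a b b = 0. Proof. by rewrite /det3; ring. Qed.

(** The combinations of rows that occur below are stated over an abstract ring, where they are
    cheap to verify. *)
Lemma det3_elim s t a b c : det3 a (b - s *: a) (c - t *: a) = det3 a b c.
Proof. by rewrite /det3 !mxE; ring. Qed.
Lemma det3_combr s t a b c : det3 a b (s *: a + t *: c) = t * det3 a b c.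
Proof. by rewrite /det3 !mxE; ring. Qed.
Lemma det3_combm s t a b c : det3 a (s *: a + t *: b) c = t * det3 a b c.
Proof. by rewrite /det3 !mxE; ring. Qed.
Lemma det3_subr s t a b c : det3 a b (s *: c - t *: b) = s * det3 a b c.
Proof. by rewrite /det3 !mxE; ring. Qed.
Lemma det3_subm s t a b c : det3 a (s *: b - t *: c) c = s * det3 a b c.
Proof. by rewrite /det3 !mxE; ring. Qed.
Lemma det3_b0 a b : det3 a b 0 = 0.
Proof. by rewrite /det3 !mxE; ring. Qed.

Lemma det3_coefl r s t a b c : det3 (r *: a + s *: b + t *: c) b c = r * det3 a b c.
Proof. by rewrite /det3 !mxE; ring. Qed.
Lemma det3_coefm r s t a b c : det3 a (r *: a + s *: b + t *: c) c = s * det3 a b c.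
Proof. by rewrite /det3 !mxE; ring. Qed.
Lemma det3_coefr r s t a b c : det3 a b (r *: a + s *: b + t *: c) = t * det3 a b c.
Proof. by rewrite /det3 !mxE; ring. Qed.

Lemma cramer3 a b c w :
  det3 a b c *: w = det3 w b c *: a + det3 a w c *: b + det3 a b w *: c.
Proof. by apply/rowP; apply: ord3P; rewrite /det3 !mxE; ring. Qed.

End Det3.

Section Covectors.
Variable K : fieldType.
Local Notation S := {mpoly K[3]}.
Implicit Types (p q r F G : S) (u v w y : 'rV[K]_3) (a b c th : 'rV[S]_3).

Lemma dot3 u th : dot u th =
  (u 0 o0)%:MP * th 0 o0 + (u 0 o1)%:MP * th 0 o1 + (u 0 o2)%:MP * th 0 o2.
Proof. exact: sum3. Qed.

(** Multiplicativity of the determinant: the components of three fields with respect to a basis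
    of covectors. *)
Lemma det3_dots u v w a b c :
  (det3 u v w)%:MP * det3 a b c =
  dot u a * (dot v b * dot w c - dot w b * dot v c)
  - dot u b * (dot v a * dot w c - dot w a * dot v c)
  + dot u c * (dot v a * dot w b - dot w a * dot v b).
Proof.
rewrite !dot3 /det3 !(mpolyCD, mpolyCB, mpolyCM).
by ring.
Qed.

(** The easy half of Saito's criterion: replacing a column by a combination of the columns that
    involves it multiplies the determinant by a constant. *)
Lemma det3_dvd u r a b c : u != 0 ->
  dvdm r (dot u a) -> dvdm r (dot u b) -> dvdm r (dot u c) ->
  dvdm r (det3 a b c).
Proof.
move=> /rV0Pn[k uk] ra rb rc.
have: dvdm r ((u 0 k)%:MP * det3 a b c).
  elim/ord3P: k {uk}.
  - have -> : (u 0 o0)%:MP * det3 a b c =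
      dot u a * (b 0 o1 * c 0 o2 - b 0 o2 * c 0 o1)
      - dot u b * (a 0 o1 * c 0 o2 - a 0 o2 * c 0 o1)
      + dot u c * (a 0 o1 * b 0 o2 - a 0 o2 * b 0 o1).
      by rewrite !dot3 /det3; ring.
    by apply: dvdm_add; first apply: dvdm_sub; apply: dvdm_mulr.
  - have -> : (u 0 o1)%:MP * det3 a b c =
      dot u b * (a 0 o0 * c 0 o2 - a 0 o2 * c 0 o0)
      - dot u a * (b 0 o0 * c 0 o2 - b 0 o2 * c 0 o0)
      - dot u c * (a 0 o0 * b 0 o2 - a 0 o2 * b 0 o0).
      by rewrite !dot3 /det3; ring.
    by apply: dvdm_sub; first apply: dvdm_sub; apply: dvdm_mulr.
  have -> : (u 0 o2)%:MP * det3 a b c =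
      dot u a * (b 0 o0 * c 0 o1 - b 0 o1 * c 0 o0)
      - dot u b * (a 0 o0 * c 0 o1 - a 0 o1 * c 0 o0)
      + dot u c * (a 0 o0 * b 0 o1 - a 0 o1 * b 0 o0).
    by rewrite !dot3 /det3; ring.
  by apply: dvdm_add; first apply: dvdm_sub; apply: dvdm_mulr.
case=> q eq_q; exists (((u 0 k)^-1)%:MP * q).
by rewrite -mulrA -eq_q mulrA -mpolyCM mulVf // mpolyC1 mul1r.
Qed.

(** A coordinate system whose first coordinate is u. The other two coordinates vanish on the
    vector v dual to u, so restriction along v leaves them unchanged. *)
Lemma complete_basis u : u != 0 -> exists v w1 w2,
  [/\ kdot u v = 1, kdot w1 v = 0, kdot w2 v = 0 & det3 u w1 w2 != 0].
Proof.
move=> /rV0Pn[k]; pose e l : 'rV[K]_3 := delta_mx 0 l.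
have kdv l : kdot u ((u 0 l)^-1 *: e l) = (u 0 l)^-1 * u 0 l.
  by rewrite kdotC kdotZl kdotC kdot_delta.
have edv l m : l != m -> kdot (e l) ((u 0 m)^-1 *: e m) = 0.
  by move=> lm; rewrite kdotC kdotZl kdotC kdot_delta mxE eq_sym (negPf lm) andbF mulr0.
elim/ord3P: k => uk; [exists ((u 0 o0)^-1 *: e o0), (e o1), (e o2)
  |exists ((u 0 o1)^-1 *: e o1), (e o0), (e o2)
  |exists ((u 0 o2)^-1 *: e o2), (e o0), (e o1)];
  rewrite kdv ?mulVf ?edv //; split=> //; rewrite /det3 !mxE /=;
  by rewrite ?(mulr1, mulr0, mul0r, mul1r, subr0, addr0, oppr0, sub0r, add0r, oppr_eq0).
Qed.

Lemma det3_neq0 u w : u != 0 -> (forall t, w != t *: u) ->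
  exists y, det3 u w y != 0.
Proof.
move=> /complete_basis [v [w1 [w2 [_ _ _ uww]]]] wu.
have wE := cramer3 u w1 w2 w.
have [d1|] := eqVneq (det3 u w1 w) 0; last first.
  by move=> d1; exists w1; rewrite det3C oppr_eq0.
have [d2|] := eqVneq (det3 u w w2) 0; last by exists w2.
case/eqP: (wu ((det3 u w1 w2)^-1 * det3 w w1 w2)).
apply: (scalerI uww); rewrite wE d1 d2 !scale0r !addr0 scalerA mulrA.
by rewrite mulfV // mul1r.
Qed.

Lemma det3_eq0P u w w' : u != 0 -> (forall t, w != t *: u) ->
  reflect (exists s t, w' = s *: u + t *: w) (det3 u w w' == 0).
Proof.
move=> u0 wu; apply: (iffP eqP) => [uwz|[s [t ->]]].
  have [y uwy] := det3_neq0 u0 wu.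
  have := cramer3 u w y w'; rewrite uwz scale0r addr0 => zE.
  exists ((det3 u w y)^-1 * det3 w' w y), ((det3 u w y)^-1 * det3 u w' y).
  apply: (scalerI uwy); rewrite zE scalerDr !scalerA !mulrA mulfV //.
  by rewrite !mul1r.
by rewrite /det3 !mxE; ring.
Qed.

Definition homv d th := forall k, th 0 k \is d.-homog.

(** Since multiplication by a homogeneous polynomial shifts the grading, quotients of homogeneous
    polynomials are homogeneous. *)
Lemma pihomog_mull e d p q : p \is e.-homog ->
  pihomog mdeg d (p * q) = if (e <= d)%N then p * pihomog mdeg (d - e) q else 0.
Proof.
move=> hp; rewrite {1}(pihomog_partitionE (leqnn (mmeasure mdeg q))).
rewrite mulr_sumr raddf_sum /=; case: ifP => [led|/negbT lde].
  rewrite [in RHS](pihomog_partitionE (leqnn (mmeasure mdeg q))) raddf_sum mulr_sumr.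
  apply: eq_bigr => i _ /=; have [di|ne] := eqVneq (d - e)%N i.
    rewrite di pihomog_id pihomog_dE // -(subnKC led) di.
    by apply: dhomogM => //; apply: pihomogP.
  rewrite [in RHS](@pihomog_ne0 _ _ _ i) 1?eq_sym ?pihomogP // mulr0.
  rewrite (@pihomog_ne0 _ _ _ (e + i)) ?dhomogM ?pihomogP //.
  by apply: contraNneq ne => <-; rewrite addKn.
rewrite big1 // => i _.
rewrite (@pihomog_ne0 _ _ _ (e + i)) ?dhomogM ?pihomogP //.
by apply: contraNneq lde => <-; rewrite leq_addr.
Qed.

Lemma dhomog_cancel e d p q : p != 0 -> p \is e.-homog -> p * q \is d.-homog ->
  q != 0 -> (e <= d)%N /\ q \is (d - e).-homog.
Proof.
move=> p0 hp hpq q0; have := pihomog_mull d q hp.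
rewrite pihomog_dE //; case: ifP => led.
  by move=> /(mulfI p0) ->; split=> //; apply: pihomogP.
by move/eqP; rewrite mulf_eq0 (negPf p0) (negPf q0).
Qed.

Lemma dhomog_cancel0 e d p q : p != 0 -> p \is e.-homog -> p * q \is d.-homog ->
  q \is (d - e).-homog.
Proof.
move=> p0 hp hpq; have [->|q0] := eqVneq q 0; first exact: dhomog0.
by have [] := dhomog_cancel p0 hp hpq q0.
Qed.

Lemma dhomog0_const p : p \is 0.-homog -> exists t, p = t%:MP.
Proof.
move=> hp; exists p@_0; apply/mpolyP => m; rewrite mcoeffC.
have [->|m0] := eqVneq m 0%MM; first by rewrite mulr1.
rewrite mulr0; apply: (dhomog_nemf_coeff hp).
by rewrite mdeg_eq0.
Qed.

Lemma dhomogC t : (t%:MP : S) \is 0.-homog.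
Proof. by rewrite -[t%:MP]mulr1 mul_mpolyC rpredZ ?dhomog1. Qed.

Lemma dhomog_mulC d t p : p \is d.-homog -> t%:MP * p \is d.-homog.
Proof. by move=> hp; rewrite mul_mpolyC rpredZ. Qed.

Lemma dot_homog d u th : homv d th -> dot u th \is d.-homog.
Proof. by move=> h; apply: rpred_sum => k _; apply: dhomog_mulC. Qed.

Lemma det3_homog d e f a b c : homv d a -> homv e b -> homv f c ->
  det3 a b c \is (d + (e + f)).-homog.
Proof.
move=> ha hb hc; rewrite /det3.
by apply: rpredD; first apply: rpredB; apply: dhomogM => //; apply: rpredB;
  first [exact: dhomogM|rewrite addnC; exact: dhomogM].
Qed.

Lemma prod_lin_homog (I : finType) (J : {pred I}) (al : I -> 'rV[K]_3) :
  \prod_(i in J) lin (al i) \is #|J|.-homog.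
Proof.
rewrite -sum1_card; elim/big_rec2: _ => [|i d q _ IH]; first exact: dhomog1.
by apply: dhomogM => //; apply: lin_homog.
Qed.

Lemma homv_euler : homv 1 (euler K).
Proof. by move=> k; rewrite mxE dhomogX /= mdeg1. Qed.

Lemma homvZ d e p th : p \is d.-homog -> homv e th -> homv (d + e) (p *: th).
Proof. by move=> hp h k; rewrite mxE dhomogM. Qed.
Lemma homvD d th1 th2 : homv d th1 -> homv d th2 -> homv d (th1 + th2).
Proof. by move=> h1 h2 k; rewrite mxE rpredD. Qed.
Lemma homvB d th1 th2 : homv d th1 -> homv d th2 -> homv d (th1 - th2).
Proof. by move=> h1 h2 k; rewrite !mxE rpredB. Qed.
Lemma homv_restr u v d th : homv d th -> homv d (map_mx (restr u v) th).
Proof. by move=> h k; rewrite mxE restr_homog. Qed.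

End Covectors.

(** * Adding and deleting a line *)

Section Arrangement.
Variables (K : fieldType) (T : finType) (al : T -> 'rV[K]_3).
Local Notation S := {mpoly K[3]}.
Local Notation x := (euler K).
Implicit Types (i j H : T) (J : {set T}) (th : 'rV[S]_3).

Definition nonproportional := (forall i, al i != 0) /\ forall i j t, al j = t *: al i -> i = j.
Definition logder J th := forall i, i \in J -> dvdm (lin (al i)) (dot (al i) th).
Definition defpoly J : S := \prod_(i in J) lin (al i).
(** Freeness with exponents 1, a, b in the form of Saito's criterion: together with the Euler
    field the two fields form a basis. *)
Definition free_exps J a b := exists th1 th2 t,
  [/\ logder J th1 /\ homv a th1, logder J th2 /\ homv b th2, t != 0
    & det3 x th1 th2 = t%:MP * defpoly J].
(** The lines through the intersection point of two distinct lines. On the diagonal the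
    determinant vanishes identically, so that [pencil i i] is everything; only pairs of distinct
    lines carry information. *)
Definition pencil i j : {set T} := [set k | det3 (al i) (al j) (al k) == 0].
(** The number of intersection points on H with the lines of J, when H is not in J. *)
Definition npoints H J := #|pencil H @: J|.

Lemma logder_euler J : logder J x.
Proof. by move=> i _; apply: dvdmm. Qed.
Lemma logderZ J p th : logder J th -> logder J (p *: th).
Proof. by move=> h i iJ; rewrite dotZ; apply/dvdm_mull/h. Qed.
Lemma logderB J th1 th2 : logder J th1 -> logder J th2 -> logder J (th1 - th2).
Proof. by move=> h1 h2 i iJ; rewrite dotB; apply: dvdm_sub; [apply: h1|apply: h2]. Qed.
Lemma logderU1 J H th : logder (H |: J) th <-> dvdm (lin (al H)) (dot (al H) th) /\ logder J th.
Proof.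
split=> [h|[hH h] i]; last by rewrite in_setU1 => /predU1P[->|/h].
by split=> [|i iJ]; apply: h; rewrite in_setU1 ?eqxx // iJ orbT.
Qed.

Lemma free_exps_sym J a b : free_exps J a b -> free_exps J b a.
Proof.
move=> [th1 [th2 [t [h1 h2 t0 e]]]]; exists th2, th1, (- t).
by split; rewrite ?oppr_eq0 // det3C e mpolyCN mulNr.
Qed.

Hypothesis alP : nonproportional.

Lemma al_neq0 i : al i != 0. Proof. by case: alP. Qed.
Lemma lin_al_neq0 i : lin (al i) != 0. Proof. by rewrite lin_eq0 al_neq0. Qed.
Lemma al_nonproportional i j t : i != j -> al j != t *: al i.
Proof. by apply: contraNneq => /(proj2 alP) ->. Qed.

Lemma defpoly_neq0 J : defpoly J != 0.
Proof. by rewrite prodf_seq_neq0; apply/allP => i _; rewrite lin_al_neq0 implybT. Qed.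

Lemma defpolyU1 H J : H \notin J -> defpoly (H |: J) = lin (al H) * defpoly J.
Proof. by move=> HJ; rewrite /defpoly big_setU1. Qed.

Lemma dvdm_lin_al i j : dvdm (lin (al i)) (lin (al j)) -> i = j.
Proof. by move=> /(dvdm_lin (al_neq0 i)) [t /(proj2 alP)]. Qed.

Lemma prod_dvdm (I : finType) (A : {set I}) (f : I -> S) F :
  {in A, forall k, primem (f k) /\ ~ dvdm (f k) 1} ->
  {in A &, forall k l, dvdm (f k) (f l) -> k = l} ->
  {in A, forall k, dvdm (f k) F} -> dvdm (\prod_(k in A) f k) F.
Proof.
move=> fP finj fF; apply: (prod_class_dvdm (cl := id)) => // y.
have [yA|yA] := boolP (y \in A).
  rewrite (big_pred1 y) => [|k]; first exact: fF.
  by apply: andb_idl => /eqP ->.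
rewrite big1 => [|k /andP[kA /eqP ky]]; last by rewrite -ky kA in yA.
by exists F; rewrite mulr1.
Qed.

Lemma defpoly_dvdm J F :
  {in J, forall i, dvdm (lin (al i)) F} -> dvdm (defpoly J) F.
Proof.
move=> h; apply: prod_dvdm => // [i _|i j _ _]; last exact: dvdm_lin_al.
by split; [apply: primem_lin; apply: al_neq0|apply: lin_ndvdm1].
Qed.

Lemma defpoly_dvdm_det3 J a b c : logder J a -> logder J b -> logder J c ->
  dvdm (defpoly J) (det3 a b c).
Proof.
move=> ha hb hc; apply: defpoly_dvdm => i iJ.
by apply: (det3_dvd (al_neq0 i)); [apply: ha|apply: hb|apply: hc].
Qed.

Lemma free_exps_card J a b : free_exps J a b -> #|J| = (a + b).+1.
Proof.
move=> [th1 [th2 [t [[_ h1] [_ h2] t0 e]]]].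
have := det3_homog (@homv_euler K) h1 h2.
have hQ : defpoly J \is #|J|.-homog by apply: prod_lin_homog.
rewrite e => /(dhomog_uniq _ (dhomog_mulC t hQ)) -> //.
by rewrite mulf_neq0 ?mpolyC_eq0 ?defpoly_neq0.
Qed.

Lemma mem_pencilP i j k : i != j ->
  reflect (exists s t, al k = s *: al i + t *: al j) (k \in pencil i j).
Proof.
move=> ij; rewrite inE; apply: det3_eq0P; first exact: al_neq0.
by move=> t; apply: al_nonproportional.
Qed.

Lemma mem_pencil_l i j : i \in pencil i j. Proof. by rewrite inE det3_aba. Qed.
Lemma mem_pencil_r i j : j \in pencil i j. Proof. by rewrite inE det3_abb. Qed.
Lemma pencil_sym i j : pencil i j = pencil j i.
Proof. by apply/setP => k; rewrite !inE -det3_rot det3C oppr_eq0 -det3_rot. Qed.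

(** Two lines determine one point: this is the only geometric input of the combinatorial part. *)
Lemma pencil_eq i j k : i != j -> i != k -> k \in pencil i j -> pencil i k = pencil i j.
Proof.
move=> ij ik /(mem_pencilP _ ij) [s [t alk]].
have t0 : t != 0.
  apply: contraNneq ik => t0; apply/eqP/(proj2 alP) => //.
  by rewrite alk t0 scale0r addr0.
apply/setP => l; rewrite !inE alk det3ZDm det3_aab mulr0 add0r det3Zm.
by rewrite mulf_eq0 (negPf t0).
Qed.

(** Throughout, [z] is the form of a line H outside J and [y1], [y2] complete it to a system of
    coordinates; [rho] sets [z] to 0, and [lam j] is the trace of line j on H. *)
Section RestrictToLine.
Variables (H : T) (J : {set T}).
Hypothesis HJ : H \notin J.
Variables v w1 w2 : 'rV[K]_3.
Hypotheses (uv : kdot (al H) v = 1) (wv1 : kdot w1 v = 0) (wv2 : kdot w2 v = 0).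
Hypothesis uww : det3 (al H) w1 w2 != 0.
Local Notation rho := (restr (al H) v).
Local Notation rhov := (map_mx rho).
Local Notation z := (lin (al H)).
Local Notation lam j := (rho (lin (al j))).
Local Notation y1 := (lin w1).
Local Notation y2 := (lin w2).

Lemma neqH j : j \in J -> H != j. Proof. by apply: contraTneq => <-. Qed.

Lemma rho_z : rho z = 0. Proof. exact: restr_lin0. Qed.
Lemma rho_y1 : rho y1 = y1. Proof. by rewrite restr_lin wv1 mul0r subr0. Qed.
Lemma rho_y2 : rho y2 = y2. Proof. by rewrite restr_lin wv2 mul0r subr0. Qed.

Lemma lam_neq0 j : j \in J -> al j - kdot (al j) v *: al H != 0.
Proof. by move=> /neqH Hj; rewrite subr_eq0 al_nonproportional. Qed.

Lemma lam_prime j : j \in J -> primem (lam j) /\ ~ dvdm (lam j) 1.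
Proof.
by move=> jJ; rewrite restr_linE; split; [apply/primem_lin/lam_neq0|apply: lin_ndvdm1].
Qed.

Lemma prod_lam_neq0 (P : pred T) : \prod_(j in J | P j) lam j != 0.
Proof.
rewrite prodf_seq_neq0; apply/allP => i _; apply/implyP => /andP[iJ _].
by have [[]] := lam_prime iJ.
Qed.

Lemma lam_homog j : lam j \is 1.-homog.
Proof. by rewrite restr_linE lin_homog. Qed.

Lemma prod_lam_homog (A : {set T}) : \prod_(j in A) lam j \is #|A|.-homog.
Proof.
rewrite -sum1_card; elim/big_rec2: _ => [|i d q _ IH]; first exact: dhomog1.
by apply: dhomogM => //; apply: lam_homog.
Qed.

Lemma pencilHP i j : i \in J -> j \in J -> pencil H i = pencil H j ->
  exists s t, al j = s *: al H + t *: al i /\ t != 0.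
Proof.
move=> iJ jJ ij; have := mem_pencil_r H j; rewrite -ij => /(mem_pencilP _ (neqH iJ)) [s [t e]].
exists s, t; split=> //; apply: contraTneq (neqH jJ) => t0.
by apply/negPn/eqP/(proj2 alP); rewrite e t0 scale0r addr0.
Qed.

(** If the traces are proportional, some combination of the two covectors is a multiple of that
    of H, so the three lines are concurrent. *)
Lemma dvdm_lam i j : i \in J -> j \in J -> dvdm (lam i) (lam j) -> pencil H i = pencil H j.
Proof.
move=> iJ jJ; rewrite !restr_linE => /(dvdm_lin (lam_neq0 iJ)) [t e].
apply/esym/pencil_eq; rewrite ?neqH //; apply/mem_pencilP; first exact: neqH.
exists (kdot (al j) v - t * kdot (al i) v), t.
rewrite -{1}[al j](subrK (kdot (al j) v *: al H)) e scalerBr scalerBl scalerA.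
by rewrite [RHS]addrC addrA addrAC.
Qed.

(** One line chosen through each point of H. *)
Let rep (X : {set T}) := odflt H [pick j in J | pencil H j == X].

Lemma repP j : j \in J -> rep (pencil H j) \in J /\ pencil H (rep (pencil H j)) = pencil H j.
Proof.
move=> jJ; rewrite /rep; case: pickP => [k /andP[kJ /eqP]|/(_ j)] //=.
by rewrite jJ eqxx.
Qed.

Let reps := [set j in J | rep (pencil H j) == j].
(** The trace of the arrangement on H is a divisor whose multiplicity at a point is the number of
    lines of J through it. It is split into the reduced divisor of the points and the rest, of
    degrees h and #|J| - h. *)
Definition simple_part := \prod_(j in reps) lam j.
Definition mult_part := \prod_(j in J :\: reps) lam j.

Lemma reps_sub j : j \in reps -> j \in J. Proof. by rewrite inE => /andP[]. Qed.

Lemma card_reps : #|reps| = npoints H J.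
Proof.
rewrite /npoints; have <- : pencil H @: reps = pencil H @: J.
  apply/setP => X; apply/imsetP/imsetP => [[j /reps_sub jJ ->]|[j jJ ->]]; first by exists j.
  have [rJ re] := repP jJ; exists (rep (pencil H j)); last by rewrite re.
  by rewrite inE rJ re eqxx.
rewrite card_in_imset // => i j; rewrite !inE => /andP[_ /eqP ri] /andP[_ /eqP rj].
by rewrite -{2}ri -{2}rj => ->.
Qed.

Lemma reps_subset : reps \subset J. Proof. by apply/subsetP => j /reps_sub. Qed.

Lemma simple_homog : simple_part \is (npoints H J).-homog.
Proof. by rewrite -card_reps prod_lam_homog. Qed.
Lemma mult_homog : mult_part \is (#|J| - npoints H J).-homog.
Proof. by rewrite -card_reps -cardsDS ?reps_subset // prod_lam_homog. Qed.

Lemma rho_prod_lam (A : {set T}) : rho (\prod_(j in A) lam j) = \prod_(j in A) lam j.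
Proof. by rewrite rmorph_prod; apply: eq_bigr => j _ /=; rewrite restrK. Qed.
Lemma rho_simple : rho simple_part = simple_part. Proof. exact: rho_prod_lam. Qed.
Lemma rho_mult : rho mult_part = mult_part. Proof. exact: rho_prod_lam. Qed.

Lemma prod_lamE : \prod_(j in J) lam j = simple_part * mult_part.
Proof.
rewrite (big_setID reps) /=; congr (_ * _); apply: eq_bigl => j.
by rewrite in_setI andb_idl // => /reps_sub.
Qed.

Lemma rho_defpoly : rho (defpoly J) = simple_part * mult_part.
Proof. by rewrite rmorph_prod prod_lamE. Qed.

Lemma simple_mult_neq0 : simple_part * mult_part != 0.
Proof. by rewrite -prod_lamE; have := prod_lam_neq0 predT; under eq_bigl do rewrite andbT. Qed.
Lemma simple_neq0 : simple_part != 0.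
Proof. by apply: contraNneq simple_mult_neq0 => ->; rewrite mul0r. Qed.
Lemma mult_neq0 : mult_part != 0.
Proof. by apply: contraNneq simple_mult_neq0 => ->; rewrite mulr0. Qed.

Lemma simple_dvdm F : {in J, forall j, dvdm (lam j) F} -> dvdm simple_part F.
Proof.
move=> h; apply: prod_dvdm => [j /reps_sub jJ|i j iI jI|j /reps_sub jJ]; [exact: lam_prime| |exact: h].
move=> /(dvdm_lam (reps_sub iI) (reps_sub jI)) e.
by move: iI jI; rewrite !inE => /andP[_ /eqP <-] /andP[_ /eqP <-]; rewrite e.
Qed.

(** It suffices to look at one point at a time, and there the chosen line may be put back: the
    product of the points takes care of it. *)
Lemma mult_dvdm F :
  {in J, forall i, dvdm (\prod_(j in J | pencil H j == pencil H i) lam j) (lam i * F)} ->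
  dvdm mult_part F.
Proof.
move=> h; apply: (dvdm_mul2l simple_neq0); rewrite -prod_lamE.
apply: (prod_class_dvdm (cl := pencil H)) => [j|i j|X]; [exact: lam_prime|exact: dvdm_lam|].
have [/existsP[i /andP[iJ /eqP <-]]|/existsPn noX] := boolP [exists i in J, pencil H i == X].
  have [rJ re] := repP iJ; rewrite -re; apply: dvdm_trans (h _ rJ) _.
  apply: dvdm_mul; last exact: dvdmm.
  rewrite /simple_part (bigD1 (rep (pencil H i))) /=; first exact/dvdm_mulr/dvdmm.
  by rewrite inE rJ re eqxx.
rewrite big1 => [|j /andP[jJ jX]]; first by eexists; rewrite mulr1.
by have := noX j; rewrite jJ jX.
Qed.

Lemma class_dvdm i F : i \in J ->
  {in J, forall j, pencil H j = pencil H i -> dvdm (lin (al j)) F} ->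
  dvdm (\prod_(j in J | pencil H j == pencil H i) lam j) (rho F).
Proof.
move=> iJ h; have [q Fq] : dvdm (defpoly [set j in J | pencil H j == pencil H i]) F.
  by apply: defpoly_dvdm => j; rewrite inE => /andP[jJ /eqP]; apply: h.
exists (rho q); rewrite Fq rmorphM rmorph_prod; congr (_ * _).
by apply: eq_bigl => j; rewrite inE.
Qed.

(** At a point p of H, the lines of J through p are combinations of z and one of them, say l.
    The polynomial l th(z) - z th(l) is, up to a constant, the same for all these lines, hence
    divisible by all of them; on H it becomes l th(z), which therefore vanishes at p to an order
    one less than the number of lines. *)
Lemma mult_dvdm_dot th : logder J th -> dvdm mult_part (rho (dot (al H) th)).
Proof.
move=> hth; apply: mult_dvdm => i iJ.
have -> : lam i * rho (dot (al H) th) =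
    rho (lin (al i) * dot (al H) th - z * dot (al i) th).
  by rewrite rmorphB !rmorphM /= rho_z mul0r subr0.
apply: class_dvdm => // j jJ ji.
have [s [t [e t0]]] := pencilHP jJ iJ ji.
rewrite e linD !linZ dotDl !dotZl.
have -> : (s%:MP * z + t%:MP * lin (al j)) * dot (al H) th -
   z * (s%:MP * dot (al H) th + t%:MP * dot (al j) th) =
   t%:MP * dot (al H) th * lin (al j) - t%:MP * z * dot (al j) th by ring.
by apply: dvdm_sub; apply: dvdm_mull; [apply: dvdmm|apply: hth].
Qed.

(** When th kills z, the values of th on the lines through p are all proportional, hence
    divisible by each of these lines; on H the value is f times one of them. *)
Lemma mult_dvdm_coef th f : logder J th -> dot (al H) th = 0 ->
  rhov th = f *: rhov x -> dvdm mult_part f.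
Proof.
move=> hth th0 e; apply: mult_dvdm => i iJ.
have -> : lam i * f = rho (dot (al i) th) by rewrite !restr_dot e dotZ mulrC.
apply: class_dvdm => // j jJ ji.
have [s [t [-> t0]]] := pencilHP jJ iJ ji.
by rewrite dotDl !dotZl th0 mulr0 add0r; apply/dvdm_mull/hth.
Qed.

(** The determinant of a field tangent to H with the Euler field, in the coordinates of H. *)
Definition wedge th := y1 * dot w2 (rhov th) - y2 * dot w1 (rhov th).

Lemma wedgeB s t th1 th2 :
  wedge (s *: th1 - t *: th2) = rho s * wedge th1 - rho t * wedge th2.
Proof.
rewrite /wedge -!restr_dot !dotB !dotZ !rmorphB !rmorphM /=; ring.
Qed.

Lemma rho_wedge th : rho (wedge th) = wedge th.
Proof.
by rewrite /wedge rmorphB !rmorphM /= rho_y1 rho_y2 -!restr_dot !restrK.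
Qed.

Lemma wedge_homog d th : homv d th -> wedge th \is d.+1.-homog.
Proof.
move=> h; rewrite -[d.+1]add1n; apply: rpredB; apply: dhomogM; rewrite ?lin_homog //;
  exact/dot_homog/homv_restr.
Qed.

Lemma decompose u : exists s t1 t2, u = s *: al H + t1 *: w1 + t2 *: w2.
Proof.
exists ((det3 (al H) w1 w2)^-1 * det3 u w1 w2), ((det3 (al H) w1 w2)^-1 * det3 (al H) u w2),
  ((det3 (al H) w1 w2)^-1 * det3 (al H) w1 u).
by rewrite -!scalerA -!scalerDr -cramer3 scalerA mulVf // scale1r.
Qed.

Lemma dots_eq0 th : dot (al H) th = 0 -> dot w1 th = 0 -> dot w2 th = 0 -> th = 0.
Proof.
move=> d0 d1 d2; apply/rowP => k; rewrite mxE.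
have -> : th 0 k = dot (delta_mx 0 k) th.
  rewrite /dot (bigD1 k) //= mxE !eqxx mpolyC1 mul1r big1 ?addr0 // => l lk.
  by rewrite mxE (negPf lk) andbF mpolyC0 mul0r.
have [s [t1 [t2 ->]]] := decompose (delta_mx 0 k).
by rewrite !dotDl !dotZl d0 d1 d2 !mulr0 !addr0.
Qed.

(** On H both the field and the Euler field are tangent to the point cut out by line j, so that
    their determinant vanishes there. *)
Lemma simple_dvdm_wedge th : logder J th -> dot (al H) th = 0 ->
  dvdm simple_part (wedge th).
Proof.
move=> hth th0; apply: simple_dvdm => j jJ.
have [s [t1 [t2 e]]] := decompose (al j).
have lj : lam j = t1%:MP * y1 + t2%:MP * y2.
  rewrite e !linD !linZ !rmorphD !rmorphM /= !restrC rho_z rho_y1 rho_y2; ring.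
have lth : rho (dot (al j) th) = t1%:MP * dot w1 (rhov th) + t2%:MP * dot w2 (rhov th).
  rewrite restr_dot e !dotDl !dotZl -restr_dot th0 rmorph0; ring.
have l1 : dvdm (lam j) (t1%:MP * wedge th).
  have -> : t1%:MP * wedge th = lam j * dot w2 (rhov th) - y2 * rho (dot (al j) th).
    by rewrite lj lth /wedge; ring.
  apply: dvdm_sub; first exact/dvdm_mulr/dvdmm.
  by apply/dvdm_mull/dvdm_rmorph/hth.
have l2 : dvdm (lam j) (t2%:MP * wedge th).
  have -> : t2%:MP * wedge th = y1 * rho (dot (al j) th) - lam j * dot w1 (rhov th).
    by rewrite lj lth /wedge; ring.
  apply: dvdm_sub; last exact/dvdm_mulr/dvdmm.
  by apply/dvdm_mull/dvdm_rmorph/hth.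
have kill t : t != 0 -> dvdm (lam j) (t%:MP * wedge th) -> dvdm (lam j) (wedge th).
  move=> t0 [q eq_q]; exists ((t^-1)%:MP * q).
  by rewrite -mulrA -eq_q mulrA -mpolyCM mulVf // mpolyC1 mul1r.
have [t10|/kill] := eqVneq t1 0; last exact.
have [t20|/kill] := eqVneq t2 0; last exact.
case/negP: (al_nonproportional s (neqH jJ)).
by rewrite e t10 t20 !scale0r !addr0.
Qed.

Lemma w1_neq0 : w1 != 0.
Proof. by apply: contraNneq uww => ->; rewrite /det3 !mxE; apply/eqP; ring. Qed.

(** A field on the plane H that is everywhere parallel to the Euler field is a polynomial
    multiple of it, the two coordinates of the Euler field being coprime. *)
Lemma wedge_eq0 d th : homv d th -> dot (al H) th = 0 -> wedge th = 0 ->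
  exists f, [/\ rhov th = f *: rhov x, rho f = f, f \is d.-1.-homog & f != 0 -> (0 < d)%N].
Proof.
move=> hd th0 /eqP; rewrite subr_eq0 => /eqP e.
have [||[f t1]] := (primem_lin w1_neq0).2 y2 (dot w1 (rhov th)).
- by rewrite -e; apply/dvdm_mulr/dvdmm.
- move=> /(dvdm_lin w1_neq0) [t w2E]; case/negP: uww.
  by rewrite w2E det3Zr det3_abb mulr0.
have ty1 : lin w1 != 0 by rewrite lin_eq0 w1_neq0.
have t2 : dot w2 (rhov th) = f * y2.
  by apply: (mulfI ty1); rewrite e t1; ring.
exists f; split.
- apply/eqP; rewrite -subr_eq0; apply/eqP; apply: dots_eq0.
  + by rewrite dotB dotZ -!restr_dot th0 rho_z rmorph0 mulr0 subr0.
  + by rewrite dotB dotZ t1 -restr_dot rho_y1 subrr.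
  + by rewrite dotB dotZ t2 -restr_dot rho_y2 subrr.
- apply: (mulIf ty1); rewrite -{1}rho_y1 -rmorphM -t1 -restr_dot /= (restrK uv) //.
- rewrite -[d.-1]subn1; apply: (dhomog_cancel0 ty1 (lin_homog w1)).
  by rewrite mulrC -t1; apply/dot_homog/homv_restr.
move=> f0; have : y1 * f \is d.-homog.
  by rewrite mulrC -t1; apply/dot_homog/homv_restr.
by move=> /(dhomog_cancel ty1 (lin_homog w1))/(_ f0) [].
Qed.

(** Subtracting a multiple of the Euler field from a field with zero wedge leaves a field that
    vanishes on H; dividing it by z gives a field for J of smaller degree. *)
Lemma peel d th : logder J th -> homv d th -> dot (al H) th = 0 -> wedge th = 0 ->
  exists f eta, [/\ th = f *: x + z *: eta, rhov th = f *: rhov x,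
    logder J eta, homv d.-1 eta & (f != 0 -> (0 < d)%N) /\ (eta != 0 -> (0 < d)%N)].
Proof.
move=> hJ hd th0 /(wedge_eq0 hd th0) [f [thf rf hf fd]].
have hfx : homv d (f *: x).
  have [->|/fd] := eqVneq f 0; first by move=> k; rewrite scale0r mxE dhomog0.
  case: d hf {hd fd} => // d hf _; rewrite -[d.+1]addn1.
  by apply: homvZ => //; apply: homv_euler.
have div k : exists q, (th - f *: x) 0 k = q * z.
  apply/(restr_eq0 uv); have := congr1 (fun A : 'rV_3 => A 0 k) thf.
  by rewrite !mxE rmorphD rmorphN rmorphM /= rf => ->; rewrite subrr.
have [eta etaE] := fin_all_exists div.
pose et : 'rV[S]_3 := \row_k eta k.
have thE : th - f *: x = z *: et.
  by apply/rowP => k; rewrite etaE !mxE mulrC.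
have hze k : z * et 0 k \is d.-homog.
  have -> : z * et 0 k = (z *: et) 0 k by rewrite [RHS]mxE.
  by rewrite -thE; apply: homvB.
exists f, et; split=> //.
- by rewrite -thE addrC subrK.
- move=> j jJ; have [_ jP] := primem_lin (al_neq0 j).
  have: dvdm (lin (al j)) (z * dot (al j) et).
    rewrite -dotZ -thE dotB dotZ; apply: dvdm_sub; first exact: hJ.
    exact/dvdm_mull/dvdmm.
  case/jP => // /dvdm_lin_al jH; by move: HJ; rewrite -jH jJ.
- move=> k; rewrite -[d.-1]subn1.
  exact: (dhomog_cancel0 (lin_al_neq0 H) (lin_homog _) (hze k)).
split=> // /rV0Pn [k] et0.
by have [] := dhomog_cancel (lin_al_neq0 H) (lin_homog _) (hze k) et0.
Qed.

Lemma normalize d th : logder (H |: J) th -> homv d th -> exists q,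
  [/\ logder J (th - q *: x), homv d (th - q *: x) & dot (al H) (th - q *: x) = 0].
Proof.
move=> /logderU1 [[q e] hJ] hd; exists q; split.
- by apply: logderB => //; apply/logderZ/logder_euler.
- apply: homvB => // k; have [->|q0] := eqVneq q 0; first by rewrite scale0r mxE dhomog0.
  have := dot_homog (al H) hd; rewrite e mulrC => /(dhomog_cancel (lin_al_neq0 H) (lin_homog _)).
  case=> // d0 hq; rewrite -(subnK d0); apply: homvZ => //; exact: homv_euler.
by rewrite dotB dotZ e subrr.
Qed.

Lemma det3_restrict th1 th2 : dot (al H) th1 = 0 -> dot (al H) th2 = 0 ->
  (det3 (al H) w1 w2)%:MP * det3 x th1 th2 =
  z * (dot w1 th1 * dot w2 th2 - dot w2 th1 * dot w1 th2).
Proof. by move=> d1 d2; rewrite det3_dots d1 d2 /lin; ring. Qed.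

(** After making both fields kill z, compare degrees of their wedges, which are multiples of a
    form of degree h. If the first wedge is not 0, then h <= a + 1, and for h = a + 1 it divides the
    second one, which can thus be made 0, so that the second field can be peeled. If it is 0, the
    first field can be peeled; it restricts to f times the Euler field with f a multiple of the
    multiple part, and the determinant of the two fields on H forces h = b + 1. *)
Lemma free_exps_deletion a b : free_exps (H |: J) a b ->
  ((npoints H J <= a.+1)%N /\
     (npoints H J = a.+1 -> exists2 b', b = b'.+1 & free_exps J a b')) \/
  (npoints H J = b.+1 /\ exists2 a', a = a'.+1 & free_exps J a' b).
Proof.
move=> [th1 [th2 [t [[L1 h1] [L2 h2] t0]]]].
have [q1 [{}L1 {}h1 z1]] := normalize L1 h1.
have [q2 [{}L2 {}h2 z2]] := normalize L2 h2.
rewrite -(det3_elim q1 q2).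
move: (th1 - q1 *: x) (th2 - q2 *: x) L1 h1 z1 L2 h2 z2.
move=> {}th1 {}th2 L1 h1 z1 L2 h2 z2; rewrite defpolyU1 // mulrCA => detE.
have z0 := lin_al_neq0 H.
have [g1 F1] := simple_dvdm_wedge L1 z1.
have [g2 F2] := simple_dvdm_wedge L2 z2.
have s0 := simple_neq0.
have hF1 := wedge_homog h1; have hF2 := wedge_homog h2.
have [F10|F1n0] := eqVneq (wedge th1) 0; last first.
  left; have g10 : g1 != 0 by apply: contraNneq F1n0 => g10; rewrite F1 g10 mul0r.
  move: (hF1); rewrite F1 mulrC => /(dhomog_cancel s0 simple_homog)/(_ g10) [lea hg1].
  split=> // ha; move: hg1; rewrite ha subnn => /dhomog0_const [s g1E].
  have sn0 : s != 0 by apply: contraNneq g10 => s0'; rewrite g1E s0' mpolyC0.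
  (* The first wedge is s times the product of the points, so that this combination has zero
     wedge. Its homogeneity uses h = a + 1. *)
  pose th := s%:MP *: th2 - g2 *: th1.
  have hth : homv b th.
    apply: homvB; first by move=> k; rewrite mxE dhomog_mulC.
    have [->|g20] := eqVneq g2 0; first by move=> k; rewrite scale0r mxE dhomog0.
    move: hF2; rewrite F2 mulrC => /(dhomog_cancel s0 simple_homog)/(_ g20) [leb hg2].
    by move: (homvZ hg2 h1); rewrite ha subSS subnK // -ltnS -ha.
  have Lth : logder J th by apply: logderB; apply: logderZ.
  have zth : dot (al H) th = 0 by rewrite dotB !dotZ z1 z2 !mulr0 subr0.
  have Wth : wedge th = 0.
    have rg2 : rho g2 * simple_part = g2 * simple_part.
      by rewrite -[in LHS]rho_simple -rmorphM -F2 /= rho_wedge.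
    rewrite wedgeB F1 F2 g1E restrC.
    have -> : rho g2 * (s%:MP * simple_part) = s%:MP * (rho g2 * simple_part) by ring.
    by rewrite rg2 subrr.
  have [f [eta [thE _ Leta heta [_ b0]]]] := peel Lth hth zth Wth.
  have detE' : det3 x th1 eta = (s * t)%:MP * defpoly J.
    apply: (mulfI z0); rewrite -det3Zr.
    have <- : det3 x th1 th = det3 x th1 (z *: eta) by rewrite thE det3_combr det3Zr.
    by rewrite det3_subr detE mpolyCM; ring.
  have eta0 : eta != 0.
    apply/eqP => eta0; move/eqP: detE'; rewrite eta0 det3_b0 eq_sym mulf_eq0 (negPf (defpoly_neq0 _)) orbF mpolyC_eq0.
    by rewrite mulf_eq0 (negPf sn0) (negPf t0).
  exists b.-1; first by rewrite prednK // b0.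
  by exists th1, eta, (s * t); split=> //; rewrite mulf_neq0.
right; have [f [eta [thE rth1 Leta heta [a0 _]]]] := peel L1 h1 z1 F10.
pose d := det3 (al H) w1 w2.
have fF2 : f * wedge th2 = (d * t)%:MP * (simple_part * mult_part).
  have e1 : dot w1 th1 * dot w2 th2 - dot w2 th1 * dot w1 th2 = (d * t)%:MP * defpoly J.
    by apply: (mulfI z0); rewrite -det3_restrict // detE mpolyCM; ring.
  rewrite -rho_defpoly -(restrC (al H) v (d * t)) -rmorphM -e1 rmorphB !rmorphM /= !(restr_dot _ _ _ th1) rth1.
  by rewrite !dotZ -!restr_dot rho_y1 rho_y2 /wedge -!restr_dot; ring.
have dt0 : (d * t)%:MP != 0 :> S by rewrite mpolyC_eq0 mulf_neq0.
have fg2 : f * g2 = (d * t)%:MP * mult_part.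
  by apply: (mulfI s0); rewrite mulrCA -[simple_part * g2]mulrC -F2 fF2; ring.
have f0 : f != 0.
  apply: contraTneq dt0 => f0; move/eqP: fF2; rewrite f0 mul0r eq_sym mulf_eq0.
  by rewrite (negPf simple_mult_neq0) orbF => ->.
have g20 : g2 != 0.
  apply: contraTneq dt0 => g20; move/eqP: fg2; rewrite g20 mulr0 eq_sym mulf_eq0.
  by rewrite (negPf mult_neq0) orbF => ->.
(* The factor [f] is a multiple of the multiple part, and its product with [g2] is a nonzero
   constant multiple of it; hence [g2] is constant and the second wedge has degree h. *)
have [k fk] := mult_dvdm_coef L1 z1 rth1.
have kg2 : g2 * k = (d * t)%:MP.
  by apply: (mulIf mult_neq0); rewrite -fg2 fk; ring.
have k0 : k != 0 by apply: contraNneq f0 => k0; rewrite fk k0 mul0r.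
move: hF2; rewrite F2 mulrC => /(dhomog_cancel s0 simple_homog)/(_ g20) [leb hg2].
have := dhomogC (d * t); rewrite -kg2 => /(dhomog_cancel g20 hg2)/(_ k0) [].
rewrite leqn0 subn_eq0 => geb _; split; first by apply/eqP; rewrite eqn_leq leb geb.
exists a.-1; first by rewrite prednK // a0.
exists eta, th2, t; split=> //; apply: (mulfI z0).
by rewrite -detE thE det3_combm.
Qed.

(** The values of the two fields on z, restricted to H, are multiples of the multiple part, whose
    degree is b when h = a + 1. If the value of the second field is not 0, it generates, and the
    first field can be corrected by a multiple of the second to become tangent to H. If it is 0,
    the second field is already tangent to H and the first one is not, since otherwise the
    determinant would be divisible by z. *)
Lemma free_exps_addition_aux a b : free_exps J a b -> npoints H J = a.+1 ->
  free_exps (H |: J) a b.+1 \/ ((b <= a)%N /\ free_exps (H |: J) b a.+1).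
Proof.
move=> /[dup] /free_exps_card cJ [th1 [th2 [t [[L1 h1] [L2 h2] t0 detE]]]] ha.
have z0 := lin_al_neq0 H; have m0 := mult_neq0.
have hm : mult_part \is b.-homog.
  by have := mult_homog; rewrite cJ ha -addSn addKn.
have [g1 G1] := mult_dvdm_dot L1; have [g2 G2] := mult_dvdm_dot L2.
have hdot d th : homv d th -> rho (dot (al H) th) \is d.-homog.
  by move=> h; apply/restr_homog/dot_homog.
have LzU th : logder J th -> logder (H |: J) (z *: th).
  move=> hth; apply/logderU1; split; last exact: logderZ.
  by rewrite dotZ; apply/dvdm_mulr/dvdmm.
have LU th : logder J th -> rho (dot (al H) th) = 0 -> logder (H |: J) th.
  by move=> hth r0; apply/logderU1; split=> //; apply/(restr_eq0 uv).
have hz d th : homv d th -> homv d.+1 (z *: th).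
  by move=> h; rewrite -[d.+1]add1n; apply: homvZ => //; apply: lin_homog.
have [g20|g2n0] := eqVneq g2 0; last first.
  left; move: (hdot _ _ h2); rewrite G2 mulrC => /(dhomog_cancel m0 hm)/(_ g2n0) [_].
  rewrite subnn => /dhomog0_const [s g2E].
  have sn0 : s != 0 by apply: contraNneq g2n0 => s0'; rewrite g2E s0' mpolyC0.
  have rg1 : rho g1 * mult_part = g1 * mult_part.
    by rewrite -[in LHS]rho_mult -rmorphM -G1 /= restrK.
  exists (s%:MP *: th1 - g1 *: th2), (z *: th2), (s * t); split.
  - split.
      apply: LU; first by apply: logderB; apply: logderZ.
      rewrite dotB !dotZ rmorphB !rmorphM /= G1 G2 restrC g2E.
      have -> : rho g1 * (s%:MP * mult_part) = s%:MP * (rho g1 * mult_part) by ring.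
      by rewrite rg1 subrr.
    apply: homvB; first by move=> k; rewrite mxE dhomog_mulC.
    have [->|g10] := eqVneq g1 0; first by move=> k; rewrite scale0r mxE dhomog0.
    move: (hdot _ _ h1); rewrite G1 mulrC => /(dhomog_cancel m0 hm)/(_ g10) [leb hg1].
    by move: (homvZ hg1 h2); rewrite subnK.
  - by split; [exact: LzU|exact: hz].
  - by rewrite mulf_neq0.
  rewrite defpolyU1 //.
  by rewrite det3Zr det3_subm detE mpolyCM; ring.
right; have L2' : logder (H |: J) th2 by apply: LU; rewrite // G2 g20 mul0r.
have [g10|g1n0] := eqVneq g1 0.
  have L1' : logder (H |: J) th1 by apply: LU; rewrite // G1 g10 mul0r.
  have [q] := defpoly_dvdm_det3 (@logder_euler (H |: J)) L1' L2'.
  rewrite detE defpolyU1 // mulrA => /(mulIf (defpoly_neq0 _)) e.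
  case: (@lin_ndvdm1 _ (al H)); exists ((t^-1)%:MP * q).
  by rewrite -mulrA -e -mpolyCM mulVf // mpolyC1.
move: (hdot _ _ h1); rewrite G1 mulrC => /(dhomog_cancel m0 hm)/(_ g1n0) [leb _].
split=> //; apply: free_exps_sym; exists (z *: th1), th2, t; split=> //.
  by split; [exact: LzU|exact: hz].
by rewrite defpolyU1 // det3Zm detE; ring.
Qed.

End RestrictToLine.

Lemma deletion H J a b : H \notin J -> free_exps (H |: J) a b ->
  ((npoints H J <= a.+1)%N /\
     (npoints H J = a.+1 -> exists2 b', b = b'.+1 & free_exps J a b')) \/
  (npoints H J = b.+1 /\ exists2 a', a = a'.+1 & free_exps J a' b).
Proof.
move=> HJ; have [v [w1 [w2 [uv wv1 wv2 uww]]]] := complete_basis (al_neq0 H).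
exact: (free_exps_deletion HJ uv wv1 wv2 uww).
Qed.

(** The second alternative of the preceding lemma gives exponents (a + 1, b) with b <= a; the
    deletion lemma bounds the number of points on H and leaves only a = b, for which these are
    the expected exponents. *)
Lemma addition H J a b : H \notin J -> free_exps J a b -> npoints H J = a.+1 ->
  free_exps (H |: J) a b.+1.
Proof.
move=> HJ FJ ha; have [v [w1 [w2 [uv wv1 wv2 uww]]]] := complete_basis (al_neq0 H).
have [//|[ba /[dup] Fba /(deletion HJ)]] := free_exps_addition_aux HJ uv FJ ha.
rewrite ha; case=> [[]|[/eqP]]; last by rewrite ltn_eqF.
rewrite ltnS => ab _; suff e : a = b by move: Fba; rewrite e.
by apply/eqP; rewrite eqn_leq ab ba.
Qed.

End Arrangement.

(** * Saito's criterion and graded dimensions of the module of derivations *)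

Section Saito.
Variables (K : fieldType) (T : finType) (al : T -> 'rV[K]_3).
Hypothesis alP : nonproportional al.
Local Notation S := {mpoly K[3]}.
Local Notation x := (euler K).
Implicit Types (J : {set T}) (th : 'rV[S]_3).

(** Cramer's rule: the three determinants are divisible by the defining polynomial, so the
    quotients are coefficients. The determinants themselves are recorded in order to read off the
    degrees of the coefficients. *)
Lemma saito J (a b c th : 'rV[S]_3) (t : K) :
  logder al J a -> logder al J b -> logder al J c -> t != 0 ->
  det3 a b c = t%:MP * defpoly al J -> logder al J th ->
  exists p q r, [/\ th = p *: a + q *: b + r *: c,
    det3 th b c = t%:MP * p * defpoly al J, det3 a th c = t%:MP * q * defpoly al J
    & det3 a b th = t%:MP * r * defpoly al J].
Proof.
move=> La Lb Lc t0 e Lth; have Q0 := defpoly_neq0 alP J.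
have [p eq_p] := defpoly_dvdm_det3 alP Lth Lb Lc.
have [q eq_q] := defpoly_dvdm_det3 alP La Lth Lc.
have [r eq_r] := defpoly_dvdm_det3 alP La Lb Lth.
have tV : (t%:MP * (t^-1)%:MP = 1 :> S) by rewrite -mpolyCM mulfV // mpolyC1.
have tQ0 : t%:MP * defpoly al J != 0 by rewrite mulf_neq0 // mpolyC_eq0.
exists ((t^-1)%:MP * p), ((t^-1)%:MP * q), ((t^-1)%:MP * r).
rewrite !mulrA tV !mul1r; split=> //.
apply/rowP => k; apply: (mulfI tQ0).
have := congr1 (fun A : 'rV_3 => A 0 k) (cramer3 a b c th).
rewrite e eq_p eq_q eq_r !mxE => ->.
have -> : t%:MP * defpoly al J * ((t^-1)%:MP * p * a 0 k + (t^-1)%:MP * q * b 0 k +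
    (t^-1)%:MP * r * c 0 k) = (t%:MP * (t^-1)%:MP) *
    (p * defpoly al J * a 0 k + q * defpoly al J * b 0 k + r * defpoly al J * c 0 k) by ring.
by rewrite tV mul1r.
Qed.
End Saito.

Section HomogeneousParts.
Variables (K : fieldType) (T : finType) (al v : T -> 'rV[K]_3).
Hypothesis alP : nonproportional al.
Hypothesis alv : forall i, kdot (al i) (v i) = 1.
Local Notation S := {mpoly K[3]}.
Local Notation x := (euler K).
Local Notation hp N := (dhomog 3 K N).
Implicit Types (J : {set T}).

Section Degree.
Variable N : nat.
Local Notation V := {ffun 'I_3 -> hp N}.

Definition vec_of (th : V) : 'rV[S]_3 := \row_k (th k : S).

Lemma homv_vec_of th : homv N (vec_of th).
Proof. by move=> k; rewrite mxE; case: (th k). Qed.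

(** The obstruction to being tangent to line i: the restriction to the line of the value of the
    field on its form. *)
Definition residue i (th : V) : hp N :=
  DHomog (restr_homog (al i) (v i) (dot_homog (al i) (homv_vec_of th))).

Fact residue_is_linear i : linear (residue i).
Proof.
move=> c th1 th2; apply: val_inj => /=.
have -> : vec_of (c *: th1 + th2) = c%:MP *: vec_of th1 + vec_of th2.
  by apply/rowP => k; rewrite !mxE !ffunE mul_mpolyC.
by rewrite dotZD rmorphD rmorphM /= restrC mul_mpolyC.
Qed.
HB.instance Definition _ i :=
  GRing.isLinear.Build K V (hp N) _ (residue i) (residue_is_linear i).

Definition logder_space J : {vspace V} := (\bigcap_(i in J) lker (linfun (residue i)))%VS.

Lemma mem_logder_space J th : th \in logder_space J <-> logder al J (vec_of th).
Proof.
rewrite memvE; split=> [/subv_bigcapP h i iJ|h].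
  apply/(restr_eq0 (alv i)); have := h i iJ; rewrite -memvE memv_ker lfunE /=.
  by move=> /eqP/(congr1 val).
apply/subv_bigcapP => i iJ; rewrite -memvE memv_ker lfunE /=.
by apply/eqP/val_inj; apply/(restr_eq0 (alv i)); apply: h.
Qed.

Lemma logder_spaceU1 H J : H \notin J ->
  logder_space (H |: J) = (logder_space J :&: lker (linfun (residue H)))%VS.
Proof. by move=> HJ; rewrite /logder_space big_setU1 //= capvC. Qed.

Lemma dim_logder_space0 : \dim (logder_space set0) = (3 * 'C(N.+2, 2))%N.
Proof.
rewrite /logder_space big_set0 dimvf.
change (#|'I_3| * 'C(N + 2, N) = 3 * 'C(N.+2, 2))%N.
by rewrite card_ord addn2 -(@bin_sub N.+2 2) // !subSS subn0.
Qed.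

(** A polynomial in two linear forms, written with its coefficients in order to bound dimensions:
    homogeneous of degree d, these form a space with d + 1 generators. *)
Definition binary_form (y1 y2 : S) d (c : nat -> K) : S :=
  \sum_(i < d.+1) (c i)%:MP * (y1 ^+ i * y2 ^+ (d - i)).

Lemma binary_formD y1 y2 d c c' :
  binary_form y1 y2 d c + binary_form y1 y2 d c' = binary_form y1 y2 d (fun i => c i + c' i).
Proof. by rewrite -big_split; apply: eq_bigr => i _ /=; rewrite mpolyCD mulrDl. Qed.

Lemma binary_formZ y1 y2 d t c :
  t%:MP * binary_form y1 y2 d c = binary_form y1 y2 d (fun i => t * c i).
Proof. by rewrite mulr_sumr; apply: eq_bigr => i _ /=; rewrite mpolyCM mulrA. Qed.

Lemma binary_formMl y1 y2 d c :
  y1 * binary_form y1 y2 d c = binary_form y1 y2 d.+1 (fun i => if i is i'.+1 then c i' else 0).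
Proof.
rewrite /binary_form [RHS]big_ord_recl mpolyC0 mul0r add0r mulr_sumr.
by apply: eq_bigr => i _; rewrite /= exprS subSS; ring.
Qed.

Lemma binary_formMr y1 y2 d c :
  y2 * binary_form y1 y2 d c = binary_form y1 y2 d.+1 (fun i => if i == d.+1 then 0 else c i).
Proof.
rewrite /binary_form [RHS]big_ord_recr /= eqxx mpolyC0 mul0r addr0 mulr_sumr.
apply: eq_bigr => i _ /=; rewrite ltn_eqF // subSn -1?ltnS // exprS; ring.
Qed.

Lemma binary_form_step y1 y2 d c (t1 t2 : K) : exists c',
  (t1%:MP * y1 + t2%:MP * y2) * binary_form y1 y2 d c = binary_form y1 y2 d.+1 c'.
Proof.
rewrite mulrDl -(mulrA _ y1) -(mulrA _ y2).
rewrite binary_formMl binary_formMr !binary_formZ binary_formD.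
by eexists.
Qed.

Lemma subst_binary_form (f : {rmorphism S -> S}) (y1 y2 : S) d p :
  (forall t : K, f t%:MP = t%:MP) ->
  (forall k, exists t1 t2 : K, f 'X_k = t1%:MP * y1 + t2%:MP * y2) ->
  p \is d.-homog -> exists c, f p = binary_form y1 y2 d c.
Proof.
move=> fC fX /dhomogP hd; rewrite [p]mpolyE rmorph_sum big_seq /=.
elim/big_ind: _ => [|q r [c ->] [c' ->]|m /hd <-].
- exists (fun=> 0); rewrite /binary_form big1 // => i _.
  by rewrite mpolyC0 mul0r.
- by rewrite binary_formD; eexists.
rewrite -mul_mpolyC rmorphM /= fC.
suff [c ->] : exists c, f 'X_[m] = binary_form y1 y2 (mdeg m) c.
  by rewrite binary_formZ; eexists.
rewrite mpolyXE_id mdegE rmorph_prod /=.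
elim/big_rec2: _ => [|k e q _ [c IH]].
  by exists (fun=> 1); rewrite /binary_form big_ord1 !expr0 mpolyC1 !mulr1.
rewrite rmorphXn /=; have [t1 [t2 ->]] := fX k.
elim: (m k) => [|j [c' IHj]]; first by rewrite expr0 mul1r IH; eexists.
rewrite exprS -mulrA IHj addSn; exact: binary_form_step.
Qed.

Lemma complete_basis_at (u v0 : 'rV[K]_3) : u != 0 -> kdot u v0 = 1 -> exists w1 w2,
  [/\ kdot w1 v0 = 0, kdot w2 v0 = 0 & det3 u w1 w2 != 0].
Proof.
move=> u0 uv; have [_ [w1 [w2 [_ _ _ d0]]]] := complete_basis u0.
exists (w1 - kdot w1 v0 *: u), (w2 - kdot w2 v0 *: u).
by rewrite det3_elim !kdotBl !kdotZl uv !mulr1 !subrr.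
Qed.

(** The fields tangent to H are the kernel of the residue on H, and the image of the residue
    consists of multiples of a fixed form of degree #|J| - h on H. *)
Lemma dim_logder_spaceU1 H J : H \notin J ->
  (\dim (logder_space J) <= \dim (logder_space (H |: J)) + (N.+1 - (#|J| - npoints al H J)))%N.
Proof.
move=> HJ; rewrite logder_spaceU1 //.
rewrite -(limg_ker_dim (linfun (residue H)) (logder_space J)) leq_add2l.
set e := (#|J| - npoints al H J)%N.
have [w1 [w2 [wv1 wv2 uww]]] := complete_basis_at (al_neq0 alP H) (alv H).
pose B := mult_part al H J (v H).
have hB : B \is e.-homog by apply: mult_homog.
have B0 : B != 0 by apply: mult_neq0.
pose mono i : hp N := insubd 0 (B * (lin w1 ^+ i * lin w2 ^+ (N - e - i))).
pose X := [seq mono i | i <- iota 0 (N.+1 - e)].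
have -> : (N.+1 - e = size X)%N by rewrite size_map size_iota.
apply: leq_trans (dim_span X); apply: dimvS; apply/subvP => w /memv_imgP [th].
move=> /mem_logder_space hth; rewrite lfunE /= => wE.
have [q qE] : dvdm B (val w) by rewrite wE; apply: mult_dvdm_dot hth.
have [q0|q0] := eqVneq q 0.
  have -> : w = 0 by apply: val_inj; rewrite qE q0 mul0r.
  exact: mem0v.
have hw : val w \is N.-homog by case: (w).
move: (hw); rewrite qE mulrC => /(dhomog_cancel B0 hB)/(_ q0) [leN hq].
have rq : restr (al H) (v H) q = q.
  apply: (mulIf B0); rewrite -qE wE /= -[RHS](restrK (alv H)).
  have -> : restr (al H) (v H) (dot (al H) (vec_of th)) = q * B by rewrite -qE wE.
  rewrite rmorphM /=; congr (_ * _); by rewrite /B rho_mult.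
have [k|c] := @subst_binary_form (restr (al H) (v H)) (lin w1) (lin w2) _ q
  (restrC _ _) _ hq.
  have [s [t1 [t2 e']]] := decompose uww (delta_mx 0 k).
  exists t1, t2; rewrite -lin_delta e' !linD !linZ !rmorphD !rmorphM /= !restrC.
  by rewrite restr_lin0 // !restr_lin wv1 wv2 !mul0r !subr0 mulr0 add0r.
rewrite /= rq => qc.
have -> : w = \sum_(i < (N - e).+1) c i *: mono i.
  apply: val_inj; rewrite qE qc mulr_suml /= raddf_sum; apply: eq_bigr => i _ /=.
  rewrite insubdK.
    by rewrite -mul_mpolyC -mulrA [_ * B]mulrC.
  have := dhomogM hB (dhomogM (dhomogMn i (lin_homog w1)) (dhomogMn (N - e - i) (lin_homog w2))).
  have ieN : (i <= N - e)%N by rewrite -ltnS.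
  by rewrite !mul1n (subnKC ieN) subnKC.
apply: memv_suml => i _; apply: memvZ; apply: memv_span; apply: map_f.
by rewrite mem_iota add0n /= subSn.
Qed.

End Degree.
End HomogeneousParts.

Section DimensionCount.
Variables (K : fieldType) (T : finType) (al v : T -> 'rV[K]_3).
Hypothesis alP : nonproportional al.
Hypothesis alv : forall i, kdot (al i) (v i) = 1.
Local Notation S := {mpoly K[3]}.
Local Notation x := (euler K).
Local Notation hp N := (dhomog 3 K N).
Implicit Types (J : {set T}).

Lemma npoints_le H J : (npoints al H J <= #|J|)%N. Proof. exact: leq_imset_card. Qed.

Lemma dim_hp N : \dim {:hp N} = 'C(N.+2, 2).
Proof.
rewrite dimvf; change ('C(N + 2, N) = 'C(N.+2, 2))%N.
by rewrite addn2 -(@bin_sub N.+2 2) // !subSS subn0.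
Qed.

(** Adding up the preceding bounds, one line after another. The function [s] is any function that
    grows by the number of points on the line that is added. *)
Lemma dim_logder_space_ge (s : {set T} -> nat) N J : s set0 = 0%N ->
  (forall H J, H \notin J -> s (H |: J) = s J + npoints al H J)%N -> (#|J| <= N)%N ->
  (3 * 'C(N.+2, 2) + 'C(#|J|, 2) <= \dim (logder_space al v N J) + #|J| * N.+1 + s J)%N.
Proof.
move=> s0 sU; move: {2}#|J| (erefl #|J|) => n; elim: n J => [|n IH] J.
  by move=> /cards0_eq ->; rewrite cards0 dim_logder_space0 s0 bin0n; lia.
move=> cJ; have /card_gt0P [H HJ] : (0 < #|J|)%N by rewrite cJ.
have HJ' : H \notin J :\ H by rewrite !inE eqxx.
rewrite -(setD1K HJ) cardsU1 HJ' sU // => nN.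
have cJ' : #|J :\ H| = n by have := cardsD1 H J; rewrite HJ cJ add1n => -[].
have := IH _ cJ' (ltnW nN); have := dim_logder_spaceU1 alP alv N HJ'.
have := npoints_le H (J :\ H); move: nN.
rewrite cJ' add1n (mulSn n N.+1) (binS n 1) bin1.
move: (npoints _ _ _) (\dim _ : nat) (\dim _ : nat) (s _) (n * _)%N => h d1 d2 s1 m; lia.
Qed.

(** For the upper bound, the fields of degree N that are multiples of a fixed homogeneous field. *)
Section Multiples.
Variables (N d : nat) (th : 'rV[S]_3).
Hypotheses (hth : homv d th) (dN : (d <= N)%N).

Fact multiple_homog (p : hp (N - d)) k : (p : S) * th 0 k \is N.-homog.
Proof. by rewrite -[N in N.-homog](subnK dN) dhomogM //; case: p. Qed.

Definition multiple (p : hp (N - d)) : {ffun 'I_3 -> hp N} :=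
  [ffun k => DHomog (multiple_homog p k)].
Fact multiple_is_linear : linear multiple.
Proof.
move=> c p q; apply/ffunP => k; rewrite !ffunE; apply: val_inj => /=.
by rewrite mulrDl scalerAl.
Qed.
HB.instance Definition _ :=
  GRing.isLinear.Build K (hp (N - d)) {ffun 'I_3 -> hp N} _ multiple multiple_is_linear.

Lemma dim_limg_multiple : (\dim (limg (linfun multiple)) <= 'C((N - d).+2, 2))%N.
Proof. by rewrite -dim_hp -(limg_ker_dim (linfun multiple) fullv) leq_addl. Qed.

End Multiples.

Lemma dim_logder_space_le N J a b : free_exps al J a b ->
  (0 < N)%N -> (a <= N)%N -> (b <= N)%N ->
  (\dim (logder_space al v N J) <=
   'C((N - 1).+2, 2) + 'C((N - a).+2, 2) + 'C((N - b).+2, 2))%N.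
Proof.
move=> /[dup] /(free_exps_card alP) cJ [th1 [th2 [t [[L1 h1] [L2 h2] t0 detE]]]] N0 aN bN.
have hx := @homv_euler K.
set U := limg (linfun (multiple hx N0)); set U1 := limg (linfun (multiple h1 aN)).
set U2 := limg (linfun (multiple h2 bN)).
apply: (@leq_trans (\dim (U + U1 + U2))).
  apply/dimvS/subvP => w /(mem_logder_space alv) Lw.
  have [p [q [r [wE pE qE rE]]]] := saito alP (@logder_euler _ _ al J) L1 L2 t0 detE Lw.
  have hw := homv_vec_of w.
  have hQ : defpoly al J \is (a + b).+1.-homog by rewrite -cJ prod_lin_homog.
  have Q0 := defpoly_neq0 alP J.
  have hom y e m : (m = e + (a + b).+1)%N ->
      t%:MP * y * defpoly al J \is m.-homog -> y \is e.-homog.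
    move=> ->; rewrite -mulrA => /(dhomog_mulC t^-1).
    rewrite mulrA -mpolyCM mulVf // mpolyC1 mul1r mulrC.
    by move=> /(dhomog_cancel0 Q0 hQ); rewrite addnK.
  have hp : p \is (N - 1).-homog.
    apply: (hom _ _ (N + (a + b))%N); first lia.
    by rewrite -pE; apply: det3_homog.
  have hq : q \is (N - a).-homog.
    apply: (hom _ _ (1 + (N + b))%N); first lia.
    by rewrite -qE; apply: det3_homog.
  have hr : r \is (N - b).-homog.
    apply: (hom _ _ (1 + (a + N))%N); first lia.
    by rewrite -rE; apply: det3_homog.
  have hm d th (hth : homv d th) (dN : (d <= N)%N) y : y \is (N - d).-homog ->
      exists2 w1, w1 \in limg (linfun (multiple hth dN)) & vec_of w1 = y *: th.
    move=> hy; exists (multiple hth dN (DHomog hy)).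
      by rewrite -[multiple _ _ _]lfunE memv_img // memvf.
    by apply/rowP => k; rewrite !mxE ffunE.
  have [wp wpU wpE] := hm _ _ hx N0 _ hp.
  have [wq wqU wqE] := hm _ _ h1 aN _ hq.
  have [wr wrU wrE] := hm _ _ h2 bN _ hr.
  have -> : w = wp + wq + wr.
    apply/ffunP => k; rewrite !ffunE; apply: val_inj => /=.
    move: wE wpE wqE wrE => /rowP/(_ k) + /rowP/(_ k) + /rowP/(_ k) + /rowP/(_ k).
    by rewrite !mxE => -> -> -> ->.
  by apply: memv_add => //; apply: memv_add.
apply: leq_trans (dimv_add_leqif _ _) _; apply: leq_add; last exact: dim_limg_multiple.
apply: leq_trans (dimv_add_leqif _ _) _; apply: leq_add; exact: dim_limg_multiple.
Qed.

(** The two bounds for the dimension are polynomials in the degree N with equal coefficients but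
    for the constant terms. They are compared at N = #|J|, where both are valid. *)
Lemma free_exps_npoints_sum (s : {set T} -> nat) J a b : s set0 = 0%N ->
  (forall H J, H \notin J -> s (H |: J) = s J + npoints al H J)%N ->
  free_exps al J a b -> (a * b + a + b <= s J)%N.
Proof.
move=> s0 sU FJ; have cJ := free_exps_card alP FJ.
have := dim_logder_space_ge s0 sU (leqnn #|J|).
have := @dim_logder_space_le #|J| _ _ _ FJ; rewrite cJ => /(_ _ _ _)H.
have {}H := H isT (leq_trans (leq_addr _ _) (leqnSn _)) (leq_trans (leq_addl _ _) (leqnSn _)).
move: H; have -> : ((a + b).+1 - a = b.+1)%N by lia.
have -> : ((a + b).+1 - b = a.+1)%N by lia.
rewrite subn1 /=.
have c2 n : ('C(n.+1, 2) * 2 = n.+1 * n)%N by rewrite mulnC -mul_bin_diag bin1.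
have := c2 (a + b).+2; have := c2 (a + b)%N; have := c2 (a + b).+1.
have := c2 a.+2; have := c2 b.+2; move: (\dim _ : nat) => d.
move: 'C((a + b).+3, 2) 'C((a + b).+1, 2) 'C((a + b).+2, 2) 'C(a.+3, 2) 'C(b.+3, 2).
move=> e1 e2 e3 e4 e5; lia.
Qed.

End DimensionCount.

(** * Counting intersection points *)

(** In this part only the incidence of lines and points matters. The points are represented by
    the sets of lines through them. *)
Section LinearSpace.
Local Open Scope nat_scope.
Variables (T : finType) (pencil : T -> T -> {set T}).
Hypothesis pencil_l : forall i j, i \in pencil i j.
Hypothesis pencil_r : forall i j, j \in pencil i j.
Hypothesis pencilC : forall i j, pencil i j = pencil j i.
Hypothesis pencil_eq : forall i j k, i != j -> i != k -> k \in pencil i j -> pencil i k = pencil i j.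
Implicit Types (i j k H : T) (J p : {set T}).

Definition blocks : {set {set T}} := [set pencil e.1 e.2 | e in [pred e : T * T | e.1 != e.2]].

Lemma pencil_blocks i j : i != j -> pencil i j \in blocks.
Proof. by move=> ij; apply/imsetP; exists (i, j). Qed.

Lemma blocks_pencil p i j : p \in blocks -> i != j -> i \in p -> j \in p -> p = pencil i j.
Proof.
case/imsetP=> [[k l] /=]; rewrite inE /= => kl -> ij ip jp.
have [ki|ki] := eqVneq k i; first by subst k; rewrite (pencil_eq kl ij jp).
have e := pencil_eq kl ki ip; rewrite -e in jp *.
have [<-|kj] := eqVneq k j; first by rewrite pencilC.
by rewrite pencilC in jp *; rewrite eq_sym in ki; rewrite (pencil_eq ki ij jp).
Qed.

(** The sum of m - 1 over the intersection points of J, where m is the number of lines of J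
    through the point. The truncated subtraction discards the blocks that J does not meet. *)
Definition excess J := \sum_(p in blocks) (#|p :&: J| - 1).

Lemma excess0 : excess set0 = 0.
Proof. by rewrite /excess big1 // => p _; rewrite setI0 cards0. Qed.

Lemma imset_pencil H J : H \notin J ->
  pencil H @: J = [set p in blocks | (H \in p) && (0 < #|p :&: J|)].
Proof.
move=> HJ; have Hn j : j \in J -> H != j by apply: contraTneq => <-.
apply/setP => p; rewrite inE; apply/imsetP/idP => [[j jJ ->]|/and3P[pB Hp]].
  rewrite pencil_blocks ?Hn // pencil_l; apply/card_gt0P; exists j.
  by rewrite inE pencil_r.
by case/card_gt0P=> j; rewrite inE => /andP[jp jJ]; exists j => //; apply: blocks_pencil; rewrite ?Hn.
Qed.

Lemma excessU1 H J : H \notin J -> excess (H |: J) = excess J + #|pencil H @: J|.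
Proof.
move=> HJ; rewrite imset_pencil // -sum1_card.
rewrite (eq_bigl (fun p => (p \in blocks) && ((H \in p) && (0 < #|p :&: J|)))); last first.
  by move=> p; rewrite inE.
rewrite big_mkcondr /= -big_split; apply: eq_bigr => p _ /=.
rewrite setIUr; have [Hp|Hp] := boolP (H \in p); last first.
  by rewrite (disjoint_setI0 (_ : [disjoint p & [set H]])) ?set0U ?addn0 // disjoint_sym disjoints1.
have -> : p :&: [set H] = [set H] by apply/setIidPr; rewrite sub1set.
rewrite cardsU1 inE (negPf HJ) andbF add1n subn1 /=.
by case: #|_| => //= n; rewrite subn1 addn1.
Qed.

Variable J : {set T}.

(** Every ordered pair of distinct lines is counted at its unique intersection point. *)
Lemma sum_pairs : \sum_(p in blocks) #|p :&: J| * (#|p :&: J| - 1) = #|J| * (#|J| - 1).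
Proof.
have card_pairs (A : {set T}) : \sum_(i in A) \sum_(j in A | j != i) 1 = #|A| * (#|A| - 1).
  rewrite (eq_bigr (fun=> #|A| - 1)) ?sum_nat_const // => i iA.
  have := cardsD1 i A; rewrite iA add1n => ->; rewrite subn1 /= -sum1_card.
  by apply: eq_bigl => j; rewrite !inE andbC.
rewrite -card_pairs -(eq_bigr _ (fun p _ => card_pairs (p :&: J))).
have -> : \sum_(p in blocks) \sum_(i in p :&: J) \sum_(j in p :&: J | j != i) 1 =
  \sum_(p in blocks) \sum_(i in J) \sum_(j in J | j != i) ((i \in p) && (j \in p)).
  apply: eq_bigr => p _; rewrite [RHS](bigID (mem p)) /= [X in _ + X]big1 ?addn0.
    apply: eq_big => [i|i]; first by rewrite inE andbC.
    rewrite inE => /andP[ip iJ]; rewrite [RHS](bigID (mem p)) /= [X in _ + X]big1 ?addn0.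
      apply: eq_big => [j|j]; first by rewrite inE; case: (j \in p); rewrite ?andbF ?andbT.
      by rewrite inE ip => /andP[/andP[-> _] _].
    by move=> j /andP[_ /negPf->]; rewrite andbF.
  by move=> i /andP[_ /negPf->]; rewrite big1.
rewrite exchange_big /=; apply: eq_bigr => i iJ.
rewrite exchange_big /=; apply: eq_bigr => j /andP[jJ ji].
rewrite (bigD1 (pencil i j)) ?pencil_blocks 1?eq_sym //= pencil_l pencil_r big1 // => p /andP[pB].
apply: contraNeq; rewrite eqb0 negbK => /andP[ip jp].
by apply/eqP/blocks_pencil; rewrite // eq_sym.
Qed.

Lemma sum_mult :
  \sum_(p in blocks | 1 < #|p :&: J|) #|p :&: J| = \sum_(H in J) #|pencil H @: (J :\ H)|.
Proof.
transitivity (\sum_(p in blocks | 1 < #|p :&: J|) \sum_(H in J) (H \in p)).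
  apply: eq_bigr => p _; rewrite -sum1_card big_mkcond [RHS]big_mkcond /=.
  by apply: eq_bigr => i _; rewrite inE; case: (i \in p); case: (i \in J).
rewrite exchange_big /=; apply: eq_bigr => H HJ.
rewrite imset_pencil ?inE ?eqxx // -sum1_card big_mkcond [RHS]big_mkcond /=.
apply: eq_bigr => p _; rewrite inE; case: (p \in blocks) => //=.
have [Hp|Hp] := boolP (H \in p); last by case: ifP.
have := cardsD1 H (p :&: J); rewrite inE Hp HJ add1n setIDA => ->.
by rewrite ltnS.
Qed.

(** For each point (m - 3)^2 = m (m - 1) + 4 m - 9 (m - 1) is nonnegative. Summing over the points,
    n (n - 1) + 4 n a >= 9 (ab + a + b), and a finite check leaves only the case of equality
    a = b = 4, where every m is 3. *)
Lemma few_points_count a b : {in J, forall H, #|pencil H @: (J :\ H)| <= a} ->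
  a <= b -> #|J| = (a + b).+1 -> 1 < #|J| < 11 -> a * b + a + b <= excess J ->
  [/\ a = 4, b = 4, #|J| = 9 &
      {in J &, forall i j, i != j -> #|pencil i j :&: J| = 3}].
Proof.
move=> ha ab cJ /andP[J1 J11] hs.
have a0 : 0 < a.
  have /card_gt0P [H HJ] : 0 < #|J| by apply: leq_trans J1.
  apply: leq_trans (ha _ HJ); rewrite card_gt0; apply/set0Pn.
  have /card_gt0P [j jJ] : 0 < #|J :\ H|.
    by have := cardsD1 H J; rewrite HJ; move: J1; lia.
  by exists (pencil H j); apply: imset_f.
have hm : \sum_(p in blocks | 1 < #|p :&: J|) #|p :&: J| <= #|J| * a.
  by rewrite sum_mult -sum_nat_const; apply: leq_sum.
(* Blocks meeting J in at most one line are not intersection points of J; they contribute 0 on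
   both sides. *)
have sq m : 9 * (m - 1) <= m * (m - 1) + 4 * (if 1 < m then m else 0) ?= iff (m <= 1) || (m == 3).
  apply/leqifP; case: m => [|[|[|[|m]]]] //=; rewrite subn1 /=; nia.
have E1 : \sum_(p in blocks) 9 * (#|p :&: J| - 1) = 9 * excess J.
  by rewrite /excess big_distrr.
have E2 : \sum_(p in blocks) 4 * (if 1 < #|p :&: J| then #|p :&: J| else 0) =
    4 * \sum_(p in blocks | 1 < #|p :&: J|) #|p :&: J|.
  by rewrite [in RHS]big_mkcondr big_distrr.
have [le_tot eq_tot] : 9 * excess J <= #|J| * (#|J| - 1) +
    4 * \sum_(p in blocks | 1 < #|p :&: J|) #|p :&: J| ?= iff
    [forall (p | p \in blocks), (#|p :&: J| <= 1) || (#|p :&: J| == 3)].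
  by rewrite -E1 -E2 -sum_pairs -big_split; apply: leqif_sum => p _; apply: sq.
have hs9 : 9 * (a * b + a + b) <= 9 * excess J by rewrite leq_mul2l hs.
move: (leq_trans hs9 le_tot) => h1; move: hm h1 le_tot eq_tot; rewrite cJ subn1 /=.
set Sm := \sum_(_ in _ | _) _ => hm h1 le_tot eq_tot.
have ab4 : a = 4 /\ b = 4.
  have : 9 * (a * b + a + b) <= (a + b).+1 * (a + b) + 4 * ((a + b).+1 * a) by lia.
  have {}J11 : a + b < 10 by rewrite -ltnS -cJ.
  move: a0 ab J11; clear; case: a => [|[|[|[|[|a]]]]]; try lia;
    by case: b => [|[|[|[|[|[|[|[|[|[|b]]]]]]]]]]; lia.
case: ab4 => a4 b4; split=> //; first by rewrite a4 b4.
subst a b; have : 9 * excess J = (4 + 4).+1 * (4 + 4) + 4 * Sm by lia.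
move/eqP; rewrite eq_tot => /forall_inP eqs i j iJ jJ ij.
have := eqs _ (pencil_blocks ij).
case/orP => [|/eqP//]; rewrite leqNgt; case/negP.
have /subset_leq_card : [set i; j] \subset pencil i j :&: J.
  by apply/subsetP => k; rewrite !inE => /orP[] /eqP->; rewrite ?pencil_l ?pencil_r ?iJ ?jJ.
by rewrite cards2 ij.
Qed.

End LinearSpace.

(** * Nine lines with only triple points *)

(** Nine lines such that each pair lies in exactly one triple form a Steiner triple system on nine
    points, which is unique: the affine plane of order 3. *)
Section Steiner.
Local Open Scope nat_scope.
Variables (T : finType) (pencil : T -> T -> {set T}).
Hypothesis pencil_l : forall i j, i \in pencil i j.
Hypothesis pencil_r : forall i j, j \in pencil i j.
Hypothesis pencilC : forall i j, pencil i j = pencil j i.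
Hypothesis pencil_eq : forall i j k, i != j -> i != k -> k \in pencil i j -> pencil i k = pencil i j.
Variable J : {set T}.
Hypothesis cardJ : #|J| = 9.
Hypothesis pencil3 : {in J &, forall i j, i != j -> #|pencil i j :&: J| = 3}.

Let third i j := odflt i [pick k in pencil i j :&: J | (k != i) && (k != j)].

Let thirdP i j : i \in J -> j \in J -> i != j ->
  [/\ third i j != i, third i j != j & pencil i j :&: J = [set i; j; third i j]].
Proof.
move=> iJ jJ ij; have c3 := pencil3 iJ jJ ij; rewrite /third.
have ijJ : [set i; j] \subset pencil i j :&: J.
  by apply/subsetP => k; rewrite !inE => /orP[] /eqP->; rewrite ?pencil_l ?pencil_r ?iJ ?jJ.
case: pickP => [k /= /andP[kB /andP[ki kj]]|none]; last first.
  have : pencil i j :&: J \subset [set i; j].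
    by apply/subsetP => k kB; have := none k; rewrite /= kB -negb_or => /negbFE; rewrite !inE.
  by move=> /subset_leq_card; rewrite c3 cards2 ij.
split=> //; apply/esym/eqP; rewrite setUC eqEcard; apply/andP; split.
  by apply/subsetP => l /setU1P[->//|]; apply: (subsetP ijJ).
by rewrite c3 cardsU1 cards2 ij !inE negb_or ki kj.
Qed.

(** All six equations are recorded, so that any second way of completing a pair to a triple
    contradicts distinctness by congruence closure alone. *)
Let third_spec i j : i \in J -> j \in J -> i <> j -> exists k,
  [/\ k \in J, k <> i /\ k <> j, k \in pencil i j &
      [/\ third i j = k, third j i = k, third i k = j &
          [/\ third k i = j, third j k = i & third k j = i]]].
Proof.
move=> iJ jJ /eqP ij; have [ki kj e] := thirdP iJ jJ ij; set k := third i j in ki kj e *.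
have kB : k \in pencil i j :&: J by rewrite e !inE eqxx orbT.
have [kb kJ] : k \in pencil i j /\ k \in J by move: kB; rewrite inE => /andP[].
have step u w s : u \in J -> w \in J -> u != w -> pencil u w = pencil i j ->
    s \in J -> s \in pencil i j -> s != u -> s != w -> third u w = s.
  move=> uJ wJ uw eB sJ sB su sw; have [_ _ e'] := thirdP uJ wJ uw.
  have : s \in [set u; w; third u w] by rewrite -e' eB inE sB.
  by rewrite !inE (negPf su) (negPf sw) /= => /eqP.
have ji : j != i by rewrite eq_sym.
have ik : i != k by rewrite eq_sym.
have jk : j != k by rewrite eq_sym.
have bik : pencil i k = pencil i j by apply: pencil_eq.
have bjk : pencil j k = pencil i j by rewrite (pencilC i); apply: pencil_eq => //; rewrite pencilC.
have bi := pencil_l i j; have bj := pencil_r i j.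
exists k; split=> //; first by split; apply/eqP.
split; [by []| | |split]; apply: step => //; by rewrite pencilC.
Qed.

(** The labels are found greedily: a, b, d are not concurrent, c, e, f, k complete pairs, and g, h
    are the two lines that remain. The third line of the pair b, f must be g or h, say g; then
    all the other triples are forced. *)
Lemma steiner9 : exists a b c d e f g h k,
  [/\ uniq [:: a; b; c; d; e; f; g; h; k] /\ J =i [:: a; b; c; d; e; f; g; h; k],
      d \notin pencil a b,
      [/\ c \in pencil a b, e \in pencil a d, f \in pencil c e & k \in pencil a f] &
      [/\ g \in pencil b f, g \in pencil c d, h \in pencil b e, h \in pencil d f &
          h \in pencil a g /\ k \in pencil b d]].
Proof.
have [a aJ] : exists a, a \in J by apply/card_gt0P; rewrite cardJ.
have new (s : seq T) : size s < 9 -> exists2 y, y \in J & y \notin s.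
  move=> ss; have /subsetPn[y yJ ys] : ~~ (J \subset [set y in s]).
    apply/negP => /subset_leq_card; rewrite cardJ leqNgt; case/negP.
    by apply: leq_ltn_trans ss; rewrite cardsE card_size.
  by exists y => //; rewrite inE in ys.
have [b bJ] := new [:: a] isT; rewrite inE => /eqP/nesym ab.
have [c [cJ [ca cb] cB [c1 c2 c3 [c4 c5 c6]]]] := third_spec aJ bJ ab.
have [d dJ] := new [:: a; b; c] isT; rewrite !inE !negb_or => /and3P[/eqP da /eqP db /eqP dc].
have [e [eJ [ea ed] eB [e1 e2 e3 [e4 e5 e6]]]] := third_spec aJ dJ (nesym da).
have eb : e <> b by congruence.
have ec : e <> c by congruence.
have [f [fJ [fc fe] fB [f1 f2 f3 [f4 f5 f6]]]] := third_spec cJ eJ (nesym ec).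
have fa : f <> a by congruence.
have fb : f <> b by congruence.
have fd : f <> d by congruence.
have [k [kJ [ka kf] kB [k1 k2 k3 [k4 k5 k6]]]] := third_spec aJ fJ (nesym fa).
have kb : k <> b by congruence.
have kc : k <> c by congruence.
have kd : k <> d by congruence.
have ke : k <> e by congruence.
have [g [h [gh gJ hJ Jdef]]] : exists g h, [/\ g <> h, g \notin [:: a; b; c; d; e; f; k],
   h \notin [:: a; b; c; d; e; f; k] & J =i [:: a; b; c; d; e; f; g; h; k]].
  pose s := [set y in [:: a; b; c; d; e; f; k]].
  have us : uniq [:: a; b; c; d; e; f; k].
    by rewrite /= !inE !negb_or andbT; do ![apply/andP; split]; apply/eqP; congruence.
  have sJ : s \subset J.
    by apply/subsetP => y; rewrite !inE; do ![case/orP|move/eqP->].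
  have /cards2P [g [h [gh JsE]]] : #|J :\: s| == 2.
    by rewrite cardsDS // cardJ cardsE (card_uniqP us).
  have gs : g \in J :\: s by rewrite JsE !inE eqxx.
  have hs : h \in J :\: s by rewrite JsE !inE eqxx orbT.
  exists g, h; split; [exact/eqP| | |].
  - by move: gs; rewrite inE => /andP[]; rewrite inE.
  - by move: hs; rewrite inE => /andP[]; rewrite inE.
  move=> y; have [ys|ys] := boolP (y \in s).
    rewrite (subsetP sJ) //; move: ys; rewrite !inE.
    by do ![case/orP|move/eqP->]; rewrite eqxx ?orbT.
  have -> : (y \in J) = (y \in J :\: s) by rewrite inE ys.
  rewrite JsE; move: ys; rewrite !inE !negb_or.
  by do 6![case/andP => /negPf->]; move=> /negPf->; rewrite !orbF.
have memJ y : y \in J -> [\/ y = a, y = b | y = c] \/ [\/ y = d, y = e | y = f] \/ [\/ y = g, y = h | y = k].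
  rewrite Jdef !inE; do 8?[case/orP]; move/eqP => ->;
  by [left; constructor|right; left; constructor|right; right; constructor].
have gJ' : g \in J by rewrite Jdef !inE eqxx !orbT.
have hJ' : h \in J by rewrite Jdef !inE eqxx !orbT.
have third_gh g' h' : g' <> h' -> [/\ g' <> a, g' <> b, g' <> c & g' <> d] ->
   [/\ g' <> e, g' <> f & g' <> k] -> [/\ h' <> a, h' <> b, h' <> c & h' <> d] ->
   [/\ h' <> e, h' <> f & h' <> k] -> g' \in J -> h' \in J ->
   (forall y, y \in J -> [\/ y = a, y = b | y = c] \/ [\/ y = d, y = e | y = f] \/
      [\/ y = g', y = h' | y = k]) -> third b f = g' ->
   [/\ [/\ g' \in pencil b f, g' \in pencil c d, h' \in pencil b e, h' \in pencil d f &
          h' \in pencil a g'] & k \in pencil b d].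
  move=> gh' [ga gb gc gd] [ge gf gk] [ha hb hc hd] [he hf hk] gJ1 hJ1 mem bfg.
  have [y [yJ1 [yb yf] yB [y1 y2 y3 [y4 y5 y6]]]] := third_spec bJ fJ (nesym fb).
  have ? : y = g' by congruence.
  subst y.
  have [y [yJ2 [ya yg] hB [h1 h2 h3 [h4 h5 h6]]]] := third_spec aJ gJ1 (nesym ga).
  have ? : y = h'.
    by case: (mem y yJ2) => [|[]] [] E; (exact: E) || (exfalso; congruence).
  subst y.
  have [y [yJ3 [yd yf'] hB2 [i1 i2 i3 [i4 i5 i6]]]] := third_spec dJ fJ (nesym fd).
  have ? : y = h'.
    by case: (mem y yJ3) => [|[]] [] E; (exact: E) || (exfalso; congruence).
  subst y.
  have [y [yJ4 [yb' ye] hB3 [j1 j2 j3 [j4 j5 j6]]]] := third_spec bJ eJ (nesym eb).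
  have yk : y <> k.
    move=> yk; subst y.
    have [z [zJ [ze zg] _ [z1 z2 z3 [z4 z5 z6]]]] := third_spec eJ gJ1 (nesym ge).
    by case: (mem z zJ) => [|[]] [] E; congruence.
  have ? : y = h'.
    by case: (mem y yJ4) => [|[]] [] E; (exact: E) || (exfalso; congruence).
  subst y.
  have [y [yJ5 [yb2 yd2] kB2 [l1 l2 l3 [l4 l5 l6]]]] := third_spec bJ dJ (nesym db).
  have ? : y = k.
    by case: (mem y yJ5) => [|[]] [] E; (exact: E) || (exfalso; congruence).
  subst y.
  have [y [yJ6 [yc2 yd3] gB2 [m1 m2 m3 [m4 m5 m6]]]] := third_spec cJ dJ (nesym dc).
  have ? : y = g'.
    by case: (mem y yJ6) => [|[]] [] E; (exact: E) || (exfalso; congruence).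
  subst y; have mv p q r : third p q = r -> third p q \in pencil p q -> r \in pencil p q by move=> ->.
  by split; [split|]; first [assumption|apply: mv; eassumption].
have neqs y : y \notin [:: a; b; c; d; e; f; k] ->
    [/\ y <> a, y <> b, y <> c & y <> d] /\ [/\ y <> e, y <> f & y <> k].
  by rewrite !inE !negb_or; do 6![case/andP => /eqP ?]; move=> /eqP ?.
have [ga gb] := neqs _ gJ; have [ha hb] := neqs _ hJ.
have memJ' y : y \in J -> [\/ y = a, y = b | y = c] \/ [\/ y = d, y = e | y = f] \/ [\/ y = h, y = g | y = k].
  move=> /memJ [|[]] [] ->; try by [left; constructor|right; left; constructor|right; right; constructor].
have dB : d \notin pencil a b.
  apply/negP => dB; have [_ _ E] := thirdP aJ bJ (introN eqP ab).
  have : d \in [set a; b; third a b] by rewrite -E inE dB.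
  by rewrite c1 !inE => /orP[/orP[]|] /eqP.
have uJ y z : y <> z -> y \notin [:: a; b; c; d; e; f; k] ->
    z \notin [:: a; b; c; d; e; f; k] -> uniq [:: a; b; c; d; e; f; y; z; k].
  move=> yz /neqs[[? ? ? ?] [? ? ?]] /neqs[[? ? ? ?] [? ? ?]].
  by rewrite /= !inE !negb_or andbT; do ![apply/andP; split]; apply/eqP; congruence.
have [y [yJ [yb yf] yB [y1 y2 y3 [y4 y5 y6]]]] := third_spec bJ fJ (nesym fb).
(* If b, d, f were concurrent, the two remaining lines would be concurrent both with a and
   with f. *)
have yd : y <> d.
  move=> yd; subst y; case: (ga) (gb) (ha) (hb) => ga1 ? ? ? [? gf1 ?] [? ? ? ?] [? ? ?].
  have [z [zJ [za zg] _ [z1 z2 z3 [z4 z5 z6]]]] := third_spec aJ gJ' (nesym ga1).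
  have [w [wJ [wf wg] _ [w1 w2 w3 [w4 w5 w6]]]] := third_spec fJ gJ' (nesym gf1).
  have ? : z = h by case: (memJ z zJ) => [|[]] [] E; (exact: E) || (exfalso; congruence).
  by case: (memJ w wJ) => [|[]] [] E; congruence.
have [yg|yh] : y = g \/ y = h.
  by case: (memJ y yJ) => [|[]] [] E; (by left) || (by right) || (exfalso; congruence).
- have [[? ? ? ? ?] ?] := third_gh g h gh ga gb ha hb gJ' hJ' memJ (etrans y1 yg).
  by exists a, b, c, d, e, f, g, h, k; split=> //; split=> //; apply: uJ.
have [[? ? ? ? ?] ?] := third_gh h g (nesym gh) ha hb ga gb hJ' gJ' memJ' (etrans y1 yh).
exists a, b, c, d, e, f, h, g, k; split=> //; split; first by apply: uJ => //; apply: nesym.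
move=> z; rewrite Jdef !inE; do 6!congr (_ || _); exact: orbCA.
Qed.
End Steiner.

(** * Free bases for the dual Hesse arrangement *)

Section DualHesse.
Variable K : fieldType.
Local Notation S := {mpoly K[3]}.
Local Notation x := (euler K).
Implicit Types (u v w P : 'rV[K]_3).

Lemma dual_vector u v w : det3 u v w != 0 -> exists P,
  [/\ kdot u P = 1, kdot v P = 0 & kdot w P = 0].
Proof.
move=> d0; pose c : 'rV[K]_3 := \row_k
  (if k == o0 then v 0 o1 * w 0 o2 - v 0 o2 * w 0 o1
   else if k == o1 then v 0 o2 * w 0 o0 - v 0 o0 * w 0 o2
   else v 0 o0 * w 0 o1 - v 0 o1 * w 0 o0).
exists ((det3 u v w)^-1 *: c).
have kE y : kdot y ((det3 u v w)^-1 *: c) = (det3 u v w)^-1 * det3 y v w.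
  rewrite kdotC kdotZl kdotC; congr (_ * _).
  by rewrite /kdot sum3 /c !mxE /= /det3; ring.
by rewrite !kE mulVf // det3_aab det3_aba !mulr0.
Qed.

Definition const_field P : 'rV[S]_3 := map_mx (@mpolyC _ K) P.

Lemma dot_const u P : dot u (const_field P) = (kdot u P)%:MP.
Proof. by rewrite /dot /kdot rmorph_sum; apply: eq_bigr => k _; rewrite mxE /= mpolyCM. Qed.

Lemma homv_const P : homv 0 (const_field P).
Proof. by move=> k; rewrite mxE dhomogC. Qed.

Lemma prod_set_seq (T : finType) (J : {set T}) (s : seq T) (F : T -> S) :
  uniq s -> J =i s -> \prod_(i in J) F i = \prod_(i <- s) F i.
Proof. by move=> us Js; rewrite (big_uniq _ us) /=; apply: eq_bigl. Qed.

Section Vertices.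
Variables u1 u2 u3 : 'rV[K]_3.
Hypothesis uuu : det3 u1 u2 u3 != 0.
Variable t : K.
Hypothesis tP : t ^+ 2 + t + 1 = 0.
Local Notation U1 := (lin u1).
Local Notation U2 := (lin u2).
Local Notation U3 := (lin u3).

Let t3 : t ^+ 3 = 1.
Proof.
apply/eqP; rewrite -subr_eq0; apply/eqP.
have -> : t ^+ 3 - 1 = (t - 1) * (t ^+ 2 + t + 1) by ring.
by rewrite tP mulr0.
Qed.

(** When s runs over the cube roots of unity, these are the nine linear factors of
    (u2^3 + u3^3)(u1^3 - u3^3)(u1^3 + u2^3). *)
Definition ceva_dir (s : K) w :=
  [\/ w = u2 + s *: u3, w = u1 - s *: u3 | w = u1 + s *: u2].

(** These are the fields x^4 d/dx + y^4 d/dy + z^4 d/dz and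
    y^2 z^2 d/dx + x^2 z^2 d/dy + x^2 y^2 d/dz, which are tangent to the lines x = s y, x = s z and
    y = s z, in the coordinates x = u1, y = - u2, z = u3. *)
Lemma ceva_fields : exists th1 th2 : 'rV[S]_3,
  [/\ homv 4 th1, homv 4 th2,
      forall s w, s ^+ 3 = 1 -> ceva_dir s w ->
        dvdm (lin w) (dot w th1) /\ dvdm (lin w) (dot w th2) &
      (det3 u1 u2 u3)%:MP * det3 x th1 th2 =
       (U2 ^+ 3 + U3 ^+ 3) * (U3 ^+ 3 - U1 ^+ 3) * (U1 ^+ 3 + U2 ^+ 3)].
Proof.
have [P1 [P11 P12 P13]] := dual_vector uuu.
have [P2 [P22 P23 P21]] : exists P, [/\ kdot u2 P = 1, kdot u3 P = 0 & kdot u1 P = 0].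
  by apply: dual_vector; rewrite det3_rot.
have [P3 [P33 P31 P32]] : exists P, [/\ kdot u3 P = 1, kdot u1 P = 0 & kdot u2 P = 0].
  by apply: dual_vector; rewrite -det3_rot.
pose fld (p q r : S) := p *: const_field P1 + q *: const_field P2 + r *: const_field P3.
have d1 p q r : dot u1 (fld p q r) = p.
  by rewrite /fld !dotD !dotZ !dot_const P11 P21 P31 mpolyC1 mpolyC0; ring.
have d2 p q r : dot u2 (fld p q r) = q.
  by rewrite /fld !dotD !dotZ !dot_const P12 P22 P32 mpolyC1 mpolyC0; ring.
have d3 p q r : dot u3 (fld p q r) = r.
  by rewrite /fld !dotD !dotZ !dot_const P13 P23 P33 mpolyC1 mpolyC0; ring.
have hfld p q r : p \is 4.-homog -> q \is 4.-homog -> r \is 4.-homog -> homv 4 (fld p q r).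
  have hz y P : y \is 4.-homog -> homv 4 (y *: const_field P).
    by move=> hy; rewrite -[4%N]addn0; apply: homvZ => //; apply: homv_const.
  by move=> hp hq hr; apply: homvD; first apply: homvD; apply: hz.
have h4 w : lin w ^+ 4 \is 4.-homog by apply: (dhomogMn 4 (lin_homog w)).
have h22 w w' : lin w ^+ 2 * lin w' ^+ 2 \is 4.-homog.
  exact: (dhomogM (dhomogMn 2 (lin_homog w)) (dhomogMn 2 (lin_homog w'))).
exists (fld (U1 ^+ 4) (- U2 ^+ 4) (U3 ^+ 4)),
       (fld (U2 ^+ 2 * U3 ^+ 2) (- (U1 ^+ 2 * U3 ^+ 2)) (U1 ^+ 2 * U2 ^+ 2)).
split.
- by apply: hfld; rewrite ?rpredN.
- by apply: hfld; rewrite ?rpredN.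
- move=> s w s3; have s4 : (s%:MP : S) = s%:MP ^+ 4.
    by rewrite -rmorphXn /= exprS s3 mulr1.
  case=> ->.
  + rewrite linD linZ !(dotDl, dotZl) !d2 !d3; split.
      exists (- ((U2 - s%:MP * U3) * (U2 ^+ 2 + s%:MP ^+ 2 * U3 ^+ 2))).
      by rewrite {1}s4; ring.
    exists (s%:MP * U1 ^+ 2 * (U2 - s%:MP * U3)).
    have -> : s%:MP * U1 ^+ 2 * (U2 - s%:MP * U3) * (U2 + s%:MP * U3) =
      s%:MP * (U1 ^+ 2 * U2 ^+ 2) - s%:MP ^+ 3 * (U1 ^+ 2 * U3 ^+ 2) by ring.
    by rewrite -rmorphXn /= s3 mpolyC1; ring.
  + rewrite linB linZ !(dotBl, dotZl) !d1 !d3; split.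
      exists ((U1 + s%:MP * U3) * (U1 ^+ 2 + s%:MP ^+ 2 * U3 ^+ 2)).
      by rewrite {1}s4; ring.
    exists (- (s%:MP * U2 ^+ 2 * (U1 + s%:MP * U3))).
    have -> : - (s%:MP * U2 ^+ 2 * (U1 + s%:MP * U3)) * (U1 - s%:MP * U3) =
      s%:MP ^+ 3 * (U2 ^+ 2 * U3 ^+ 2) - s%:MP * (U1 ^+ 2 * U2 ^+ 2) by ring.
    by rewrite -rmorphXn /= s3 mpolyC1; ring.
  rewrite linD linZ !(dotDl, dotZl) !d1 !d2; split.
    exists ((U1 - s%:MP * U2) * (U1 ^+ 2 + s%:MP ^+ 2 * U2 ^+ 2)).
    by rewrite {1}s4; ring.
  exists (- (s%:MP * U3 ^+ 2 * (U1 - s%:MP * U2))).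
  have -> : - (s%:MP * U3 ^+ 2 * (U1 - s%:MP * U2)) * (U1 + s%:MP * U2) =
    s%:MP ^+ 3 * (U2 ^+ 2 * U3 ^+ 2) - s%:MP * (U1 ^+ 2 * U3 ^+ 2) by ring.
  by rewrite -rmorphXn /= s3 mpolyC1; ring.
rewrite det3_dots !d1 !d2 !d3 /lin.
by move: (dot u1 x) (dot u2 x) (dot u3 x) => p q r; ring.
Qed.

Lemma cube_factor (p q : S) :
  (p + q) * (p + t%:MP * q) * (p + (t ^+ 2)%:MP * q) = p ^+ 3 + q ^+ 3.
Proof.
have e1 : t%:MP + (t ^+ 2)%:MP = - 1 :> S.
  have tt : t + t ^+ 2 = - 1 by apply/eqP; rewrite -subr_eq0 opprK -tP; apply/eqP; ring.
  by rewrite -mpolyCD tt mpolyCN mpolyC1.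
have e2 : t%:MP * (t ^+ 2)%:MP = 1 :> S by rewrite -mpolyCM -exprS t3 mpolyC1.
have -> : (p + q) * (p + t%:MP * q) * (p + (t ^+ 2)%:MP * q) =
  (p + q) * (p ^+ 2 + (t%:MP + (t ^+ 2)%:MP) * (p * q) + (t%:MP * (t ^+ 2)%:MP) * q ^+ 2) by ring.
by rewrite e1 e2; ring.
Qed.

Lemma ceva_free_exps (T : finType) (al : T -> 'rV[K]_3) (J : {set T})
  (a b c d e f g h k : T) (ca cb cc cd ce cf cg ch ck : K) :
  uniq [:: a; b; c; d; e; f; g; h; k] -> J =i [:: a; b; c; d; e; f; g; h; k] ->
  all (fun c => c != 0) [:: ca; cb; cc; cd; ce; cf; cg; ch; ck] ->
  [/\ al a = ca *: (u2 + 1 *: u3), al b = cb *: (u2 + t ^+ 2 *: u3) &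
      al c = cc *: (u2 + t *: u3)] ->
  [/\ al d = cd *: (u1 - 1 *: u3), al f = cf *: (u1 - t *: u3) &
      al h = ch *: (u1 - t ^+ 2 *: u3)] ->
  [/\ al e = ce *: (u1 + 1 *: u2), al g = cg *: (u1 + t ^+ 2 *: u2) &
      al k = ck *: (u1 + t *: u2)] ->
  free_exps al J 4 4.
Proof.
move=> us Js; rewrite /= => /and5P[ca0 cb0 cc0 cd0 /and5P[ce0 cf0 cg0 ch0 /andP[ck0 _]]].
move=> [aE bE cE] [dE fE hE] [eE gE kE].
have [th1 [th2 [h1 h2 L D]]] := ceva_fields.
have t1 : (1 : K) ^+ 3 = 1 by rewrite expr1n.
have t23 : (t ^+ 2) ^+ 3 = 1 by rewrite exprAC t3 expr1n.
have memJ i : i \in J -> exists s w r, [/\ s ^+ 3 = 1, ceva_dir s w, r != 0 & al i = r *: w].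
  rewrite Js !inE; do 8?[case/orP]; move/eqP => ->.
  - by do 3!eexists; split; last exact: aE; [exact: t1|constructor 1|].
  - by do 3!eexists; split; last exact: bE; [exact: t23|constructor 1|].
  - by do 3!eexists; split; last exact: cE; [exact: t3|constructor 1|].
  - by do 3!eexists; split; last exact: dE; [exact: t1|constructor 2|].
  - by do 3!eexists; split; last exact: eE; [exact: t1|constructor 3|].
  - by do 3!eexists; split; last exact: fE; [exact: t3|constructor 2|].
  - by do 3!eexists; split; last exact: gE; [exact: t23|constructor 3|].
  - by do 3!eexists; split; last exact: hE; [exact: t23|constructor 2|].
  - by do 3!eexists; split; last exact: kE; [exact: t3|constructor 3|].
have cancel r w p : r != 0 -> dvdm (lin w) p -> dvdm (lin (r *: w)) (r%:MP * p).
  by move=> r0 [q ->]; exists q; rewrite linZ; ring.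
pose C := - (ca * cb * cc * (cd * cf * ch) * (ce * cg * ck)).
have C0 : C != 0 by rewrite /C oppr_eq0 !mulf_neq0.
have QE : defpoly al J = C%:MP * ((det3 u1 u2 u3)%:MP * det3 x th1 th2).
  rewrite D /defpoly (prod_set_seq _ us Js) !big_cons big_nil.
  rewrite aE bE cE dE eE fE gE hE kE !linZ !linB !linD !linZ -!cube_factor.
  have -> : U3 ^+ 3 - U1 ^+ 3 = - (U1 ^+ 3 + (- U3) ^+ 3) by ring.
  by rewrite -cube_factor /C mpolyCN !mpolyCM mpolyC1; ring.
exists th1, th2, (C * det3 u1 u2 u3)^-1; split.
- split=> // i /memJ [s [w [r [s3 sw r0 ->]]]].
  by rewrite dotZl; apply: cancel => //; case: (L s w s3 sw).
- split=> // i /memJ [s [w [r [s3 sw r0 ->]]]].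
  by rewrite dotZl; apply: cancel => //; case: (L s w s3 sw).
- by rewrite invr_eq0 mulf_neq0.
rewrite QE; move: (det3 x th1 th2) => D3.
by rewrite mulrA -mpolyCM mulrA -mpolyCM -[_^-1 * C * _]mulrA mulVf ?mpolyC1 ?mul1r // mulf_neq0.
Qed.

End Vertices.
End DualHesse.

Section HesseCoordinates.
Variable K : fieldType.
Hypothesis char_neq3 : 3%:R != 0 :> K.

Lemma indep3 (A B D : 'rV[K]_3) (x1 y1 z1 x2 y2 z2 : K) : det3 A B D != 0 ->
  x1 *: A + y1 *: B + z1 *: D = x2 *: A + y2 *: B + z2 *: D ->
  [/\ x1 = x2, y1 = y2 & z1 = z2].
Proof.
move=> d0 e; split; apply: (mulIf d0).
- by rewrite -(det3_coefl x1 y1 z1) e det3_coefl.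
- by rewrite -(det3_coefm x1 y1 z1) e det3_coefm.
by rewrite -(det3_coefr x1 y1 z1) e det3_coefr.
Qed.

Variables (T : finType) (al : T -> 'rV[K]_3).
Hypothesis alP : nonproportional al.

Lemma mem_pencil_coef i j k : i != j -> i != k -> j != k -> k \in pencil al i j ->
  exists s t, [/\ s != 0, t != 0 & al k = s *: al i + t *: al j].
Proof.
move=> ij ik jk /(mem_pencilP alP _ ij) [s [t e]]; exists s, t; split=> //.
  apply: contraNneq jk => s0; apply/eqP/(proj2 alP _ _ t).
  by rewrite e s0 scale0r add0r.
apply: contraNneq ik => t0; apply/eqP/(proj2 alP _ _ s).
by rewrite e t0 scale0r addr0.
Qed.

(** Scaling a, b, d suitably makes c = A + B and e proportional to A + D. The line f in the pencil of
    c and e introduces one parameter t; the lines g, h, k are then intersections of pencils, and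
    the last concurrency, of a, g, h, is the equation t^2 + t + 1 = 0. *)
Lemma hesse_coordinates (a b c d e f g h k : T) :
  uniq [:: a; b; c; d; e; f; g; h; k] -> d \notin pencil al a b ->
  [/\ c \in pencil al a b, e \in pencil al a d, f \in pencil al c e & k \in pencil al a f] ->
  [/\ g \in pencil al b f, g \in pencil al c d, h \in pencil al b e, h \in pencil al d f &
      h \in pencil al a g /\ k \in pencil al b d] ->
  exists (A B D : 'rV[K]_3) (t ca cb cd ce cf cg ch ck : K),
  [/\ det3 A B D != 0 /\ t ^+ 2 + t + 1 = 0,
      all (fun c => c != 0) [:: ca; cb; cd; ce; cf; cg; ch; ck],
      [/\ al a = ca *: A, al b = cb *: B, al d = cd *: D & al c = A + B],
      [/\ al e = ce *: (A + D), al f = cf *: ((1 + t) *: A + B + t *: D) &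
          al k = ck *: (B + t *: D)] &
      al g = cg *: ((1 + t) *: A + (1 + t) *: B + t *: D) /\
      al h = ch *: ((1 + t) *: A + B + (1 + t) *: D)].
Proof.
move=> us dab [cab ead fce kaf] [gbf gcd hbe hdf [hag kbd]].
have ne i j : (i < 9)%N -> (j < 9)%N -> i != j ->
    nth a [:: a; b; c; d; e; f; g; h; k] i != nth a [:: a; b; c; d; e; f; g; h; k] j.
  by move=> i9 j9; rewrite nth_uniq.
have [s1 [s2 [s10 s20 cE]]] :=
  mem_pencil_coef (ne 0 1 isT isT isT) (ne 0 2 isT isT isT) (ne 1 2 isT isT isT) cab.
have [r1 [r2 [r10 r20 eE]]] :=
  mem_pencil_coef (ne 0 3 isT isT isT) (ne 0 4 isT isT isT) (ne 3 4 isT isT isT) ead.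
have [p [q [p0 q0 fE]]] :=
  mem_pencil_coef (ne 2 4 isT isT isT) (ne 2 5 isT isT isT) (ne 4 5 isT isT isT) fce.
have [m1 [m2 [m10 m20 gE]]] :=
  mem_pencil_coef (ne 1 5 isT isT isT) (ne 1 6 isT isT isT) (ne 5 6 isT isT isT) gbf.
have [n1 [n2 [n10 n20 gE']]] :=
  mem_pencil_coef (ne 2 3 isT isT isT) (ne 2 6 isT isT isT) (ne 3 6 isT isT isT) gcd.
have [h1 [h2 [h10 h20 hE]]] :=
  mem_pencil_coef (ne 1 4 isT isT isT) (ne 1 7 isT isT isT) (ne 4 7 isT isT isT) hbe.
have [l1 [l2 [l10 l20 hE']]] :=
  mem_pencil_coef (ne 3 5 isT isT isT) (ne 3 7 isT isT isT) (ne 5 7 isT isT isT) hdf.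
have [w1 [w2 [w10 w20 hE'']]] :=
  mem_pencil_coef (ne 0 6 isT isT isT) (ne 0 7 isT isT isT) (ne 6 7 isT isT isT) hag.
have [k1 [k2 [k10 k20 kE]]] :=
  mem_pencil_coef (ne 0 5 isT isT isT) (ne 0 8 isT isT isT) (ne 5 8 isT isT isT) kaf.
have [k3 [k4 [k30 k40 kE']]] :=
  mem_pencil_coef (ne 1 3 isT isT isT) (ne 1 8 isT isT isT) (ne 3 8 isT isT isT) kbd.
pose dd := s1 * r2 / r1; pose t := q * (r1 / s1) / p.
have dd0 : dd != 0 by rewrite /dd !mulf_neq0 ?invr_eq0.
pose A := s1 *: al a; pose B := s2 *: al b; pose D := dd *: al d.
have ABD : det3 A B D != 0.
  rewrite /A /B /D det3Zl det3Zm det3Zr !mulf_neq0 ?invr_eq0 //.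
  by move: dab; rewrite /pencil inE.
have aA : al a = s1^-1 *: A by rewrite /A scalerA mulVf // scale1r.
have bB : al b = s2^-1 *: B by rewrite /B scalerA mulVf // scale1r.
have dD : al d = dd^-1 *: D by rewrite /D scalerA mulVf // scale1r.
have eA : al e = (r1 / s1) *: (A + D).
  rewrite eE /A /D /dd; apply/rowP => i; rewrite !mxE; field; exact/andP.
have fA : al f = p *: ((1 + t) *: A + B + t *: D).
  rewrite fE eA cE -/A -/B /t; apply/rowP => i; rewrite !mxE; field; exact/andP.
move: (aA) (bB) (dD) eA fA (cE); rewrite -/A -/B; clearbody A B D t dd.
move=> {}aA {}bB {}dD eA fA cA {cE eE fE}.
have g1 : al g = (m2 * p * (1 + t)) *: A + (m1 / s2 + m2 * p) *: B + (m2 * p * t) *: D.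
  by rewrite gE bB fA; apply/rowP => i; rewrite !mxE; field.
have g2 : al g = n1 *: A + n1 *: B + (n2 / dd) *: D.
  by rewrite gE' dD cA; apply/rowP => i; rewrite !mxE; field; rewrite ?s10 ?s20 ?dd0 ?p0.
have h1' : al h = (h2 * (r1 / s1)) *: A + (h1 / s2) *: B + (h2 * (r1 / s1)) *: D.
  by rewrite hE bB eA; apply/rowP => i; rewrite !mxE; field; rewrite ?s10 ?s20 ?dd0 ?p0.
have h2' : al h = (l2 * p * (1 + t)) *: A + (l2 * p) *: B + (l1 / dd + l2 * p * t) *: D.
  by rewrite hE' dD fA; apply/rowP => i; rewrite !mxE; field; rewrite ?s10 ?s20 ?dd0 ?p0.
have k1' : al k = (k1 / s1 + k2 * p * (1 + t)) *: A + (k2 * p) *: B + (k2 * p * t) *: D.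
  by rewrite kE aA fA; apply/rowP => i; rewrite !mxE; field; rewrite ?s10 ?s20 ?dd0 ?p0.
have k2' : al k = 0 *: A + (k3 / s2) *: B + (k4 / dd) *: D.
  by rewrite kE' bB dD; apply/rowP => i; rewrite !mxE; field; rewrite ?s10 ?s20 ?dd0 ?p0.
have [eg1 eg2 _] := indep3 ABD (etrans (esym g1) g2).
have gF : al g = (m2 * p) *: ((1 + t) *: A + (1 + t) *: B + t *: D).
  by rewrite g1 eg2 -eg1 !scalerDr !scalerA.
have [eh1 eh2 _] := indep3 ABD (etrans (esym h1') h2').
have hF : al h = (l2 * p) *: ((1 + t) *: A + B + (1 + t) *: D).
  by rewrite h1' eh2 eh1 !scalerDr !scalerA.
have [ek1 _ _] := indep3 ABD (etrans (esym k1') k2').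
have kF : al k = (k2 * p) *: (B + t *: D).
  by rewrite k1' ek1 scale0r add0r !scalerDr !scalerA.
have h3 : al h = (w1 / s1 + w2 * (m2 * p) * (1 + t)) *: A + (w2 * (m2 * p) * (1 + t)) *: B
    + (w2 * (m2 * p) * t) *: D.
  by rewrite hE'' aA gF; apply/rowP => i; rewrite !mxE; field; rewrite ?s10 ?s20 ?dd0 ?p0.
have h4 : al h = (l2 * p * (1 + t)) *: A + (l2 * p) *: B + (l2 * p * (1 + t)) *: D.
  by rewrite hF !scalerDr !scalerA.
have [_ w1E w2E] := indep3 ABD (etrans (esym h4) h3).
exists A, B, D, t, s1^-1, s2^-1, dd^-1, (r1 / s1), p, (m2 * p), (l2 * p), (k2 * p).
split=> //; last by rewrite /= !invr_eq0 s10 s20 dd0 p0 !mulf_neq0 ?invr_eq0.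
split=> //; have W0 : w2 * (m2 * p) != 0 by rewrite !mulf_neq0.
apply: (mulfI W0); rewrite mulr0.
have -> : w2 * (m2 * p) * (t ^+ 2 + t + 1) =
  (w2 * (m2 * p) * (1 + t)) * (1 + t) - w2 * (m2 * p) * t by ring.
by rewrite -w1E -w2E subrr.
Qed.

(** The three vertices through which three parallel classes of lines pass give new coordinates
    u1, u2, u3, with A = u2 + u3, B = t^2 u2 + t u3 and D = u1 - u3, in which the lines take the
    form of [ceva_dir]. *)
Lemma dual_hesse_free_exps (J : {set T}) (a b c d e f g h k : T) :
  uniq [:: a; b; c; d; e; f; g; h; k] -> J =i [:: a; b; c; d; e; f; g; h; k] ->
  d \notin pencil al a b ->
  [/\ c \in pencil al a b, e \in pencil al a d, f \in pencil al c e & k \in pencil al a f] ->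
  [/\ g \in pencil al b f, g \in pencil al c d, h \in pencil al b e, h \in pencil al d f &
      h \in pencil al a g /\ k \in pencil al b d] ->
  free_exps al J 4 4.
Proof.
move=> us Js dab l1 l2.
have [A [B [D [t [ca [cb [cd [ce [cf [cg [ch [ck]]]]]]]]]]]] := hesse_coordinates us dab l1 l2.
move=> [[ABD tP] c0 [aE bE dE cE] [eE fE kE] [gE hE]].
have t3 : t ^+ 3 = 1.
  apply/eqP; rewrite -subr_eq0; apply/eqP.
  have -> : t ^+ 3 - 1 = (t - 1) * (t ^+ 2 + t + 1) by ring.
  by rewrite tP mulr0.
have t0 : t != 0 by apply/eqP => t0; move/eqP: tP; rewrite t0 expr0n /= !add0r oner_eq0.
have tt0 : t - t ^+ 2 != 0.
  apply: contraNneq char_neq3 => tt; apply/eqP.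
  have -> : (3%:R : K) = t ^+ 2 + t + 1 - (t - 1) * (t + 2%:R) by ring.
  have -> : t - 1 = 0; last by rewrite tP mul0r subr0.
  by apply: (mulfI t0); rewrite mulr0 -[RHS]oppr0 -tt; ring.
pose u3 := (t - t ^+ 2)^-1 *: (B - t ^+ 2 *: A).
pose u2 := A - u3; pose u1 := D + u3.
have AE : A = u2 + u3 by rewrite subrK.
have DE : D = u1 - u3 by rewrite /u1 addrK.
have BE : B = t ^+ 2 *: u2 + t *: u3.
  by rewrite /u2 /u3; apply/rowP => i; rewrite !mxE; field.
have uuu : det3 u1 u2 u3 != 0.
  apply: contraNneq ABD => u0; rewrite AE BE DE.
  have -> : det3 (u2 + u3) (t ^+ 2 *: u2 + t *: u3) (u1 - u3) =
    (t - t ^+ 2) * det3 u1 u2 u3 by rewrite /det3 !mxE; ring.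
  by rewrite u0 mulr0.
clearbody u1 u2 u3; move: (c0) => /= /and5P[ca0 cb0 cd0 ce0 /and5P[cf0 cg0 ch0 ck0 _]].
(* All remaining equalities of coefficients hold modulo t^2 + t + 1; the factors are supplied
   explicitly. *)
have red (P Q : K) (Z : K) : P - Q = (t ^+ 2 + t + 1) * Z -> P = Q.
  by rewrite tP mul0r => /subr0_eq.
apply: (@ceva_free_exps _ u1 u2 u3 uuu t tP _ al J a b c d e f g h k
  ca (cb * t ^+ 2) (- t) cd ce (cf * t) (cg * t) (- (ch * t ^+ 2)) (ck * t)) => //.
- by rewrite /= ca0 cd0 ce0 !oppr_eq0 t0 !mulf_neq0 ?expf_neq0.
- split.
  + by rewrite aE AE scale1r.
  + rewrite bE BE; apply/rowP => i; rewrite !mxE.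
    by apply: (red _ _ (cb * (t - t ^+ 2) * u3 0 i)); ring.
  + rewrite cE AE BE; apply/rowP => i; rewrite !mxE.
    by apply: (red _ _ (u2 0 i + u3 0 i)); ring.
- split.
  + by rewrite dE DE scale1r.
  + rewrite fE AE BE DE; apply/rowP => i; rewrite !mxE.
    by apply: (red _ _ (cf * (u2 0 i + u3 0 i))); ring.
  + rewrite hE AE BE DE; apply/rowP => i; rewrite !mxE.
    apply: (red _ _ (ch * (u1 0 i + u2 0 i + (t - t ^+ 2) * u3 0 i))); ring.
split.
- by rewrite eE AE DE scale1r addrACA [u3 - _]addrC; congr (_ *: _); apply/rowP => i; rewrite !mxE; ring.
- rewrite gE AE BE DE; apply/rowP => i; rewrite !mxE.
  apply: (red _ _ (cg * (u2 0 i + u3 0 i))); ring.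
rewrite kE BE DE; apply/rowP => i; rewrite !mxE; ring.
Qed.
End HesseCoordinates.

(** * The exponents are combinatorial *)

Section Transfer.
Variables (K : fieldType) (T : finType).
Hypothesis char_neq3 : 3%:R != 0 :> K.
Implicit Types (al : T -> 'rV[K]_3) (J : {set T}).

Lemma free_exps1 al i : nonproportional al -> free_exps al [set i] 0 0.
Proof.
move=> alP; have [_ [w1 [w2 [_ _ _ d0]]]] := complete_basis (al_neq0 alP i).
have [P1 [P11 P12 P13]] : exists P, [/\ kdot w1 P = 1, kdot w2 P = 0 & kdot (al i) P = 0].
  by apply: dual_vector; rewrite det3_rot.
have [P2 [P22 P23 P21]] : exists P, [/\ kdot w2 P = 1, kdot (al i) P = 0 & kdot w1 P = 0].
  by apply: dual_vector; rewrite -det3_rot.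
have L P : kdot (al i) P = 0 -> logder al [set i] (const_field P).
  by move=> P0 j /set1P ->; rewrite dot_const P0 mpolyC0; apply: dvdm0.
exists (const_field P1), (const_field P2), (det3 (al i) w1 w2)^-1; split.
- by split; [apply: L|apply: homv_const].
- by split; [apply: L|apply: homv_const].
- by rewrite invr_eq0.
rewrite /defpoly big_set1; have dC : (det3 (al i) w1 w2)%:MP != 0 :> {mpoly K[3]} by rewrite mpolyC_eq0.
apply: (mulfI dC); rewrite det3_dots !dot_const P11 P12 P13 P22 P23 P21 [RHS]mulrA -[in RHS]mpolyCM mulfV //.
by rewrite !mpolyC1 !mpolyC0 /lin; ring.
Qed.

(** Induction on the number of lines. If some line carries more than a <= b points, remove it from
    the first arrangement and add it back to the second one. Otherwise the counting argument
    identifies the dual Hesse configuration. *)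
Lemma free_exps_combinatorial al al' J a b : nonproportional al -> nonproportional al' ->
  (forall i j, i != j -> pencil al i j = pencil al' i j) ->
  (#|J| < 11)%N -> free_exps al J a b -> free_exps al' J a b.
Proof.
move=> alP alP' eq_pencil.
have eq_npoints H J' : H \notin J' -> npoints al H J' = npoints al' H J'.
  move=> HJ; congr #|pred_of_set _|; apply: eq_in_imset => j jJ.
  by apply: eq_pencil; apply: contraNneq HJ => ->.
move: {2}#|J| (erefl #|J|) => n; elim: n J a b => [|n IH] J a b cJ J11 F.
  by have := free_exps_card alP F; rewrite cJ.
wlog le_ab : a b F / (a <= b)%N.
  move=> W; have [/W|/ltnW/W] := leqP a b; first exact.
  by move=> /(_ (free_exps_sym F)) /free_exps_sym.
have cab := free_exps_card alP F.
have [n0|n0] := posnP n.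
  have /cards1P [i Ji] : #|J| == 1%N by rewrite cJ n0.
  have [-> ->] : a = 0%N /\ b = 0%N by move: cab; rewrite cJ n0; lia.
  by rewrite Ji; apply: free_exps1.
have [/existsP[H /andP[HJ lta]]|/existsPn stuck] :=
  boolP [exists H in J, (a < npoints al H (J :\ H))%N].
  have HJ' : H \notin J :\ H by rewrite !inE eqxx.
  have cJ' : #|J :\ H| = n by have := cardsD1 H J; rewrite HJ cJ add1n => -[].
  have J11' : (#|J :\ H| < 11)%N by rewrite cJ' -ltnS -cJ ltnW.
  move: (F); rewrite -{1}(setD1K HJ) => /(deletion alP HJ').
  case=> [[le_a del]|[hb [a' a'E F']]].
    have ha : npoints al H (J :\ H) = a.+1 by apply/eqP; rewrite eqn_leq le_a.
    have [b' -> F'] := del ha.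
    rewrite -(setD1K HJ); apply: addition => //; first exact: IH.
    by rewrite -eq_npoints.
  rewrite a'E -(setD1K HJ); apply: free_exps_sym; apply: addition => //.
    by apply: free_exps_sym; apply: IH.
  by rewrite -eq_npoints.
have [v vP] := fin_all_exists (fun i => exists_kdot1 (al_neq0 alP i)).
have excU H J' : H \notin J' ->
    excess (pencil al) (H |: J') = (excess (pencil al) J' + npoints al H J')%N.
  apply: excessU1; [exact: mem_pencil_l|exact: mem_pencil_r|exact: pencil_sym|exact: pencil_eq].
have hs := free_exps_npoints_sum alP vP (excess0 (pencil al)) excU F.
have [] := @few_points_count T (pencil al) (mem_pencil_l al) (mem_pencil_r al) (pencil_sym al)
  (pencil_eq alP) J a b _ le_ab cab _ hs.
- by move=> H HJ; have := stuck H; rewrite HJ -leqNgt.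
- by rewrite J11 cJ ltnS n0.
move=> -> -> c9 pencil3.
have [a1 [b1 [c1 [d1 [e1 [f1 [g1 [h1 [k1 [[us Js] dab l1 l2]]]]]]]]]] :=
  steiner9 (mem_pencil_l al') (mem_pencil_r al') (pencil_sym al') (pencil_eq alP') c9
    (fun i j iJ jJ ij => etrans (congr1 (fun A => #|pred_of_set (A :&: J)|) (esym (eq_pencil i j ij)))
       (pencil3 i j iJ jJ ij)).
exact: (dual_hesse_free_exps char_neq3 alP' us Js dab l1 l2).
Qed.

End Transfer.

(** * A free module of derivations has a homogeneous basis containing the Euler field *)

Lemma det3_comb (R : comNzRingType) (a b c : 'rV[R]_3) (p1 q1 r1 p2 q2 r2 p3 q3 r3 : R) :
  det3 (p1 *: a + q1 *: b + r1 *: c) (p2 *: a + q2 *: b + r2 *: c)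
       (p3 *: a + q3 *: b + r3 *: c) =
  (p1 * (q2 * r3 - r2 * q3) - q1 * (p2 * r3 - r2 * p3) + r1 * (p2 * q3 - q2 * p3))
  * det3 a b c.
Proof. by rewrite /det3 !mxE; ring. Qed.

(** A linearly independent family that spans Q times the standard basis has three elements. If M
    is the matrix of the family and N that of the coefficients, then N M = Q; by independence also
    M N = Q, and comparing traces gives the size. *)
Section FamilyOfVectors.
Variables (R : idomainType) (V : eqType) (P : V -> Prop) (beta : V -> 'rV[R]_3).
(* Natural numbers are determined by their images in the ring, so that a trace determines a
   size. *)
Hypothesis char0 : forall m n, m%:R = n%:R :> R -> m = n.
Hypothesis indep : forall (s : seq V) (c : V -> R), uniq s -> (forall b, b \in s -> P b) ->
  \sum_(b <- s) c b *: beta b = 0 -> forall b, b \in s -> c b = 0.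

Definition in_span (w : 'rV[R]_3) := exists (s : seq V) (c : V -> R),
  (forall b, b \in s -> P b) /\ w = \sum_(b <- s) c b *: beta b.

Lemma sum_sub_seq (s t : seq V) (c : V -> R) : uniq t -> {subset s <= t} ->
  \sum_(b <- s) c b *: beta b = \sum_(b <- t) ((count_mem b s)%:R * c b) *: beta b.
Proof.
move=> ut; elim: s => [|y s IH] st.
  by rewrite big_nil big1 // => b _; rewrite mul0r scale0r.
rewrite big_cons IH => [|b bs]; last by apply: st; rewrite in_cons bs orbT.
under [RHS]eq_bigr => b _ do rewrite /= natrD mulrDl scalerDl.
rewrite big_split /=; congr (_ + _).
rewrite (bigD1_seq y) ?st ?mem_head //= eqxx mul1r big1 ?addr0 // => b.
by rewrite eq_sym => /negPf->; rewrite mul0r scale0r.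
Qed.

Lemma basis_three (Q : R) : Q != 0 -> (forall k, in_span (Q *: delta_mx 0 k)) ->
  exists b1 b2 b3, [/\ P b1, P b2, P b3 & forall w, in_span w -> exists p q r,
    w = p *: beta b1 + q *: beta b2 + r *: beta b3].
Proof.
move=> Q0 Qspan.
have [sk /fin_all_exists [ck skP]] := fin_all_exists Qspan.
pose s := undup (flatten [seq sk k | k <- enum 'I_3]).
have us : uniq s by apply: undup_uniq.
have sks k : {subset sk k <= s}.
  move=> b bs; rewrite mem_undup; apply/flatten_mapP; exists k => //.
  by rewrite mem_enum.
have Ps b : b \in s -> P b.
  by rewrite mem_undup => /flatten_mapP [k _]; case: (skP k) => H _; apply: H.
pose N k b := (count_mem b (sk k))%:R * ck k b.
have QN k : Q *: delta_mx 0 k = \sum_(b <- s) N k b *: beta b.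
  by have [_ ->] := skP k; apply: sum_sub_seq.
have Qw (w : 'rV[R]_3) : Q *: w = \sum_(b <- s) (\sum_k w 0 k * N k b) *: beta b.
  rewrite [w in LHS]matrix_sum_delta big_ord1 scaler_sumr.
  under [RHS]eq_bigr => b _ do rewrite scaler_suml.
  rewrite exchange_big; apply: eq_bigr => k _ /=.
  rewrite scalerA mulrC -scalerA QN scaler_sumr.
  by apply: eq_bigr => b _; rewrite scalerA.
(* A further member b would be dependent, as Q b is a combination of the others. *)
have PsE b : P b -> b \in s.
  move=> Pb; apply/negPn/negP => bs.
  have := @indep (b :: s) (fun y => if y == b then - Q else \sum_k beta b 0 k * N k y).
  rewrite /= bs us => /(_ isT) H.
  have : - Q = 0.
    rewrite -[LHS](_ : (fun y => if y == b then - Q else \sum_k beta b 0 k * N k y) b = - Q);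
      last by rewrite /= eqxx.
    apply: H; [|rewrite big_cons eqxx|exact: mem_head].
      by move=> y; rewrite in_cons => /predU1P [->|/Ps].
    rewrite scaleNr Qw addrC; apply/eqP; rewrite subr_eq0; apply/eqP.
    rewrite !big_seq; apply: eq_bigr => y ys; case: eqP => // yb.
    by rewrite -yb ys in bs.
  by move/eqP; rewrite oppr_eq0 (negPf Q0).
have size3 : size s = 3.
  pose tr := \sum_(b <- s) \sum_k beta b 0 k * N k b.
  have tr3 : tr = Q * 3%:R.
    rewrite /tr exchange_big /= -[3%:R](_ : \sum_(k < 3) 1 = _); last first.
      by rewrite sumr_const card_ord.
    rewrite mulr_sumr; apply: eq_bigr => k _; have := congr1 (fun A : 'rV_3 => A 0 k) (QN k).
    rewrite summxE !mxE !eqxx => ->; apply: eq_bigr => b _.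
    by rewrite mxE mulrC.
  have trm : tr = Q * (size s)%:R.
    rewrite /tr -sum1_size natr_sum mulr_sumr big_seq [RHS]big_seq; apply: eq_bigr => b bs.
    rewrite mulr1; apply/eqP; rewrite -subr_eq0; apply/eqP.
    have := @indep s (fun y => (\sum_k beta b 0 k * N k y) - (if y == b then Q else 0)) us Ps.
    move=> /(_ _ b bs); rewrite eqxx; apply.
    under eq_bigr => y _ do rewrite scalerBl.
    rewrite sumrB -Qw (bigD1_seq b) //= eqxx big1 ?addr0 ?subrr // => y /negPf->.
    by rewrite scale0r.
  by apply: char0; apply: (mulfI Q0); rewrite -trm tr3.
move: us Ps PsE size3 {sks QN Qw N}; case: {skP}s => [|b1 [|b2 [|b3 [|]]]] // us Ps PsE _.
exists b1, b2, b3; split; try by apply: Ps; rewrite !inE eqxx ?orbT.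
move=> w [t [c [Pt ->]]]; rewrite (sum_sub_seq c us); last by move=> b /Pt/PsE.
by rewrite !big_cons big_nil addr0 addrA; do 3!eexists.
Qed.

End FamilyOfVectors.

(** The invariant of the following steps is a determinant G * Q with G nonzero at the origin. It
    survives both the replacement of a vector by the Euler field and the passage to a
    suitable homogeneous component, and when everything is homogeneous G must be constant. *)
Section HomogeneousBasis.
Variables (K : fieldType) (T : finType) (al : T -> 'rV[K]_3) (J : {set T}).
Hypothesis alP : nonproportional al.
Hypothesis J0 : J != set0.
Local Notation S := {mpoly K[3]}.
Local Notation x := (euler K).
Local Notation ev0 := (meval (fun=> 0 : K)).
Local Notation Q := (defpoly al J).
Local Notation D := (logder al J).
Implicit Types th : 'rV[S]_3.

(** A divisor of a product of linear forms is, up to a constant, a product of some of them; all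
    that matters is that it is divisible by one of them or does not vanish at the origin. *)
Lemma dvdm_prod_lin (s : seq T) (g : S) : dvdm g (\prod_(i <- s) lin (al i)) ->
  ev0 g != 0 \/ exists2 i, i \in s & dvdm (lin (al i)) g.
Proof.
move=> [h]; elim: s g h => [|i s IH] g h.
  rewrite big_nil => /(congr1 ev0); rewrite meval1 mevalM => e; left.
  by apply/eqP => g0; move/eqP: e; rewrite g0 mulr0 oner_eq0.
rewrite big_cons => e.
have [_ iP] := primem_lin (al_neq0 alP i).
have : dvdm (lin (al i)) (h * g) by rewrite -e; apply/dvdm_mulr/dvdmm.
case/iP => [[q hq]|]; last by right; exists i; rewrite ?mem_head.
have [|g0|[j js ij]] := IH g q.
- by apply: (mulfI (lin_al_neq0 alP i)); rewrite e hq; ring.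
- by left.
by right; exists j; rewrite // in_cons js orbT.
Qed.

Lemma ev0_defpoly : ev0 Q = 0.
Proof.
have /set0Pn [i iJ] := J0.
rewrite /defpoly (bigD1 i iJ) /= mevalM linE rmorph_sum big1 ?mul0r // => k _.
by rewrite rmorphM /= mevalXU mulr0.
Qed.

Lemma ev0_homog d (p : S) : p \is d.-homog -> ev0 p != 0 -> d = 0%N.
Proof.
move=> /dhomogP hp; apply: contraNeq => d0; rewrite mevalE big_seq big1 // => m mp.
have [i mi] : exists i, m i != 0%N.
  apply/existsP; apply: contraNT d0; rewrite negb_exists => /forallP m0.
  by rewrite -(hp _ mp) /= mdegE big1 // => i _; have /eqP := negbNE (m0 i).
by rewrite (bigD1 i) //= expr0n (negPf mi) mul0r mulr0.
Qed.

Lemma ev0_neq0 (p : S) : ev0 p != 0 -> p != 0.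
Proof. by apply: contraNneq => ->; rewrite meval0. Qed.

Lemma logder_pihomog d th : D th -> D (map_mx (pihomog mdeg d) th).
Proof.
move=> h i iJ; have -> : dot (al i) (map_mx (pihomog mdeg d) th) = pihomog mdeg d (dot (al i) th).
  rewrite /dot raddf_sum; apply: eq_bigr => k _.
  by rewrite !mxE !mul_mpolyC /= linearZ.
have [q ->] := h i iJ; rewrite mulrC (pihomog_mull _ _ (lin_homog _)).
by case: ifP => _; [apply/dvdm_mulr/dvdmm|apply: dvdm0].
Qed.

Lemma homv_pihomog d th : homv d (map_mx (pihomog mdeg d) th).
Proof. by move=> k; rewrite mxE pihomogP. Qed.

Lemma vector_pihomog th : exists N,
  th = \sum_(d < N) map_mx (pihomog mdeg d) th.
Proof.
exists (\max_(k < 3) mmeasure mdeg (th ord0 k)); apply/rowP => k.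
rewrite summxE [LHS](pihomog_partitionE (leq_bigmax (F := fun k => mmeasure mdeg (th ord0 k)) k)).
by apply: eq_bigr => d _; rewrite !mxE.
Qed.

(** If [eta] is additive and sends logarithmic fields to multiples of Q, then G is the sum of the
    quotients belonging to the homogeneous components, one of which is nonzero at the origin. *)
Lemma pick_component (eta : 'rV[S]_3 -> S) th G :
  (forall N (f : 'I_N -> 'rV[S]_3), eta (\sum_d f d) = \sum_d eta (f d)) ->
  (forall th, D th -> dvdm Q (eta th)) -> D th -> eta th = G * Q -> ev0 G != 0 ->
  exists d th' G', [/\ D th', homv d th', eta th' = G' * Q & ev0 G' != 0].
Proof.
move=> eta_sum etaQ Dth e G0; have [N thE] := vector_pihomog th.
have comp (d : 'I_N) : exists g, eta (map_mx (pihomog mdeg d) th) = g * Q.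
  exact/etaQ/logder_pihomog.
have [g gE] := fin_all_exists comp.
have GE : G = \sum_d g d.
  apply: (mulIf (defpoly_neq0 alP J)); rewrite -e thE eta_sum mulr_suml.
  by apply: eq_bigr => d _; rewrite -gE.
have [d gd] : exists d, ev0 (g d) != 0.
  apply/existsP; apply: contraNT G0; rewrite negb_exists => /forallP g0.
  by rewrite GE rmorph_sum big1 // => d _; have /eqP := negbNE (g0 d).
exists d, (map_mx (pihomog mdeg d) th), (g d).
by split; [apply: logder_pihomog|apply: homv_pihomog| |].
Qed.

Lemma free_exps_of_euler_basis th1 th2 G : D th1 -> D th2 ->
  det3 x th1 th2 = G * Q -> ev0 G != 0 -> exists a b, free_exps al J a b.
Proof.
move=> D1 D2 e G0; have Dx := @logder_euler K T al J.
have sum_m c N (f : 'I_N -> 'rV[S]_3) : det3 x (\sum_d f d) c = \sum_d det3 x (f d) c.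
  elim/big_rec2: _ => [|d u v _ IH]; first by rewrite -[0 in LHS](scale0r 0) det3Zm mul0r.
  by rewrite -[f d in LHS]scale1r det3ZDm mul1r IH.
have sum_r b N (f : 'I_N -> 'rV[S]_3) : det3 x b (\sum_d f d) = \sum_d det3 x b (f d).
  elim/big_rec2: _ => [|d u v _ IH]; first by rewrite -[0 in LHS](scale0r 0) det3Zr mul0r.
  by rewrite -[f d in LHS]scale1r det3ZDr mul1r IH.
have [a [t1 [G1 [Dt1 ht1 e1 G10]]]] := pick_component (sum_m th2)
  (fun th Dth => defpoly_dvdm_det3 alP Dx Dth D2) D1 e G0.
have [b [t2 [G2 [Dt2 ht2 e2 G20]]]] := pick_component (sum_r t1)
  (fun th Dth => defpoly_dvdm_det3 alP Dx Dt1 Dth) D2 e1 G10.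
have hQ : Q \is #|J|.-homog by apply: prod_lin_homog.
have := det3_homog (@homv_euler K) ht1 ht2.
rewrite e2 mulrC => /(dhomog_cancel (defpoly_neq0 alP J) hQ)/(_ (ev0_neq0 G20)) [_ hG2].
have [t G2E] : exists t, G2 = t%:MP.
  by apply: dhomog0_const; move: hG2 (ev0_homog hG2 G20) => /[swap] ->.
exists a, b, t1, t2, t; split=> //; last by rewrite e2 G2E.
by apply: contraNneq G20 => t0; rewrite G2E t0 mpolyC0 meval0.
Qed.

Variables (e1 e2 e3 : 'rV[S]_3).
Hypotheses (De1 : D e1) (De2 : D e2) (De3 : D e3).
Hypothesis span : forall w, D w -> exists p q r, w = p *: e1 + q *: e2 + r *: e3.

Lemma det3_span a b c : D a -> D b -> D c -> exists N, det3 a b c = N * det3 e1 e2 e3.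
Proof.
move=> /span [p1 [q1 [r1 ->]]] /span [p2 [q2 [r2 ->]]] /span [p3 [q3 [r3 ->]]].
by rewrite det3_comb; eexists.
Qed.

(** For each line i, the fields Q times v and Q / l_i times two vectors spanning the plane of i are
    logarithmic and have determinant Q (Q / l_i)^2 up to a constant. Hence G divides
    (Q / l_i)^2 for every i, and no linear form of the arrangement can divide G. *)
Lemma det3_basis_const G : det3 e1 e2 e3 = G * Q -> ev0 G != 0.
Proof.
move=> eG.
have key i : i \in J -> dvdm G (defpoly al (J :\ i) ^+ 2).
  move=> iJ; have [_ [w1 [w2 [_ _ _ d0]]]] := complete_basis (al_neq0 alP i).
  have [Pa [Pa1 Pa2 Pa3]] := dual_vector d0.
  have [Pb [Pb2 Pb3 Pb1]] : exists P, [/\ kdot w1 P = 1, kdot w2 P = 0 & kdot (al i) P = 0].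
    by apply: dual_vector; rewrite det3_rot.
  have [Pc [Pc3 Pc1 Pc2]] : exists P, [/\ kdot w2 P = 1, kdot (al i) P = 0 & kdot w1 P = 0].
    by apply: dual_vector; rewrite -det3_rot.
  pose Q' := defpoly al (J :\ i).
  have QQ' : Q = lin (al i) * Q' by rewrite -defpolyU1 ?setD1K // !inE eqxx.
  have dvdQ' j : j \in J -> j != i -> dvdm (lin (al j)) Q'.
    move=> jJ ji; rewrite /Q' /defpoly (bigD1 j) /= ?inE ?ji //.
    exact/dvdm_mulr/dvdmm.
  have Da : D (Q *: const_field Pa).
    move=> j jJ; rewrite dotZ; apply: dvdm_mulr; rewrite /defpoly (bigD1 j) //=.
    exact/dvdm_mulr/dvdmm.
  have Dbc P : kdot (al i) P = 0 -> D (Q' *: const_field P).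
    move=> P0 j jJ; rewrite dotZ; have [->|ji] := eqVneq j i.
      by rewrite dot_const P0 mpolyC0 mulr0; apply: dvdm0.
    exact/dvdm_mulr/dvdQ'.
  have [N eN] := det3_span Da (Dbc _ Pb1) (Dbc _ Pc1).
  have eP : (det3 (al i) w1 w2)%:MP * det3 (const_field Pa) (const_field Pb) (const_field Pc) = 1 :> S.
    rewrite det3_dots !dot_const Pa1 Pa2 Pa3 Pb1 Pb2 Pb3 Pc1 Pc2 Pc3 !mpolyC1 !mpolyC0.
    by ring.
  exists ((det3 (al i) w1 w2)%:MP * N); apply: (mulfI (defpoly_neq0 alP J)).
  have -> : Q * ((det3 (al i) w1 w2)%:MP * N * G) = (det3 (al i) w1 w2)%:MP * (N * (G * Q)).
    by ring.
  rewrite -eG -eN det3Zl det3Zm det3Zr.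
  have -> (u v w z : S) : u * (v * (w * (w * z))) = (u * z) * (v * w ^+ 2) by ring.
  by rewrite eP mul1r.
have dvd2 i : i \in J -> ev0 G != 0 \/ exists2 j, j \in J :\ i & dvdm (lin (al j)) G.
  move=> /key; rewrite expr2 /defpoly -!big_enum /= -big_cat => /dvdm_prod_lin [|[j]].
    by left.
  by rewrite mem_cat !mem_enum orbb => jJ jG; right; exists j.
have /set0Pn [i iJ] := J0; have [//|[j jJi jG]] := dvd2 i iJ.
have jJ : j \in J by move: jJi; rewrite inE => /andP[].
have := dvdm_trans jG (key j jJ); have [jP0 jP] := primem_lin (al_neq0 alP j).
rewrite expr2 => H; have {H}jQ : dvdm (lin (al j)) (defpoly al (J :\ j)) by case/jP: H.
move: jQ; rewrite /defpoly -big_enum /=.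
move=> /(primem_prod (conj jP0 jP) (@lin_ndvdm1 _ _)) [k].
by rewrite mem_enum !inE => /andP[kj _] /(dvdm_lin_al alP) jk; rewrite jk eqxx in kj.
Qed.

(** Write the Euler field as p e1 + q e2 + r e3. If p, q, r all vanished at the origin, taking
    derivatives there would express the identity matrix through the values of e1, e2, e3, whose
    determinant is the value of G * Q, namely 0. *)
Lemma euler_replaces : exists th1 th2 G,
  [/\ D th1, D th2, det3 x th1 th2 = G * Q & ev0 G != 0].
Proof.
have [G eG] := defpoly_dvdm_det3 alP De1 De2 De3; have G0 := det3_basis_const eG.
have [p [q [r xE]]] := span (@logder_euler K T al J).
have [p0|p0] := eqVneq (ev0 p) 0; last first.
  exists e2, e3, (p * G); split=> //; last by rewrite mevalM mulf_neq0.
  by rewrite xE -mulrA -eG det3_coefl.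
have [q0|q0] := eqVneq (ev0 q) 0; last first.
  exists e3, e1, (q * G); split=> //; last by rewrite mevalM mulf_neq0.
  by rewrite (det3_rot e1) xE -mulrA -eG det3_coefm.
have [r0|r0] := eqVneq (ev0 r) 0; last first.
  exists e1, e2, (r * G); split=> //; last by rewrite mevalM mulf_neq0.
  by rewrite -(det3_rot x) xE -mulrA -eG det3_coefr.
pose ev th : 'rV[K]_3 := map_mx ev0 th.
have delta j : delta_mx 0 j = ev0 (p^`M(j)) *: ev e1 + ev0 (q^`M(j)) *: ev e2 + ev0 (r^`M(j)) *: ev e3.
  apply/rowP => k; have := congr1 (fun A : 'rV[S]_3 => ev0 (A 0 k)^`M(j)) xE.
  rewrite !mxE !mderivD !mderivM !mevalD !mevalM p0 q0 r0 !mul0r !addr0 => <-.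
  rewrite mderivX mevalZ mevalX mnmE; rewrite eq_sym.
  have [->|kj] := eqVneq k j; last by rewrite mul0r.
  rewrite mul1r big1 // => i _; rewrite mnmBE subnn expr0 //.
have : det3 (delta_mx 0 o0) (delta_mx 0 o1) (delta_mx 0 o2) = 1 :> K.
  by rewrite /det3 !mxE /=; ring.
rewrite !delta det3_comb.
have -> : det3 (ev e1) (ev e2) (ev e3) = ev0 (det3 e1 e2 e3).
  by rewrite /det3 !mxE mevalD mevalB !mevalM !mevalB !mevalM.
by rewrite eG mevalM ev0_defpoly !mulr0 => /eqP; rewrite eq_sym oner_eq0.
Qed.

Lemma free_exps_of_basis : exists a b, free_exps al J a b.
Proof.
have [th1 [th2 [G [D1 D2 e G0]]]] := euler_replaces.
exact: free_exps_of_euler_basis D1 D2 e G0.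
Qed.

End HomogeneousBasis.

(** * Derivations as vectors of coefficients *)

Import boolp classical_sets functions.

Section Derivations.
Variable R : realType.
Local Notation C := R[i].
Local Notation S := {mpoly C[3]}.
Implicit Types (w : 'rV[S]_3) (th : S -> S^o).

Definition der w : S -> S^o := fun p => \sum_k w 0 k * p^`M(k).
Definition vec th : 'rV[S]_3 := \row_k (th 'X_k : S).

Lemma der_is_derivation w : is_derivation (der w).
Proof.
split=> [a p q|p q]; rewrite /der.
  rewrite scaler_sumr -big_split; apply: eq_bigr => k _ /=.
  by rewrite mderivD mderivZ mulrDr scalerAr.
rewrite mulr_suml mulr_sumr -big_split; apply: eq_bigr => k _ /=.
by rewrite mderivM; ring.
Qed.

Lemma derK w : vec (der w) = w.
Proof.
apply/rowP => k; rewrite mxE /der (bigD1 k) //= big1 => [|l lk].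
  rewrite mderivX mnmE eqxx scale1r addr0.
  by rewrite (_ : (U_(k) - U_(k))%MM = 0%MM) ?mpolyX0 ?mulr1 //; apply/mnmP => l; rewrite mnmBE subnn mnm0E.
by rewrite mderivX mnmE eq_sym (negPf lk) scale0r mulr0.
Qed.

Lemma vecK th : is_derivation th -> der (vec th) = th.
Proof.
move=> [thL thM]; have thD p q : th (p + q) = th p + th q.
  by rewrite -[p in LHS]scale1r thL scale1r.
have th0 : th 0 = 0 by apply: (addrI (th 0)); rewrite -thD !addr0.
have thZ a p : th (a *: p) = a *: (th p : S).
  by rewrite -[_ *: p in LHS]addr0 thL th0 addr0.
have th1 : th 1 = 0.
  have := thM 1 1; rewrite !mulr1 mul1r => e; apply: (addrI (th 1)).
  by rewrite addr0 -e.
have [dL dM] := der_is_derivation (vec th).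
have dD p q : der (vec th) (p + q) = der (vec th) p + der (vec th) q.
  by rewrite -[p in LHS]scale1r dL scale1r.
have d0 : der (vec th) 0 = 0 by apply: (addrI (der (vec th) 0)); rewrite -dD !addr0.
have dZ a p : der (vec th) (a *: p) = a *: (der (vec th) p : S).
  by rewrite -[_ *: p in LHS]addr0 dL d0 addr0.
have d1 : der (vec th) 1 = 0.
  have := dM 1 1; rewrite !mulr1 mul1r => e; apply: (addrI (der (vec th) 1)).
  by rewrite addr0 -e.
have dX k : der (vec th) 'X_k = th 'X_k.
  by have := derK (vec th) => /rowP/(_ k); rewrite !mxE.
apply/funext => p; elim/mpolyind: p => [|a m p _ _ IH]; first by rewrite th0 d0.
rewrite thD dD IH thZ dZ; suff -> : der (vec th) 'X_[m] = th 'X_[m] by [].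
rewrite mpolyXE_id {p IH}; elim/big_rec: _ => [|k p _ IH]; first by rewrite th1 d1.
suff e : der (vec th) ('X_k ^+ m k) = th ('X_k ^+ m k) by rewrite thM dM IH e.
elim: (m k) => [|j e]; first by rewrite expr0 th1 d1.
by rewrite exprS thM dM e dX.
Qed.

Lemma vec_sum (s : seq (S -> S^o)) (c : (S -> S^o) -> S) :
  vec (\sum_(b <- s) c b *: b) = \sum_(b <- s) c b *: vec b.
Proof.
apply/rowP => k; rewrite mxE summxE fct_sumE; apply: eq_bigr => b _.
by rewrite !mxE.
Qed.

Lemma derivation_lin th u : is_derivation th -> th (lin u) = dot u (vec th).
Proof.
move=> [thL _]; have th0 : th 0 = 0.
  by have := thL (-1) 0 0; rewrite scaler0 addr0 scaleN1r addNr.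
rewrite linE /dot; elim/big_rec2: _ => [//|k p q _ IH].
by rewrite mul_mpolyC thL IH mxE mul_mpolyC.
Qed.

Lemma homog1_lin (p : S) : p \is 1.-homog -> exists u, p = lin u.
Proof.
move=> /dhomogP hp; exists (\row_k p@_U_(k)); apply/mpolyP => m; rewrite linE raddf_sum /=.
have [/mdeg1P [i /eqP ->]|m1] := boolP (mdeg m == 1%N).
  rewrite (bigD1 i) //= mcoeffCM mxE mcoeffX eqxx mulr1 big1 ?addr0 // => l li.
  rewrite mcoeffCM mcoeffX; case: eqP => [/mnmP/(_ l)|]; last by rewrite mulr0.
  by rewrite !mnm1E eqxx eq_sym (negPf li).
rewrite big1 => [|k _].
  by apply: memN_msupp_eq0; apply: contra m1 => /hp /eqP.
rewrite mcoeffCM mcoeffX; case: eqP => [e|]; last by rewrite mulr0.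
by rewrite -e mdeg1 in m1.
Qed.

(** A linear form is determined up to a constant by its kernel. *)
Lemma kernel_prop (u w : 'rV[C]_3) : u != 0 ->
  (forall v, kdot u v = 0 -> kdot w v = 0) -> exists t, w = t *: u.
Proof.
move=> /exists_kdot1 [v uv] h; exists (kdot w v).
apply/rowP => k; rewrite mxE.
have := h (delta_mx 0 k - u 0 k *: v); rewrite !(kdotC _ (_ - _)) !kdotBl !kdotZl.
rewrite ![kdot (delta_mx _ _) _]kdotC !kdot_delta ![kdot v _]kdotC uv mulr1 subrr => /(_ erefl)/eqP.
by rewrite subr_eq0 mulrC => /eqP.
Qed.

Local Notation subspace := {vspace 'rV[C]_3}.

Lemma covector (H : subspace) : \dim H = 2%N -> exists u, u != 0 /\
  forall v, (v \in H) = (kdot u v == 0).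
Proof.
move=> dH; have [s [ss sb]] : exists s, size s = 2%N /\ basis_of H s.
  by exists (vbasis H); split; [rewrite size_tuple|apply: vbasisP].
case: s ss sb => [|v1 [|v2 []]] //= _ /andP[/eqP HE].
rewrite free_cons span_seq1 => /andP[v12].
rewrite free_cons span_nil memv0 => /andP[v20 _].
have v1v2 t : v1 != t *: v2 by apply: contraNneq v12 => ->; apply/memvZ/memv_line.
pose u : 'rV[C]_3 := \row_k det3 (delta_mx 0 k) v2 v1.
have uE y : kdot u y = det3 v2 v1 y.
  by rewrite /kdot sum3 !mxE /det3 !mxE /=; ring.
exists u; split.
  have [y d0] := det3_neq0 v20 v1v2.
  by apply: contraNneq d0 => u0; rewrite -uE u0 /kdot big1 // => k _; rewrite mxE mul0r.
move=> v; rewrite uE -HE; apply/idP/(det3_eq0P _ v20 v1v2).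
  rewrite span_cons span_seq1 => /memv_addP [_ /vlineP [t ->]] [_ /vlineP [r ->] ->].
  by exists r, t; rewrite addrC.
move=> [r [t ->]]; apply: memvD; apply/memvZ/memv_span; rewrite !inE eqxx ?orbT //.
Qed.

End Derivations.

(** The arrangement A is enumerated without repetition by [pl], with covectors [al]. *)
Section LogDerivations.
Variable R : realType.
Local Notation C := R[i].
Local Notation S := {mpoly C[3]}.
Local Notation subspace := {vspace 'rV[C]_3}.
Local Notation x := (euler C).
Variables (T : finType) (pl : T -> subspace) (al : T -> 'rV[C]_3) (A : {fset subspace}).
Hypothesis plA : forall H, H \in A <-> exists i, pl i = H.
Hypothesis pl_inj : injective pl.
Hypothesis al0 : forall i, al i != 0.
Hypothesis alE : forall i v, (v \in pl i) = (kdot (al i) v == 0).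

Lemma covectors_nonproportional : nonproportional al.
Proof.
split=> // i j t e; apply: pl_inj; apply/vspaceP => v; rewrite !alE e kdotZl mulf_eq0.
have t0 : t != 0 by apply: contraNneq (al0 j) => t0; rewrite e t0 scale0r.
by rewrite (negPf t0).
Qed.

Lemma lin_form_of i : linear_form_of (pl i) (lin (al i)).
Proof. by split=> [|v]; [apply: lin_homog|rewrite alE meval_lin]. Qed.

Lemma linear_form_ofE i (p : S) : linear_form_of (pl i) p -> exists t, p = lin (t *: al i).
Proof.
move=> [/homog1_lin [w ->] h]; have [|t ->] := @kernel_prop _ (al i) w (al0 i); last by exists t.
by move=> v /eqP; rewrite -alE h meval_lin => /eqP.
Qed.

Lemma log_derivationsE (th : S -> S^o) :
  log_derivations A th <-> is_derivation th /\ logder al [set: T] (vec th).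
Proof.
split=> [[dth h]|[dth h]]; split=> //.
  move=> i _; have iA : pl i \in A by apply/plA; exists i.
  have [q e] := h _ iA _ (lin_form_of i).
  by exists q; rewrite -derivation_lin // e mulrC.
move=> H /plA [i <-] p /linear_form_ofE [t ->].
have [q e] := h i (finset.in_setT i).
by exists q; rewrite derivation_lin // dotZl e linZ; ring.
Qed.

Lemma der_log (w : 'rV[S]_3) : logder al [set: T] w -> log_derivations A (der w).
Proof. by move=> h; apply/log_derivationsE; rewrite derK; split=> //; apply: der_is_derivation. Qed.

(** The Euler field and the two given fields are a basis by [saito]; they are independent because
    their determinant is not 0. *)
Lemma free_arrangement_of_exps a b : free_exps al [set: T] a b -> free_arrangement A.
Proof.
move=> [th1 [th2 [t [[L1 h1] [L2 h2] t0 detE]]]].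
have alP := covectors_nonproportional; have Q0 := defpoly_neq0 alP [set: T].
have d0 : det3 x th1 th2 != 0 by rewrite detE mulf_neq0 // mpolyC_eq0.
have neq (u v : 'rV[S]_3) : u <> v -> der u != der v.
  by move=> uv; apply/eqP => e; apply: uv; rewrite -[u]derK e derK.
have n1 : der th1 != der x.
  by apply: neq => e; move: d0; rewrite e det3_aab eqxx.
have n2 : der th2 != der x.
  by apply: neq => e; move: d0; rewrite e det3_aba eqxx.
have n12 : der th2 != der th1.
  by apply: neq => e; move: d0; rewrite e det3_abb eqxx.
pose s3 := [:: der x; der th1; der th2].
have us3 : uniq s3 by rewrite /= !inE negb_or ![der x == _]eq_sym n1 n2 eq_sym n12.
exists [set` s3]%classic; split.
- move=> th; rewrite /mkset /s3 !inE => /or3P [] /eqP ->; apply: der_log => //.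
  exact: logder_euler.
- move=> th /log_derivationsE [dth Lth].
  have [p [q [r [e _ _ _]]]] := saito alP (@logder_euler _ _ al _) L1 L2 t0 detE Lth.
  exists s3, (fun b => if b == der x then p else if b == der th1 then q else r).
  split=> //; rewrite -(vecK dth) e /s3 !big_cons big_nil addr0 eqxx (negPf n1) (negPf n2).
  rewrite eqxx (negPf n12); apply/funext => f.
  rewrite /der !fctE /= !scaler_sumr -!big_split; apply: eq_bigr => k _ /=.
  have sE (u v : S) : u *: (v : S^o) = u * v by [].
  by rewrite !sE !mxE !mulrDl !mulrA addrA.
move=> s c us ss /(congr1 (@vec R)); rewrite vec_sum => e.
have e3 : \sum_(b <- s3) (if b \in s then c b else 0) *: vec b = 0.
  transitivity (\sum_(b <- s) c b *: vec b); last first.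
    by rewrite e; apply/rowP => k; rewrite !mxE.
  rewrite [RHS](perm_big (filter (mem s) s3)); last first.
    apply: uniq_perm => //; first exact: filter_uniq.
    by move=> y; rewrite mem_filter; apply/idP/andP => [ys|[]//]; split; [exact: ys|exact: (ss y ys)].
  rewrite big_filter [RHS]big_mkcond /=; apply: eq_bigr => y _.
  by case: ifP => //; rewrite scale0r.
have [cc ccE {}e3] : exists2 cc : (S -> S^o) -> S, (forall b, b \in s -> cc b = c b) &
    cc (der x) *: x + cc (der th1) *: th1 + cc (der th2) *: th2 = 0.
  exists (fun b => if b \in s then c b else 0); first by move=> y ->.
  rewrite -[RHS]e3 /s3 big_cons big_cons big_cons big_nil.
  by rewrite (derK x) (derK th1) (derK th2) addr0 addrA.
have [p px] : exists p, cc (der x) = p by eexists.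
have [q qx] : exists q, cc (der th1) = q by eexists.
have [r rx] : exists r, cc (der th2) = r by eexists.
rewrite px qx rx in e3.
have z0 y : y * det3 x th1 th2 = 0 -> y = 0.
  by move/eqP; rewrite mulf_eq0 (negPf d0) orbF => /eqP.
have p0 : p = 0.
  by apply: z0; rewrite -(det3_coefl p q r) e3 -[0 in LHS](scale0r 0) det3Zl mul0r.
have q0 : q = 0.
  by apply: z0; rewrite -(det3_coefm p q r) e3 -[0 in LHS](scale0r 0) det3Zm mul0r.
have r0 : r = 0.
  by apply: z0; rewrite -(det3_coefr p q r) e3 -[0 in LHS](scale0r 0) det3Zr mul0r.
move=> y ys; rewrite -ccE //; move: (ss y ys); rewrite /mkset !inE.
by move=> /or3P [] /eqP ->; rewrite (px, qx, rx).
Qed.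

Lemma exps_of_free_arrangement : [set: T] != finset.set0 -> free_arrangement A ->
  exists a b, free_exps al [set: T] a b.
Proof.
move=> T0 [Bs [BsA Bspan Bindep]].
have alP := covectors_nonproportional; have Q0 := defpoly_neq0 alP [set: T].
have BsD b : Bs b -> is_derivation b /\ logder al [set: T] (vec b).
  by move/BsA/log_derivationsE.
have vec0 : vec (0 : S -> S^o) = 0 by apply/rowP => k; rewrite !mxE.
have spanD w : logder al [set: T] w -> in_span Bs (@vec R) w.
  move=> /der_log/Bspan [s [c [sB e]]]; exists s, c; split=> //.
  by rewrite -vec_sum -e derK.
have indepD (s : seq (S -> S^o)) (c : (S -> S^o) -> S) : uniq s ->
    (forall b, b \in s -> Bs b) -> \sum_(b <- s) c b *: vec b = 0 ->
    forall b, b \in s -> c b = 0.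
  move=> us sB e; apply: Bindep => //; rewrite -vec_sum in e.
  have ds : is_derivation (\sum_(b <- s) c b *: b).
    rewrite -(_ : der (\sum_(b <- s) c b *: vec b) = \sum_(b <- s) c b *: b).
      exact: der_is_derivation.
    apply/funext => p; rewrite fct_sumE /der.
    under eq_bigr => k _ do rewrite summxE mulr_suml.
    rewrite exchange_big big_seq [RHS]big_seq; apply: eq_bigr => b bs /=.
    have [db _] := BsD b (sB b bs); have -> : (c b *: b) p = c b *: (der (vec b) p : S^o) by rewrite vecK.
    rewrite /der scaler_sumr.
    have sE (u v : S) : u *: (v : S^o) = u * v by [].
    by apply: eq_bigr => k _; rewrite sE mxE mulrA.
  rewrite -(vecK ds) e; apply/funext => p.
  by rewrite /der big1 // => k _; rewrite mxE mul0r.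
have char0 m n : m%:R = n%:R :> S -> m = n.
  by move=> /(congr1 (meval (fun=> 0 : C))); rewrite !rmorph_nat => /eqP; rewrite eqr_nat => /eqP.
have [|b1 [b2 [b3 [B1 B2 B3 sp]]]] := basis_three char0 indepD Q0.
  move=> k; apply: spanD => i _; rewrite dotZ; apply: dvdm_mulr.
  by rewrite /defpoly (bigD1 i) //=; apply/dvdm_mulr/dvdmm.
apply: (@free_exps_of_basis _ _ al [set: T] alP T0 (vec b1) (vec b2) (vec b3)).
- by have [] := BsD _ B1.
- by have [] := BsD _ B2.
- by have [] := BsD _ B3.
by move=> w /spanD/sp.
Qed.

End LogDerivations.

(** * Lattice isomorphisms and concurrency *)

Section Lattice.
Local Open Scope fset_scope.
Variable R : realType.
Local Notation C := R[i].
Local Notation subspace := {vspace 'rV[C]_3}.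
Implicit Types (A : {fset subspace}) (H X : subspace).

Lemma mem_latticeP A X : reflect
  (exists2 D : {fset subspace}, D `<=` A & X = (\bigcap_(H <- enum_fset D) H)%VS)
  (X \in intersection_lattice A).
Proof.
rewrite /intersection_lattice; apply: (iffP (imfsetP _ _ _ _)) => [[D /= DA ->]|[D DA ->]]; exists D => //; first by rewrite fpowersetE in DA.
by rewrite /= fpowersetE.
Qed.

Lemma sub_bigcap_seq (s : seq subspace) X :
  (X <= \bigcap_(H <- s) H)%VS = all (fun H => (X <= H)%VS) s.
Proof.
elim: s => [|H s IH]; first by rewrite big_nil subvf.
by rewrite big_cons subv_cap IH.
Qed.

Lemma bigcap_sub_mem (s : seq subspace) H : H \in s -> (\bigcap_(H <- s) H <= H)%VS.
Proof. by move=> Hs; have := subvv (\bigcap_(H <- s) H)%VS; rewrite sub_bigcap_seq => /allP; apply. Qed.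

Lemma lattice_full A : fullv \in intersection_lattice A.
Proof. by apply/mem_latticeP; exists fset0; rewrite ?fsub0set // big_nil. Qed.

Lemma lattice_line A H : H \in A -> H \in intersection_lattice A.
Proof.
move=> HA; apply/mem_latticeP; exists [fset H]; first by rewrite fsub1set.
by apply/eqP; rewrite eqEsubv bigcap_sub_mem ?inE // sub_bigcap_seq andbT;
   apply/allP => X; rewrite inE => /eqP ->.
Qed.

Lemma lattice_cap A X Y : X \in intersection_lattice A -> Y \in intersection_lattice A ->
  (X :&: Y)%VS \in intersection_lattice A.
Proof.
move=> /mem_latticeP [D DA ->] /mem_latticeP [E EA ->]; apply/mem_latticeP.
exists (D `|` E); first by rewrite fsubUset DA EA.
apply/eqP; rewrite eqEsubv; apply/andP; split.
  rewrite sub_bigcap_seq; apply/allP => H; rewrite in_fsetU => /orP[] HD.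
    exact: subv_trans (capvSl _ _) (bigcap_sub_mem HD).
  exact: subv_trans (capvSr _ _) (bigcap_sub_mem HD).
by rewrite subv_cap !sub_bigcap_seq; apply/andP; split; apply/allP => H HD;
  apply: bigcap_sub_mem; rewrite in_fsetU HD ?orbT.
Qed.

Lemma lattice_below A X : X \in intersection_lattice A -> X != fullv ->
  exists2 H, H \in A & (X <= H)%VS.
Proof.
move=> /mem_latticeP [D DA ->]; case: (fset_0Vmem D) => [->|[H HD] _].
  by rewrite big_nil eqxx.
by exists H; [apply: (fsubsetP DA)|apply: bigcap_sub_mem].
Qed.

Lemma line_neq_full H : \dim H = 2%N -> H != fullv.
Proof.
by move=> dH; apply/eqP => HE; move: dH; rewrite HE dimvf dim_matrix.
Qed.

Section Iso.
Variables (A A' : {fset subspace}).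
Hypotheses (lA : line_arrangement A) (lA' : line_arrangement A').
Variables (f : intersection_lattice A -> intersection_lattice A')
          (g : intersection_lattice A' -> intersection_lattice A).
Hypotheses (fK : cancel f g) (gK : cancel g f).
Hypothesis fle : forall Z W, (val (f Z) <= val (f W))%VS = (val Z <= val W)%VS.

Lemma iso_full (X : intersection_lattice A) : (val (f X) == fullv) = (val X == fullv).
Proof.
apply/eqP/eqP => e.
  apply/eqP; rewrite eqEsubv subvf /=.
  by have := fle [` lattice_full A] X; rewrite e subvf => <-.
apply/eqP; rewrite eqEsubv subvf /=.
have := fle (g [` lattice_full A']) X; rewrite gK /= => ->.
by rewrite e subvf.
Qed.

(** A line is sent to a proper element of the lattice, which lies in a line H'. The inverse image of
    H' is proper and contains the original line, hence equals it by dimension. *)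
Lemma iso_line (H : A) : exists H' : A', val H' = val (f [` lattice_line (valP H)]).
Proof.
set X := [` lattice_line (valP H)].
have XE : val X = val H by [].
have fX : val (f X) != fullv by rewrite iso_full XE; apply: line_neq_full; exact: lA (valP H).
have [H' H'A' le1] := lattice_below (valP (f X)) fX.
pose Y := g [` lattice_line H'A'].
have fY : val (f Y) = H' by rewrite gK.
have Yn : val Y != fullv by rewrite -iso_full fY; apply: line_neq_full; exact: lA' H'A'.
have [H2 H2A le2] := lattice_below (valP Y) Yn.
have le3 : (val X <= val Y)%VS by rewrite -fle fY.
have eH : val H = H2.
  apply/eqP; rewrite eqEdim (lA H2A) (lA (valP H)) leqnn andbT.
  exact: subv_trans le3 le2.
have XY : X = Y.
  by apply/val_inj/eqP; rewrite eqEsubv le3 /= eH.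
by exists [` H'A']; rewrite /= XY fY.
Qed.

(** Intersections of two lines belong to the lattice and are infima for inclusion, and infima are
    preserved. *)
Lemma iso_meet (H1 H2 H3 : A) (H1' H2' H3' : A') :
  val H1' = val (f [` lattice_line (valP H1)]) ->
  val H2' = val (f [` lattice_line (valP H2)]) ->
  val H3' = val (f [` lattice_line (valP H3)]) ->
  (val H1' :&: val H2' <= val H3')%VS = (val H1 :&: val H2 <= val H3)%VS.
Proof.
move=> e1 e2 e3; apply/idP/idP => le.
  pose X := [` lattice_cap (lattice_line (valP H1)) (lattice_line (valP H2))].
  have := fle X [` lattice_line (valP H3)]; rewrite /= => <-; rewrite -e3.
  apply: subv_trans le; rewrite subv_cap e1 e2 !fle /=.
  by rewrite capvSl capvSr.
pose X := g [` lattice_cap (lattice_line (valP H1')) (lattice_line (valP H2'))].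
have fX : val (f X) = (val H1' :&: val H2')%VS by rewrite gK.
rewrite -fX e3 fle /=; apply: subv_trans le; rewrite subv_cap.
have := fle X [` lattice_line (valP H1)]; rewrite fX -e1 capvSl /= => <-.
by have := fle X [` lattice_line (valP H2)]; rewrite fX -e2 capvSr /= => <-.
Qed.

End Iso.

Lemma lattice_iso_lines A A' : line_arrangement A -> line_arrangement A' ->
  lattice_isomorphic A A' -> exists s : A -> A', bijective s /\
    forall i j k : A, (val (s i) :&: val (s j) <= val (s k))%VS =
                      (val i :&: val j <= val k)%VS.
Proof.
move=> lA lA' [f [g fK gK] fle0].
have fle Z W : (val (f Z) <= val (f W))%VS = (val Z <= val W)%VS by apply: fle0.
have gle Z W : (val (g Z) <= val (g W))%VS = (val Z <= val W)%VS by rewrite -fle !gK.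
have [s sE] := fin_all_exists (iso_line lA lA' gK fle).
have [t tE] := fin_all_exists (iso_line lA' lA fK gle).
exists s; split; last by move=> i j k; apply: (iso_meet gK fle).
exists t => i; apply: val_inj.
  rewrite tE (_ : [` lattice_line (valP (s i))] = f [` lattice_line (valP i)]) ?fK //.
  by apply: val_inj => /=; rewrite sE.
rewrite sE (_ : [` lattice_line (valP (t i))] = g [` lattice_line (valP i)]) ?gK //.
by apply: val_inj => /=; rewrite tE.
Qed.

(** If the three covectors are independent, the vector dual to the third one lies in the first two
    planes but not in the third. *)
Lemma pencil_meet (T : finType) (pl : T -> subspace) (al : T -> 'rV[C]_3) i j k :
  nonproportional al -> (forall i v, (v \in pl i) = (kdot (al i) v == 0)) -> i != j ->
  (k \in pencil al i j) = (pl i :&: pl j <= pl k)%VS.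
Proof.
move=> alP alE ij; apply/idP/idP => [/(mem_pencilP alP _ ij) [s [t e]]|/subvP le].
  apply/subvP => v; rewrite memv_cap !alE => /andP[/eqP vi /eqP vj].
  by rewrite e kdotDl !kdotZl vi vj !mulr0 addr0.
rewrite /pencil inE; apply/negPn/negP; rewrite -det3_rot -det3_rot => /dual_vector [P [Pk Pi Pj]].
have := le P; rewrite memv_cap !alE Pk Pi Pj eqxx => /(_ isT).
by rewrite oner_eq0.
Qed.

End Lattice.

Local Open Scope fset_scope.

Theorem corollary7p5 (R : realType) (B B' : {fset {vspace 'rV[R[i]]_3}}) :
  line_arrangement B -> line_arrangement B' ->
  (#|` B| < 11)%N -> (#|` B'| < 11)%N ->
  lattice_isomorphic B B' ->
  free_arrangement B -> free_arrangement B'.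
Proof.
move=> lB lB' cB _ /(lattice_iso_lines lB lB') [s [[t sK tK] sE]] freeB.
have [B0|[H0 H0B]] := fset_0Vmem B.
  suff -> : B' = B by [].
  have noB H : (H \in B) = false by rewrite B0 in_fset0.
  apply/fsetP => H; rewrite noB; apply/negP => HB'.
  by have := valP (t [` HB']); rewrite noB.
have cov (H : B) := covector (lB _ (valP H)).
have [al alP] := fin_all_exists cov.
have cov' (H : B) := covector (lB' _ (valP (s H))).
have [al' alP'] := fin_all_exists cov'.
have np : nonproportional al := covectors_nonproportional val_inj (fun i => (alP i).1) (fun i => (alP i).2).
have s_inj : injective (fun i => val (s i)) by apply/(inj_comp val_inj)/(can_inj sK).
have np' : nonproportional al' := covectors_nonproportional s_inj (fun i => (alP' i).1) (fun i => (alP' i).2).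
have plB H : H \in B <-> exists i : B, val i = H.
  by split=> [HB|[i <-]]; [exists [` HB]|apply: valP].
have plB' H : H \in B' <-> exists i : B, val (s i) = H.
  by split=> [HB|[i <-]]; [exists (t [` HB]); rewrite tK|apply: valP].
have T0 : [set: B]%SET != finset.set0 by apply/set0Pn; exists [` H0B]; rewrite finset.in_setT.
have [a [b F]] := exps_of_free_arrangement plB val_inj (fun i => (alP i).1) (fun i => (alP i).2) T0 freeB.
apply: (free_arrangement_of_exps plB' s_inj (fun i => (alP' i).1) (fun i => (alP' i).2) (a := a) (b := b)).
apply: (free_exps_combinatorial _ np np' _ _ F).
- by rewrite pnatr_eq0.
- move=> i j ij; apply/setP => k.
  rewrite (pencil_meet k np (fun i => (alP i).2) ij).
  by rewrite (@pencil_meet _ _ (fun i => val (s i)) al' i j k np' (fun i => (alP' i).2) ij) sE.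
by rewrite cardsT -cardfE.
Qed.
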